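(* Let $w$ be the solution of the closed-loop system described in the context, and suppose that assumptions (A1) and (A2) of the context hold. Let $0\le\alpha\le\frac12\min\{\nu,\delta,c_0+w_d,c_1+w_d\}$ be such that $\beta=\min\{\nu-2\alpha,\delta-2\alpha,c_0+w_d-2\alpha,c_1+w_d-2\alpha\}>0$. Then there is a constant $C>0$, independent of $t$ (it may depend on norms of $w_0$), such that for all $t>0$ $$\|w\|_2^2+\|w_t\|_1^2+\|z\|^2+E(t)+E_2(t)+e^{-2\alpha t}\int_0^te^{2\alpha s}\Big(\||w(s)|\|^2+\|w_t(s)\|_2^2+\|w(s)\|_2^2\Big)ds$$ $$\qquad+e^{-2\alpha t}\int_0^te^{2\alpha s}\Big(\|z(s)\|^2+E_1(s)+w^4(1,s)+w^4(0,s)\Big)ds\le Ce^{-2\alpha t}\|w_0\|_3^2,$$ where $E(t)=\sum_{i=0}^1\big((c_i+w_d)w^2(i,t)+\frac{1}{9c_i}w^4(i,t)\big)$, $E_1(t)=\sum_{i=0}^1\big((c_i+w_d)w_t^2(i,t)+\frac{4}{3c_i}w_t^2(i,t)w^2(i,t)\big)$ and $E_2(t)=\sum_{i=0}^1\big((c_i+w_d)w_t^2(i,t)+\frac{2}{3c_i}w_t^2(i,t)w^2(i,t)\big)$.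
   Context: Notation: $(\cdot,\cdot)$ and $\|\cdot\|$ are the inner product and norm of $L^2(0,1)$; $\|\cdot\|_m$ is the norm of the Sobolev space $H^m(0,1)$; $\||f|\|:=\sqrt{\|f_x\|^2+f^2(0)+f^2(1)}$. Parameters: $\nu,\rho,\delta,c_0,c_1>0$ and $w_d\ge 0$ are constants. $C$ is a generic positive constant. Closed-loop system: for $x\in(0,1)$, $t>0$, $$w_t-\nu w_{xx}+ww_x+w_dw_x=\rho z_x,\qquad z_t+\delta z=w_x,$$ $w_x(0,t)=v_0(t)$, $w_x(1,t)=v_1(t)$, $w(x,0)=w_0(x)$, $z(x,0)=0$, so that $z(x,t)=\int_0^te^{-\delta(t-s)}w_x(x,s)\,ds$, with feedback laws $$v_0(t)=\tfrac1\nu\Big((c_0+w_d)w(0,t)+\tfrac{2}{9c_0}w^3(0,t)-\rho z(0,t)\Big),\qquad v_1(t)=-\tfrac1\nu\Big((c_1+w_d)w(1,t)+\tfrac{2}{9c_1}w^3(1,t)+\rho z(1,t)\Big).$$ Weak form: for all $\phi\in H^1(0,1)$, $$(w_t,\phi)+\nu(w_x,\phi_x)+w_d(w_x,\phi)+(ww_x,\phi)+\rho(z,\phi_x)+\sum_{i=0}^1\Big((c_i+w_d)w(i,t)+\tfrac{2}{9c_i}w^3(i,t)\Big)\phi(i)=0,\quad w(\cdot,0)=w_0.$$ Assumption (A1): $w_0\in H^3(0,1)$ and the compatibility conditions $w_{0x}(0)=v_0(0)$, $w_{0x}(1)=v_1(0)$, $w_{0xt}(0)=v_{0t}(0)$,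 $w_{0xt}(1)=v_{1t}(0)$ hold at $t=0$ (here $w_{0xt}(i)$ means $w_{xt}(i,0)$). Assumption (A2): for $w_0\in H^3(0,1)$ there is a unique weak solution $w$ and it satisfies, with a positive constant $C$, $\|w\|_2^2+\|w_t\|_1^2+\|z\|^2+\int_0^t(\||w(s)|\|^2+\|w_t(s)\|_2^2+\|z(s)\|^2)ds\le C\|w_0\|_3^2$. *)

(* Defs.v *)
From HB Require Import structures.
From mathcomp Require Import all_boot all_order all_algebra.
From mathcomp Require Import all_classical all_reals all_analysis.

Set Implicit Arguments.
Unset Strict Implicit.
Unset Printing Implicit Defensive.

Import Order.TTheory GRing.Theory Num.Theory.
Import numFieldNormedType.Exports.

Local Open Scope classical_set_scope.
Local Open Scope ring_scope.

Section Sobolev.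
Context {R : realType}.
Implicit Types (f g phi : R -> R) (m : nat).

Local Notation mu := (@lebesgue_measure R).
Local Notation I := (`]0%R, 1%R[%classic : set R).

(* Elements of L^2(0,1) and H^m(0,1) are represented by functions R -> R,
   whose values outside [0,1] are irrelevant. *)

Definition L2 f : Prop :=
  measurable_fun I f /\ mu.-integrable I (fun x => (f x ^+ 2)%:E).

Definition dot f g : R := \int[mu]_(x in I) (f x * g x).

Definition L2norm f : R := Num.sqrt (dot f f).

(* C^1 functions with compact support in (0,1) *)
Definition test_function phi : Prop :=
  [/\ forall x, derivable phi x 1,
      continuous (derive1 phi) &
      exists a b : R, [/\ 0 < a, b < 1 &
        forall x, ~~ (a <= x <= b) -> phi x = 0]].

Definition weak_derivative f g : Prop :=
  L2 g /\
  forall phi, test_function phi -> dot f (derive1 phi) = - dot g phi.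

(* [sobolev m f] : f belongs to H^m(0,1) *)
Fixpoint sobolev m f : Prop :=
  if m is m'.+1 then
    L2 f /\ exists g, weak_derivative f g /\ sobolev m' g
  else L2 f.

(* A representative of the weak derivative (unique up to null sets); the
   default value 0 is only taken when f has no weak derivative in L^2. *)
Definition wderiv f : R -> R :=
  xget (fun=> 0) [set g | weak_derivative f g].

Definition Hnorm m f : R :=
  Num.sqrt (\sum_(k < m.+1) L2norm (iter k wderiv f) ^+ 2).

(* Point values of an H^1 function are those of its continuous
   representative. *)
Definition cont01 f : Prop := {within `[0, 1], continuous f}.

Definition tnorm f : R :=
  Num.sqrt (L2norm (wderiv f) ^+ 2 + f 0 ^+ 2 + f 1 ^+ 2).

(* One-sided classical derivatives. *)
Definition right_derivative f (a d : R) : Prop :=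
  h^-1 * (f (a + h) - f a) @[h --> 0^'+] --> d.

Definition left_derivative f (a d : R) : Prop :=
  h^-1 * (f (a + h) - f a) @[h --> 0^'-] --> d.

(* [u t] is a time-dependent function on (0,1), defined for t >= 0; g is its
   time derivative at t as an L^2(0,1)-valued function (from the right if
   t = 0). Only meaningful when all [u s], s >= 0, are in L^2. *)
Definition time_derivative (u : R -> R -> R) (t : R) g : Prop :=
  L2 g /\
  L2norm (fun x => h^-1 * (u (t + h) x - u t x) - g x)
    @[h --> within [set h | 0 <= t + h] 0^'] --> (0 : R).

End Sobolev.

Record params (R : realType) := Params {
  nu : R; rho : R; delta : R; c0 : R; c1 : R; wd : R }.

Section ClosedLoop.
Context {R : realType}.
Variable p : params R.
Implicit Types (w wt z : R -> R -> R).

Local Notation mu := (@lebesgue_measure R).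

(* All time-dependent functions take time first: [w t x] is w(x,t). *)

Definition admissible_params : Prop :=
  [/\ 0 < nu p, 0 < rho p & 0 < delta p] /\
  [/\ 0 < c0 p, 0 < c1 p & 0 <= wd p].

(* The sum over i = 0, 1 of F c_i i *)
Definition bsum (F : R -> R -> R) : R := F (c0 p) 0 + F (c1 p) 1.

Definition v0 w z (t : R) : R :=
  (nu p)^-1 * ((c0 p + wd p) * w t 0 + 2 / (9 * c0 p) * w t 0 ^+ 3
               - rho p * z t 0).

Definition v1 w z (t : R) : R :=
  - (nu p)^-1 * ((c1 p + wd p) * w t 1 + 2 / (9 * c1 p) * w t 1 ^+ 3
                 + rho p * z t 1).

(* wt is the time derivative of w; z solves z_t + delta z = w_x, z(.,0) = 0. *)
Record weak_solution (w0 : R -> R) w wt z : Prop := {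
  ws_w : forall t : R, 0 <= t -> sobolev 1 (w t) /\ cont01 (w t);
  ws_wt : forall t : R, 0 <= t -> time_derivative w t (wt t);
  ws_z : forall t : R, 0 <= t -> L2 (z t);
  ws_zt : forall t : R, 0 <= t ->
    time_derivative z t (fun x => wderiv (w t) x - delta p * z t x);
  ws_w_init : forall x : R, 0 <= x <= 1 -> w 0 x = w0 x;
  ws_z_init : forall x : R, 0 <= x <= 1 -> z 0 x = 0;
  ws_eq : forall t : R, 0 < t -> forall phi, sobolev 1 phi -> cont01 phi ->
    dot (wt t) phi + nu p * dot (wderiv (w t)) (wderiv phi)
    + wd p * dot (wderiv (w t)) phi
    + dot (fun x => w t x * wderiv (w t) x) phi
    + rho p * dot (z t) (wderiv phi)
    + bsum (fun c i =>
        ((c + wd p) * w t i + 2 / (9 * c) * w t i ^+ 3) * phi i) = 0 }.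

(* Here w_xt(i,0) is read as the x-derivative at i of w_t(.,0). *)
Record assumption_A1 (w0 : R -> R) w wt z : Prop := {
  A1_w0 : sobolev 3 w0;
  A1_cont : cont01 w0;
  A1_left : right_derivative w0 0 (v0 w z 0);
  A1_right : left_derivative w0 1 (v1 w z 0);
  A1_left_t : exists d,
    right_derivative (wt 0) 0 d /\ right_derivative (v0 w z) 0 d;
  A1_right_t : exists d,
    left_derivative (wt 0) 1 d /\ right_derivative (v1 w z) 0 d }.

(* K is the constant of the estimate. *)
Record assumption_A2 (K : R) (w0 : R -> R) w wt z : Prop := {
  A2_solution : weak_solution w0 w wt z;
  A2_unique : forall w' wt' z', weak_solution w0 w' wt' z' ->
    forall t x : R, 0 <= t -> 0 <= x <= 1 -> w' t x = w t x;
  A2_w : forall t : R, 0 <= t -> sobolev 2 (w t);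
  A2_wt : forall t : R, 0 <= t -> sobolev 1 (wt t);
  A2_wt2 : {ae mu, forall s : R, 0 < s -> sobolev 2 (wt s)};
  A2_bound : forall t : R, 0 <= t ->
    ((Hnorm 2 (w t) ^+ 2 + Hnorm 1 (wt t) ^+ 2 + L2norm (z t) ^+ 2)%:E
     + \int[mu]_(s in `[0%R, t])
         (tnorm (w s) ^+ 2 + Hnorm 2 (wt s) ^+ 2 + L2norm (z s) ^+ 2)%:E
     <= (K * Hnorm 3 w0 ^+ 2)%:E)%E }.

Definition E w (t : R) : R :=
  bsum (fun c i => (c + wd p) * w t i ^+ 2 + 1 / (9 * c) * w t i ^+ 4).

Definition E1 w wt (t : R) : R :=
  bsum (fun c i => (c + wd p) * wt t i ^+ 2
                   + 4 / (3 * c) * (wt t i ^+ 2 * w t i ^+ 2)).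

Definition E2 w wt (t : R) : R :=
  bsum (fun c i => (c + wd p) * wt t i ^+ 2
                   + 2 / (3 * c) * (wt t i ^+ 2 * w t i ^+ 2)).

Definition alpha_max : R :=
  2^-1 * Num.min (Num.min (nu p) (delta p))
                 (Num.min (c0 p + wd p) (c1 p + wd p)).

Definition beta (alpha : R) : R :=
  Num.min (Num.min (nu p - 2 * alpha) (delta p - 2 * alpha))
          (Num.min (c0 p + wd p - 2 * alpha) (c1 p + wd p - 2 * alpha)).

End ClosedLoop.

(* Main.v *)
Require Import Defs.
From HB Require Import structures.
From mathcomp Require Import all_boot all_order all_algebra.
From mathcomp Require Import all_classical all_reals all_analysis.
From mathcomp Require Import measurable_realfun ring lra.

Set Implicit Arguments.
Unset Strict Implicit.
Unset Printing Implicit Defensive.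

Import Order.TTheory GRing.Theory Num.Theory.
Import numFieldNormedType.Exports.

Local Open Scope classical_set_scope.
Local Open Scope ring_scope.

(* The system is dissipative in L^2, but controlling w_xx and w_t requires an
   energy functional at the level of H^1, and controlling w_t in H^1 requires the
   time-differentiated system, for which the regularity in (A2) is too weak.
   Differentiation in time is therefore replaced by forward difference quotients:
   u = w, or u = (w(t+h) - w(t))/h, satisfies
     u_t - nu u_xx + w_d u_x + (s u)_x = rho zeta_x,   zeta_t + delta zeta = u_x,
   with boundary terms (c_i + w_d) u + 2/(9 c_i) q u, where s = w/2 and q = w^2,
   respectively s = (w(t+h) + w(t))/2 and q = w(t+h)^2 + w(t+h) w(t) + w(t)^2.
   In both cases q >= 3 s^2, which is exactly what lets the cubic feedback absorb
   the boundary flux of (s u)_x. The interior flux is absorbed by an integrating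
   factor exp(2 lambda / nu), where lambda is bounded and -lambda' >= sup s^2; such
   a lambda is a multiple of the L^2 energy of (w, z). For A large and eps small,
     Phi = e^(2 alpha t) (A exp(2 lambda/nu) (|u|^2 + rho |zeta|^2)
             + nu |u_x|^2 + 2 rho (zeta, u_x) + boundary terms + eps |zeta_x|^2)
   is decreasing and -Phi' dominates all the norms of u and zeta to be estimated.
   The bound (A2) only serves to make the constants and Phi(0) finite, uniformly
   in h because w, w_x, z and z_x are Lipschitz in time with values in L^2.
   As h tends to 0, weak lower semicontinuity of the norm and Fatou's lemma give
   the estimates of w_t, w_xt and w_xxt. *)

(** * The space L^2(0,1) *)

Section L2space.
Context {R : realType}.
Implicit Types (f g h : R -> R) (a : R).

Local Notation mu := (@lebesgue_measure R).
Local Notation I := (`]0%R, 1%R[%classic : set R).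

(** The three layers of [Phi] come from three multipliers. Testing with u gives the L^2 energy,
    whose dissipation pays for every lower-order term once A is large. Testing with u_t dissipates
    |u_t|^2 and yields the derivative of nu |u_x|^2 + 2 rho (zeta, u_x) plus the boundary terms. The
    interior equation determines only nu u_xx + rho zeta_x, so u_xx is out of reach without zeta_x;
    eliminating u_xx from zeta_xt + delta zeta_x = u_xx adds a damping of zeta_x, at the price of a
    multiple of |u_t|^2 that a small eps keeps below the available dissipation. None of this asks
    for small data: the size of w enters only through constants such as exp(2 lambda / nu). Time
    regularity is a second obstacle, since the derivatives of w_x and z_x are available only against
    test functions. A Lipschitz bound in L^2 is enough for quadratic functionals, because the
    product of two increments is then quadratic in the time step. Finally, [Phi] at time 0 is
    bounded by a multiple of K |w_0|_3^2, for w and for its quotients alike, which puts |w_0|_3^2 on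
    the right-hand side. *)

Lemma mu_I : mu I = 1%:E.
Proof. by rewrite lebesgue_measure_itv/= lte_fin ltr01 oppr0 adde0. Qed.

Lemma bounded_integrable f (M : R) : measurable_fun I f ->
  (forall x, I x -> `|f x| <= M) -> mu.-integrable I (EFin \o f).
Proof.
move=> mf fM; apply: measurable_bounded_integrable => //.
  by have := ltry (1:R); rewrite -mu_I.
exists M; split; first exact: num_real.
by move=> y My x Ix /=; rewrite (le_trans (fM x Ix))// ltW.
Qed.

Lemma L2_measurable f : L2 f -> measurable_fun I f.
Proof. by case. Qed.

Lemma L2_integrable_mul f g : L2 f -> L2 g ->
  mu.-integrable I (EFin \o (fun x => f x * g x)).
Proof.
move=> [mf If] [mg Ig].
apply: (@le_integrable _ _ _ mu I _ _
  (fun x => (f x ^+ 2)%:E + (g x ^+ 2)%:E)%E) => //.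
- by apply/measurable_EFinP; exact: measurable_funM.
- move=> x _.
  rewrite -[leLHS]/(`|f x * g x|%:E) -[leRHS]/(`|f x ^+ 2 + g x ^+ 2|%:E) lee_fin.
  rewrite [leRHS]ger0_norm ?addr_ge0 ?sqr_ge0//.
  rewrite ler_norml; apply/andP; split; nra.
- exact: integrableD.
Qed.

Lemma dominated_L2 f g : measurable_fun I f -> L2 g ->
  (forall x, I x -> `|f x| <= `|g x|) -> L2 f.
Proof.
move=> mf [mg Ig] fg; split=> //.
apply: (@le_integrable _ _ _ mu I _ _ (fun x => (g x ^+ 2)%:E)) => //.
  by apply/measurable_EFinP; exact: measurable_funX.
move=> x Ix; rewrite -[leLHS]/(`|f x ^+ 2|%:E) -[leRHS]/(`|g x ^+ 2|%:E) lee_fin.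
by rewrite !normrX ler_sqr ?nnegrE//; exact: fg.
Qed.

Lemma bounded_L2 f (M : R) : measurable_fun I f ->
  (forall x, I x -> `|f x| <= M) -> L2 f.
Proof.
move=> mf fM; split=> //.
apply: (@bounded_integrable _ (M ^+ 2)); first exact: measurable_funX.
move=> x Ix; rewrite normrX ler_sqr ?nnegrE//; first exact: fM.
by rewrite (le_trans _ (fM x Ix)).
Qed.

Lemma L2D f g : L2 f -> L2 g -> L2 (fun x => f x + g x).
Proof.
move=> f2 g2; have [mf If] := f2; have [mg Ig] := g2; split.
  exact: measurable_funD.
rewrite (_ : (fun x => _) = (fun x => (f x ^+ 2)%:E + ((g x ^+ 2)%:E
   + (2 * (f x * g x))%:E))%E); last first.
  by apply/funext => x; rewrite -!EFinD; congr (_%:E); ring.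
apply: integrableD => //; apply: integrableD => //.
rewrite (_ : (fun x => _) = (fun x => 2%:E * (f x * g x)%:E)%E)//.
by apply: integrableZl => //; exact: L2_integrable_mul.
Qed.

Lemma L2Z a f : L2 f -> L2 (fun x => a * f x).
Proof.
move=> [mf If]; split; first exact: measurable_funM.
rewrite (_ : (fun x => _) = (fun x => (a ^+ 2)%:E * (f x ^+ 2)%:E)%E).
  exact: integrableZl.
by apply/funext => x; rewrite -EFinM exprMn.
Qed.

Lemma L2N f : L2 f -> L2 (fun x => - f x).
Proof.
move=> /(L2Z (-1)); congr L2; apply/funext => x; exact: mulN1r.
Qed.

Lemma L2B f g : L2 f -> L2 g -> L2 (fun x => f x - g x).
Proof. by move=> f2 g2; apply: L2D => //; exact: L2N. Qed.

Lemma L2_cst a : L2 (fun=> a).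
Proof. by apply: (@bounded_L2 _ `|a|). Qed.

Lemma dotC f g : dot f g = dot g f.
Proof. by apply: eq_Rintegral => x _; rewrite mulrC. Qed.

Lemma eq_dot f f' g g' : (forall x, I x -> f x = f' x) ->
  (forall x, I x -> g x = g' x) -> dot f g = dot f' g'.
Proof. by move=> ff gg; apply: eq_Rintegral => x /[!inE] Ix; rewrite ff ?gg. Qed.

Lemma dotDl f g h : L2 f -> L2 g -> L2 h ->
  dot (fun x => f x + g x) h = dot f h + dot g h.
Proof.
move=> f2 g2 h2; rewrite /dot; under eq_Rintegral do rewrite mulrDl.
by rewrite RintegralD//; exact: L2_integrable_mul.
Qed.

Lemma dotZl a f g : L2 f -> L2 g -> dot (fun x => a * f x) g = a * dot f g.
Proof.
move=> f2 g2; rewrite /dot; under eq_Rintegral do rewrite -mulrA.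
by rewrite RintegralZl//; exact: L2_integrable_mul.
Qed.

Lemma dotNl f g : L2 f -> L2 g -> dot (fun x => - f x) g = - dot f g.
Proof.
move=> f2 g2; rewrite -mulN1r -dotZl//.
by apply: eq_dot => // x _; rewrite mulN1r.
Qed.

Lemma dotBl f g h : L2 f -> L2 g -> L2 h ->
  dot (fun x => f x - g x) h = dot f h - dot g h.
Proof. by move=> f2 g2 h2; rewrite dotDl ?dotNl//; exact: L2N. Qed.

Lemma dotDr f g h : L2 f -> L2 g -> L2 h ->
  dot h (fun x => f x + g x) = dot h f + dot h g.
Proof. by move=> *; rewrite dotC dotDl// 2!(dotC h). Qed.

Lemma dotBr f g h : L2 f -> L2 g -> L2 h ->
  dot h (fun x => f x - g x) = dot h f - dot h g.
Proof. by move=> *; rewrite dotC dotBl// 2!(dotC h). Qed.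

Lemma dotZr a f g : L2 f -> L2 g -> dot g (fun x => a * f x) = a * dot g f.
Proof. by move=> *; rewrite dotC dotZl// dotC. Qed.

Lemma dotNr f g : L2 f -> L2 g -> dot g (fun x => - f x) = - dot g f.
Proof. by move=> *; rewrite dotC dotNl// dotC. Qed.

Lemma dot_ge0 f : 0 <= dot f f.
Proof. by apply: Rintegral_ge0 => x _; rewrite -expr2 sqr_ge0. Qed.

Lemma dot0l f g : (forall x, I x -> f x = 0) -> dot f g = 0.
Proof.
move=> f0; rewrite (@eq_dot f (fun=> 0) g g)// /dot.
by under eq_Rintegral do rewrite mul0r; rewrite Rintegral_cst// mul0r.
Qed.

Lemma L2norm_sqr f : L2norm f ^+ 2 = dot f f.
Proof. by rewrite sqr_sqrtr// dot_ge0. Qed.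

Lemma L2norm_ge0 f : 0 <= L2norm f.
Proof. exact: sqrtr_ge0. Qed.

Lemma dot_sqrB f g : L2 f -> L2 g ->
  dot (fun x => f x - g x) (fun x => f x - g x) =
  dot f f - 2 * dot f g + dot g g.
Proof.
move=> f2 g2; have ? := L2B f2 g2.
rewrite dotBl// !dotBr// (dotC g f); ring.
Qed.

Lemma dot_sqrD f g : L2 f -> L2 g ->
  dot (fun x => f x + g x) (fun x => f x + g x) =
  dot f f + 2 * dot f g + dot g g.
Proof.
move=> f2 g2; have ? := L2D f2 g2.
rewrite dotDl// !dotDr// (dotC g f); ring.
Qed.

Lemma dot_young e f g : 0 < e -> L2 f -> L2 g ->
  2 * dot f g <= e * dot f f + e^-1 * dot g g.
Proof.
move=> e0 f2 g2; have := dot_ge0 (fun x => e * f x - g x).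
have ef2 := L2Z e f2.
rewrite dot_sqrB// !dotZl// dotZr// => h.
rewrite -(ler_pM2l e0) mulrDr (mulrA e e^-1) mulfV ?gt_eqF// mul1r.
nra.
Qed.

Lemma dot_young_abs e f g : 0 < e -> L2 f -> L2 g ->
  2 * `|dot f g| <= e * dot f f + e^-1 * dot g g.
Proof.
move=> e0 f2 g2; rewrite -[2]ger0_norm// -normrM ler_norml.
have := dot_young e0 f2 g2; have := dot_young e0 (L2N f2) g2.
have ? := L2N f2.
rewrite !dotNl// dotNr// opprK => *; apply/andP; split; lra.
Qed.

Lemma dot_CS f g : L2 f -> L2 g -> dot f g ^+ 2 <= dot f f * dot g g.
Proof.
move=> f2 g2; have := dot_ge0 g; rewrite le_eqVlt => /predU1P[g0|g0].
  suff -> : dot f g = 0 by rewrite expr0n/= -g0 mulr0.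
  apply/eqP/negPn/negP => fg0.
  have f1 : 0 < 1 + dot f f by rewrite ltr_wpDr ?dot_ge0.
  (* When |g| = 0, Young's inequality with this weight gives 2 |(f, g)| <= |(f, g)| |f|^2 / (1 +
     |f|^2), which is impossible unless (f, g) = 0. *)
  have e0 : 0 < `|dot f g| / (1 + dot f f) by rewrite divr_gt0 ?normr_gt0.
  have := dot_young_abs e0 f2 g2; rewrite -g0 mulr0 addr0 mulrAC.
  rewrite ler_pdivlMr// -normr_gt0 in fg0 *; have := dot_ge0 f; nra.
have H2 := L2Z (dot g g) f2; have K2 := L2Z (dot f g) g2.
have := dot_ge0 (fun x => dot g g * f x - dot f g * g x).
rewrite dot_sqrB// !dotZl// !dotZr// => h.
by rewrite -subr_ge0 -(pmulr_rge0 _ g0); apply: le_trans h _; rewrite le_eqVlt; apply/orP; left; apply/eqP; ring.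
Qed.

Lemma dot_le_norm f g : L2 f -> L2 g -> `|dot f g| <= L2norm f * L2norm g.
Proof.
move=> f2 g2; rewrite -ler_sqr ?nnegrE ?mulr_ge0 ?L2norm_ge0//.
by rewrite exprMn !L2norm_sqr real_normK ?num_real// dot_CS.
Qed.

Lemma L2normD_sqr f g : L2 f -> L2 g ->
  dot (fun x => f x + g x) (fun x => f x + g x) <= 2 * dot f f + 2 * dot g g.
Proof.
by move=> f2 g2; have := dot_young ltr01 f2 g2; rewrite dot_sqrD// invr1 !mul1r; lra.
Qed.

Lemma cont01_measurable f : cont01 f -> measurable_fun I f.
Proof.
move=> cf; apply: subspace_continuous_measurable_fun => //.
apply: continuous_subspaceW cf => x /=.
by rewrite !in_itv/= => /andP[/ltW-> /ltW->].
Qed.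

Lemma cont01_bounded f : cont01 f ->
  exists M, forall x, 0 <= x <= 1 -> `|f x| <= M.
Proof.
move=> cf; have /compact_bounded[M [_ fM]] := continuous_compact cf (@segment_compact _ 0 1).
exists (M + 1) => x x01; apply: (fM (M + 1)); first by rewrite ltrDl.
by exists x => //=; rewrite in_itv.
Qed.

Lemma I_sub x : I x -> 0 <= x <= 1.
Proof. by rewrite /= in_itv/= => /andP[/ltW-> /ltW->]. Qed.

Lemma cont01_L2 f : cont01 f -> L2 f.
Proof.
move=> cf; have [M fM] := cont01_bounded cf.
apply: (@bounded_L2 _ M); first exact: cont01_measurable.
by move=> x /I_sub; exact: fM.
Qed.

Lemma L2_bndM (M : R) f g : measurable_fun I f -> (forall x, I x -> `|f x| <= M) ->
  L2 g -> L2 (fun x => f x * g x).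
Proof.
move=> mf fM g2; apply: (dominated_L2 _ (L2Z M g2)).
  by apply: measurable_funM => //; exact: L2_measurable.
move=> x Ix; rewrite !normrM ler_wpM2r//.
by rewrite (le_trans (fM _ Ix))// ler_norm.
Qed.

Lemma cont01_L2M f g : cont01 f -> L2 g -> L2 (fun x => f x * g x).
Proof.
move=> cf; have [M fM] := cont01_bounded cf.
apply: (@L2_bndM M); first exact: cont01_measurable.
by move=> x /I_sub; exact: fM.
Qed.

Lemma dot_bndM (M : R) f g : measurable_fun I f -> (forall x, I x -> `|f x| <= M) ->
  L2 g -> dot (fun x => f x * g x) (fun x => f x * g x) <= M ^+ 2 * dot g g.
Proof.
move=> mf fM g2; have fg2 := L2_bndM mf fM g2.
rewrite -[leRHS]RintegralZl//; last exact: L2_integrable_mul.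
apply: le_Rintegral => //; first exact: L2_integrable_mul.
- rewrite (_ : _ \o _ = (fun x => (M ^+ 2)%:E * (g x * g x)%:E)%E).
    by apply: integrableZl => //; exact: L2_integrable_mul.
  by apply/funext => x; rewrite -EFinM.
- move=> x Ix; rewrite -!expr2 exprMn ler_wpM2r ?sqr_ge0//.
  rewrite -real_normK ?num_real// ler_sqr ?nnegrE//; first exact: fM.
  by rewrite (le_trans _ (fM x Ix)).
Qed.

Lemma cont01D f g : cont01 f -> cont01 g -> cont01 (fun x => f x + g x).
Proof. by move=> cf cg x; apply: cvgD; [exact: cf|exact: cg]. Qed.

Lemma cont01M f g : cont01 f -> cont01 g -> cont01 (fun x => f x * g x).
Proof. by move=> cf cg x; apply: cvgM; [exact: cf|exact: cg]. Qed.

Lemma cont01_cst a : cont01 (fun=> a).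
Proof. by move=> x; exact: cvg_cst. Qed.

Lemma cont01Z a f : cont01 f -> cont01 (fun x => a * f x).
Proof. by move=> cf; apply: cont01M => //; exact: cont01_cst. Qed.

Lemma cont01B f g : cont01 f -> cont01 g -> cont01 (fun x => f x - g x).
Proof. by move=> cf cg x; apply: cvgB; [exact: cf|exact: cg]. Qed.

Lemma continuous_cont01 f : continuous f -> cont01 f.
Proof. by move=> cf; apply: continuous_subspaceT. Qed.

End L2space.

(** * Derivatives of real functions *)

Section RealDerivatives.
Context {R : realType}.
Implicit Types (f g : R -> R) (x a d e : R).

Lemma isd_cst a x : is_derive x 1 (fun=> a : R) 0.
Proof. exact: is_derive_cst. Qed.

Lemma isd_id x : is_derive x 1 (fun y => y : R) 1.
Proof. exact: is_derive_id. Qed.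

Lemma isdD f g x d e : is_derive x 1 f d -> is_derive x 1 g e ->
  is_derive x 1 (fun y => f y + g y) (d + e).
Proof. by move=> *; exact: is_deriveD. Qed.

Lemma isdB f g x d e : is_derive x 1 f d -> is_derive x 1 g e ->
  is_derive x 1 (fun y => f y - g y) (d - e).
Proof. by move=> *; exact: is_deriveB. Qed.

Lemma isdZ a f x d : is_derive x 1 f d -> is_derive x 1 (fun y => a * f y) (a * d).
Proof. by move=> *; exact: is_deriveZ. Qed.

Lemma isdM f g x d e : is_derive x 1 f d -> is_derive x 1 g e ->
  is_derive x 1 (fun y => f y * g y) (d * g x + f x * e).
Proof.
move=> fd gd; rewrite (_ : _ + _ = f x *: e + g x *: d); first exact: is_deriveM.
by rewrite /GRing.scale/= addrC (mulrC d).
Qed.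

Lemma isd_comp f g x d e : is_derive x 1 g e -> is_derive (g x) 1 f d ->
  is_derive x 1 (fun y => f (g y)) (e * d).
Proof. by move=> gd fd; rewrite mulrC; exact: is_derive1_comp. Qed.

Lemma isd_shift f x a d : is_derive (x + a) 1 f d ->
  is_derive x 1 (fun y => f (y + a)) d.
Proof.
move=> fd; rewrite -[d]mul1r; apply: (@isd_comp f (fun y => y + a)) => //.
have := isdD (isd_id x) (isd_cst a x); by rewrite addr0.
Qed.

Lemma isd_expR f x d : is_derive x 1 f d ->
  is_derive x 1 (fun y => expR (f y)) (d * expR (f x)).
Proof. by move=> fd; exact: (isd_comp fd (is_derive_expR _)). Qed.

Lemma isd_continuous f x d : is_derive x 1 f d -> {for x, continuous f}.
Proof. by move=> fd; apply/differentiable_continuous/derivable1_diffP. Qed.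

Lemma isd_eq f g x d e : is_derive x 1 f d -> f =1 g -> d = e -> is_derive x 1 g e.
Proof. by move=> fd fg <-; have -> : g = f by exact/esym/funext. Qed.

Lemma isdP f x d : is_derive x 1 f d <->
  h^-1 * (f (x + h) - f x) @[h --> 0^'] --> d.
Proof.
have E : (fun h : R => h^-1 *: ((f \o shift x) (h *: 1) - f x)) =
  (fun h => h^-1 * (f (x + h) - f x)).
  by apply/funext => h /=; rewrite -[h%:A]/(h * 1) mulr1 (addrC h).
split=> [[fd dd]|fd].
  by rewrite -dd /derive -E; exact: fd.
by split; [rewrite /derivable E; apply/cvg_ex; exists d|rewrite /derive E; exact/cvg_lim].
Qed.

Lemma isd_MVT f (df : R -> R) (a b : R) : a <= b ->
  {within `[a, b], continuous f} ->
  (forall x, a < x < b -> is_derive x 1 f (df x)) ->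
  exists c, (a < c < b \/ a = b) /\ f b - f a = df c * (b - a).
Proof.
rewrite le_eqVlt => /predU1P[->|ab] cf fd.
  by exists b; split; [right|rewrite !subrr mulr0].
have fd' x : x \in `]a, b[ -> is_derive x 1 f (df x) by rewrite in_itv; exact: fd.
have [c cab E] := MVT ab fd' cf.
by exists c; split => //; left; move: cab; rewrite in_itv.
Qed.

Lemma isd_nonincreasing f (df : R -> R) (a b : R) : a <= b ->
  {within `[a, b], continuous f} ->
  (forall x, a < x < b -> is_derive x 1 f (df x)) ->
  (forall x, a < x < b -> df x <= 0) -> f b <= f a.
Proof.
move=> ab cf fd df0; have [c [[cab|->] E]] := isd_MVT ab cf fd => //.
by rewrite -subr_le0 E mulr_le0_ge0 ?subr_ge0//; exact: df0.
Qed.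

Lemma isd_lipschitz f (df : R -> R) (a b L : R) : a <= b ->
  {within `[a, b], continuous f} ->
  (forall x, a < x < b -> is_derive x 1 f (df x)) ->
  (forall x, a < x < b -> `|df x| <= L) -> `|f b - f a| <= L * (b - a).
Proof.
move=> ab cf fd dfL; have [c [[cab|->] ->]] := isd_MVT ab cf fd.
  by rewrite normrM [X in _ * X]ger0_norm ?subr_ge0// ler_wpM2r ?subr_ge0//; exact: dfL.
by rewrite subrr !mulr0 normr0.
Qed.

Lemma continuous_max0 : continuous (fun x : R => Num.max 0 x).
Proof.
move=> x; by apply: (@continuous_max _ _ (fun=> 0) id) => //; exact: cvg_cst.
Qed.

Lemma isd_max0_sqr x :
  is_derive x 1 (fun y : R => Num.max 0 y ^+ 2) (2 * Num.max 0 x).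
Proof.
have [x0|x0|->] := ltgtP x 0.
- rewrite mulr0; apply: near_eq_is_derive (isd_cst 0 x).
  near=> y; rewrite max_l ?expr0n// ltW//; near: y; exact: lt_nbhsl.
- have H : is_derive x 1 (fun y : R => y * y) (2 * x).
    by apply: isd_eq (isdM (isd_id x) (isd_id x)) _ _ => //; ring.
  apply: near_eq_is_derive H.
  near=> y; rewrite max_r// ltW//; near: y; exact: lt_nbhsr.
rewrite mulr0; apply/isdP/cvgrPdist_le => /= e e0; near=> h.
have h0 : h != 0 by near: h; exact: nbhs_dnbhs_neq.
rewrite sub0r normrN add0r maxxx expr0n/= subr0 normrM normrX normfV.
apply: (@le_trans _ _ `|h|); last by near: h; exact: dnbhs0_le.
rewrite ler_pdivrMl ?normr_gt0// -expr2 ler_sqr ?nnegrE//.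
by rewrite /Num.max; case: ifP => //; rewrite normr0.
Unshelve. all: by end_near.
Qed.

(* A C^1 step from 0 on x <= 0 to 1 on x >= 1: its derivative [dstep] is a
   continuous hat function supported in [0,1]. *)
Definition step (x : R) : R :=
  2 * (Num.max 0 x ^+ 2 - 2 * Num.max 0 (x - 2^-1) ^+ 2 + Num.max 0 (x - 1) ^+ 2).
Definition dstep (x : R) : R :=
  4 * (Num.max 0 x - 2 * Num.max 0 (x - 2^-1) + Num.max 0 (x - 1)).

Lemma isd_step x : is_derive x 1 step (dstep x).
Proof.
have S a := isd_shift (isd_max0_sqr (x + a)).
apply: isd_eq (isdZ 2 (isdD (isdB (isd_max0_sqr x) (isdZ 2 (S (- 2^-1)))) (S (-1)))) _ _ => //.
by rewrite /dstep; ring.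
Qed.

Lemma continuous_dstep : continuous dstep.
Proof.
have S a : continuous (fun x : R => Num.max 0 (x + a)).
  move=> x; apply: (@continuous_comp _ _ _ (fun y : R => y + a) (Num.max 0)); last exact: continuous_max0.
  exact: isd_continuous (isdD (isd_id x) (isd_cst a x)).
move=> x; apply: cvgM; first exact: cvg_cst.
apply: cvgD; last exact: S.
apply: cvgB; first exact: continuous_max0.
by apply: cvgM; [exact: cvg_cst|exact: S].
Qed.

Lemma step_le0 x : x <= 0 -> step x = 0.
Proof.
by move=> x0; rewrite /step !max_l//; [ring|lra|lra].
Qed.

Lemma step_ge1 x : 1 <= x -> step x = 1.
Proof.
by move=> x0; rewrite /step !max_r//; [field|lra|lra|lra].
Qed.

Lemma dstep_ge0 x : 0 <= dstep x.
Proof. rewrite /dstep; case: (ltP 0 x); case: (ltP 0 (x - 2^-1)); case: (ltP 0 (x - 1)) => *; lra. Qed.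

Lemma dstep_out x : ~~ (0 < x < 1) -> dstep x = 0.
Proof.
rewrite /dstep negb_and -!leNgt => /orP[x0|x1]; first by rewrite !max_l; lra.
by rewrite !max_r; lra.
Qed.

Lemma step_itv x : 0 <= step x <= 1.
Proof.
rewrite /step; case: (ltP 0 x); case: (ltP 0 (x - 2^-1)); case: (ltP 0 (x - 1)) => *; apply/andP; split; nra.
Qed.

End RealDerivatives.

(** * Density of test functions in L^2(0,1) *)

Section Density.
Context {R : realType}.
Implicit Types (f g h phi : R -> R) (a b e x y : R).

Local Notation mu := (@lebesgue_measure R).
Local Notation I := (`]0%R, 1%R[%classic : set R).

Lemma dominated_L2_cvg f (f_ : nat -> R -> R) g :
  measurable_fun I f -> (forall n, measurable_fun I (f_ n)) -> L2 g ->
  (forall n x, I x -> `|f x - f_ n x| <= `|g x|) ->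
  (forall x, I x -> f_ n x @[n --> \oo] --> f x) ->
  dot (fun x => f x - f_ n x) (fun x => f x - f_ n x) @[n --> \oo] --> (0 : R).
Proof.
move=> mf mf_ [mg Ig] fg ff.
pose G n x := ((f x - f_ n x) ^+ 2)%:E.
have : (\int[mu]_(x in I) G n x)%E @[n --> \oo] --> (\int[mu]_(x in I) (cst 0%E) x)%E.
  apply: (@dominated_cvg _ _ _ mu I _ G (cst 0%E) (fun x => (g x ^+ 2)%:E)) => //.
  - move=> n; apply/measurable_EFinP; apply: measurable_funX.
    by apply: measurable_funB; [exact: mf|exact: mf_].
  - move=> x Ix; apply: cvg_EFin; first exact: nearW.
    rewrite [X in _ --> X](_ : _ = (f x - f x) ^+ 2).
      apply: (@cvg_comp _ _ _ _ (fun y : R => y ^+ 2)); last exact: exprn_continuous.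
      by apply: cvgB; [exact: cvg_cst|exact: ff].
    by rewrite subrr expr0n.
  - move=> n x Ix; rewrite /G gee0_abs ?lee_fin ?sqr_ge0//.
    rewrite -real_normK ?num_real// -[leRHS]real_normK ?num_real//.
    by rewrite ler_sqr ?nnegrE//; exact: fg.
rewrite integral0 => /fine_cvgP[_]; apply: cvg_trans.
by apply: near_eq_cvg; apply: nearW => n /=; congr fine; apply: eq_integral => x _; rewrite /G expr2.
Qed.

Lemma fundamental_theorem01 (F f : R -> R) : (forall x, is_derive x 1 F (f x)) ->
  continuous f -> \int[mu]_(x in I) f x = F 1 - F 0.
Proof.
move=> Ff cf.
have c01 : {within `[0, 1], continuous f} by exact: continuous_subspaceT.
have iI : mu.-integrable `[0%R, 1%R] (EFin \o f).
  by apply: continuous_compact_integrable => //; exact: segment_compact.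
have E := @continuous_FTC2 R f F 0 1 ltr01 c01.
rewrite Rintegral_itv_bndo_bndc; last first.
  apply: integrableS iI => // x /=.
  by rewrite !in_itv/= => /andP[/ltW-> /ltW->].
rewrite Rintegral_itv_obnd_cbnd; last first.
  apply: integrableS iI => // x /=.
  by rewrite !in_itv/= => /andP[/ltW-> ->].
rewrite /Rintegral E//.
  split.
  - by move=> x _; have [] := Ff x.
  - by apply: cvg_at_right_filter; exact: isd_continuous (Ff 0).
  - by apply: cvg_at_left_filter; exact: isd_continuous (Ff 1).
by move=> x _; rewrite derive1E; apply: derive_val.
Qed.

Lemma exists_primitive f : continuous f -> (forall x, x <= 0 -> f x = 0) ->
  exists F : R -> R, (forall x, is_derive x 1 F (f x)) /\ (forall x, x <= 0 -> F x = 0).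
Proof.
move=> cf f0.
(* The base point -1 lies strictly to the left of where f may be nonzero: near every x <= -1 the
   function F is constantly 0, and for x > -1 the fundamental theorem applies on [-1, x + 1], also
   at x = 0. *)
pose F x := \int[mu]_(t in `[(-1)%R, x]) f t.
have F0 x : x <= 0 -> F x = 0.
  move=> x0; rewrite /F (@eq_Rintegral _ _ _ _ _ (fun=> 0)); last first.
    by move=> t; rewrite inE/= in_itv/= => /andP[_ tx]; rewrite f0// (le_trans tx).
  by rewrite Rintegral_cst// mul0r.
exists F; split=> // x; have [x1|x1] := ltP (-1) x; last first.
  rewrite f0; last by rewrite (le_trans x1)// lerN10.
  apply: near_eq_is_derive (isd_cst 0 x); near=> y; apply/esym/F0.
  by apply: ltW; near: y; apply: lt_nbhsl; rewrite (le_lt_trans x1)// ltrN10.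
have iI : mu.-integrable `[(-1)%R, (x + 1)%R] (EFin \o f).
  apply: continuous_compact_integrable; first exact: segment_compact.
  exact: continuous_subspaceT.
have xx1 : x < x + 1 by rewrite ltrDl.
have [dF FE] := continuous_FTC1_closed xx1 iI x1 (cf x).
by apply: DeriveDef; [exact: dF|rewrite -derive1E; exact: FE].
Unshelve. all: by end_near. Qed.

Lemma clamp_itv (N y : R) : 0 <= N -> `|Num.max (- N) (Num.min N y)| <= N.
Proof.
move=> N0; rewrite ler_norml.
case: (leP N y) => ?; [case: (leP (- N) N)|case: (leP (- N) y)] => ?;
  apply/andP; split; lra.
Qed.

(** Truncation is the projection onto [-N, N], so it brings y no farther from a point of that
    interval. *)
Lemma clamp_dist (N x y : R) : `|x| <= N ->
  `|x - Num.max (- N) (Num.min N y)| <= `|x - y|.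
Proof.
rewrite ler_norml => /andP[xN Nx]; rewrite ler_norml.
have := ler_norm (x - y); have := ler_norm (- (x - y)); rewrite normrN => ? ?.
case: (leP N y) => ?; [case: (leP (- N) N)|case: (leP (- N) y)] => ?;
  apply/andP; split; lra.
Qed.

Lemma clamp_le (N y : R) : 0 <= N -> `|Num.max (- N) (Num.min N y)| <= `|y|.
Proof.
move=> N0; rewrite ler_norml; have := ler_norm y; have := ler_norm (- y).
rewrite normrN => ? ?.
case: (leP N y) => ?; [case: (leP (- N) N)|case: (leP (- N) y)] => ?;
  apply/andP; split; lra.
Qed.

Lemma clamp_id (N y : R) : `|y| <= N -> Num.max (- N) (Num.min N y) = y.
Proof. by rewrite ler_norml => /andP[yN Ny]; rewrite min_r// max_r. Qed.

Lemma continuous_clamp (N : R) : continuous (fun y : R => Num.max (- N) (Num.min N y)).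
Proof.
move=> y; apply: (@continuous_max _ _ (fun=> - N) (fun y => Num.min N y)).
  exact: cvg_cst.
by apply: (@continuous_min _ _ (fun=> N) id) => //; exact: cvg_cst.
Qed.

(** Membership in the L^2 closure of the test functions. Density is proved by enlarging the class of
    such f: compactly supported continuous, bounded continuous, bounded measurable, all of L^2. *)
Definition test_dense f := L2 f /\ forall e, 0 < e ->
  exists2 phi, test_function phi &
    dot (fun x => f x - phi x) (fun x => f x - phi x) <= e.

Lemma test_function_continuous phi : test_function phi -> continuous phi.
Proof.
move=> [d _ _] x; apply: differentiable_continuous; exact/derivable1_diffP.
Qed.

Lemma test_function_L2 phi : test_function phi -> L2 phi.
Proof. by move=> /test_function_continuous/continuous_cont01/cont01_L2. Qed.

Lemma test_dense_lim f : L2 f -> (forall e, 0 < e ->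
  exists2 g, test_dense g &
    dot (fun x => f x - g x) (fun x => f x - g x) <= e) -> test_dense f.
Proof.
move=> f2 fg; split=> // e e0.
have e4 : 0 < e / 4 by rewrite divr_gt0.
have [g [g2 gphi] fge] := fg _ e4.
have [phi phit gphie] := gphi _ e4.
have phi2 := test_function_L2 phit.
exists phi => //; rewrite (@eq_dot _ _ (fun x => (f x - g x) + (g x - phi x)) _
  (fun x => (f x - g x) + (g x - phi x))); [|by move=> x _; ring..].
apply: le_trans (L2normD_sqr (L2B f2 g2) (L2B g2 phi2)) _; lra.
Qed.

Lemma test_dense_seq f (f_ : nat -> R -> R) g : L2 f -> (forall n, test_dense (f_ n)) ->
  L2 g -> (forall n x, I x -> `|f x - f_ n x| <= `|g x|) ->
  (forall x, I x -> f_ n x @[n --> \oo] --> f x) -> test_dense f.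
Proof.
move=> f2 f_2 g2 fg ff; apply: test_dense_lim => // e e0.
have mf_ n : measurable_fun I (f_ n) by have [[]] := f_2 n.
have /cvgrPdist_le/(_ _ e0)[n _ /(_ n (leqnn n))] :=
  dominated_L2_cvg (L2_measurable f2) mf_ g2 fg ff.
rewrite /= sub0r normrN => ne; exists (f_ n) => //.
by apply: le_trans ne; exact: ler_norm.
Qed.

Lemma cvg_dnbhs0 (h : nat -> R) : h n @[n --> \oo] --> (0 : R) ->
  (forall n, h n != 0) -> h n @[n --> \oo] --> 0^'.
Proof.
move=> h0 hn P PP; have : \forall n \near \oo, h n != 0 -> P (h n) := h0 _ PP.
by apply: filterS => n /(_ (hn n)).
Qed.

Lemma cvg_harmonicZ a : a / n.+1%:R @[n --> \oo] --> (0 : R).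
Proof.
rewrite -[X in _ --> X](mulr0 a); apply: cvgM; first exact: cvg_cst.
exact: cvg_harmonic.
Qed.

(** Difference quotients of a primitive of f are C^1, inherit the bound M and converge pointwise to
    f, so dominated convergence applies. *)
Lemma test_dense_compact f a b (M : R) : continuous f -> 0 < a -> b < 1 ->
  (forall x, `|f x| <= M) ->
  (forall x, ~~ (a <= x <= b) -> f x = 0) -> test_dense f.
Proof.
move=> cf a0 b1 fM f0.
have [|F [Ff F0']] := exists_primitive cf.
  by move=> x x0; apply: f0; rewrite negb_and -ltNge (le_lt_trans x0).
have F0 x : x <= a -> F x = 0.
  have [x0 _|x0 xa] := leP x 0; first exact: F0'.
  have : `|F x - F 0| <= 0 * (x - 0).
    apply: (isd_lipschitz (ltW x0) _ (fun y _ => Ff y)).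
      by apply: continuous_subspaceT => y; exact: isd_continuous (Ff y).
    move=> y /andP[_ yx]; rewrite f0 ?normr0// negb_and -!ltNge.
    by rewrite (lt_le_trans yx xa).
  by rewrite mul0r normr_le0 [F 0]F0' ?subr0// => /eqP.
(* Steps of at most a / 2 keep the support of the quotients inside [a / 2, b]. *)
pose h n := (a / 2) / n.+1%:R : R.
have h0 n : 0 < h n by rewrite !divr_gt0.
have ha n : h n <= a / 2 by rewrite /h ler_pdivrMr ?ltr0n// ler_peMr ?ler1n// ltW// divr_gt0.
pose f_ n x := (h n)^-1 * (F (x + h n) - F x).
have df_ n x : is_derive x 1 (f_ n) ((h n)^-1 * (f (x + h n) - f x)).
  by apply: isdZ; apply: isdB => //; exact: isd_shift.
have cF : continuous F by move=> x; exact: isd_continuous (Ff x).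
have f_M n x : `|f_ n x| <= M.
  have /(_ x (x + h n) M) := isd_lipschitz _ _ (fun y _ => Ff y).
  rewrite lerDl ltW// => /(_ isT) H.
  rewrite normrM gtr0_norm ?invr_gt0// ler_pdivrMl//.
  rewrite mulrC (le_trans (H _ _))//; last by rewrite addrAC subrr add0r.
  exact: continuous_subspaceT.
have cf_ n : continuous (f_ n) by move=> x; exact: isd_continuous (df_ n x).
apply: (@test_dense_seq f f_ (fun=> M + M)).
- by apply: cont01_L2; exact: continuous_cont01.
- move=> n; split; first by apply: cont01_L2; exact: continuous_cont01.
  move=> e e0; exists (f_ n); last first.
    by rewrite dot0l ?ltW// => x _; rewrite subrr.
  split.
  + by move=> x; have [] := df_ n x.
  + have -> : derive1 (f_ n) = (fun x => (h n)^-1 * (f (x + h n) - f x)).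
      by apply/funext => x; rewrite derive1E; have [] := df_ n x.
    move=> x; apply: cvgM; first exact: cvg_cst.
    apply: cvgB; last exact: cf.
    apply: (@continuous_comp _ _ _ (fun y : R => y + h n) f); last exact: cf.
    exact: isd_continuous (isdD (isd_id x) (isd_cst (h n) x)).
  + exists (a / 2), b; split; rewrite ?divr_gt0// => x.
    rewrite negb_and -!ltNge => /orP[xa|bx].
      rewrite /f_ !F0 ?subrr ?mulr0//; [lra|have := ha n; lra].
    have : `|F (x + h n) - F x| <= 0 * (x + h n - x).
      apply: (isd_lipschitz _ _ (fun y _ => Ff y)); first by rewrite lerDl ltW.
        exact: continuous_subspaceT.
      move=> y /andP[xy _]; rewrite f0 ?normr0// negb_and -!ltNge.
      by rewrite (lt_trans bx xy) orbT.
    by rewrite mul0r normr_le0 /f_ => /eqP ->; rewrite mulr0.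
- exact: L2_cst.
- move=> n x _; rewrite [leRHS]ger0_norm; last first.
    by rewrite addr_ge0// (le_trans _ (fM 0)).
  by rewrite (le_trans (ler_normB _ _))// lerD.
- move=> x _; have /isdP Fx := Ff x.
  have hc : h n @[n --> \oo] --> 0^'.
    by apply: cvg_dnbhs0; [exact: cvg_harmonicZ|move=> n; rewrite gt_eqF].
  exact: (cvg_comp _ _ hc Fx).
Qed.

Lemma test_dense_continuous f (M : R) : continuous f -> (forall x, `|f x| <= M) ->
  test_dense f.
Proof.
move=> cf fM.
(* A cutoff equal to 1 on [2/(n+1), 1 - 2/(n+1)] and to 0 outside [1/(n+1), 1 - 1/(n+1)]. *)
pose chi (n : nat) x : R := step (n.+1%:R * x - 1) * step (n.+1%:R * (1 - x) - 1).
have chi01 n x : 0 <= chi n x <= 1.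
  have /andP[a0 a1] := step_itv (n.+1%:R * x - 1).
  have /andP[b0 b1] := step_itv (n.+1%:R * (1 - x) - 1).
  by rewrite mulr_ge0//= mulr_ile1.
have cchi n : continuous (chi n).
  have cs : continuous (@step R) by move=> y; exact: isd_continuous (isd_step y).
  move=> x; apply: cvgM.
    apply: (@continuous_comp _ _ _ (fun y : R => n.+1%:R * y - 1) (@step R)); last exact: cs.
    exact: isd_continuous (isdB (isdZ n.+1%:R (isd_id x)) (isd_cst 1 x)).
  apply: (@continuous_comp _ _ _ (fun y : R => n.+1%:R * (1 - y) - 1) (@step R)); last exact: cs.
  exact: isd_continuous (isdB (isdZ n.+1%:R (isdB (isd_cst 1 x) (isd_id x))) (isd_cst 1 x)).
have n0 (n : nat) : 0 < n.+1%:R :> R by rewrite ltr0n.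
have chif n x : `|chi n x * f x| <= M.
  have /andP[c0 c1] := chi01 n x.
  by rewrite normrM ger0_norm// (le_trans _ (fM x))// ler_piMl.
apply: (@test_dense_seq f (fun n x => chi n x * f x) (fun=> M + M)).
- by apply: cont01_L2; exact: continuous_cont01.
- move=> n; apply: (@test_dense_compact _ n.+1%:R^-1 (1 - n.+1%:R^-1) M).
  + by move=> x; apply: cvgM; [exact: cchi|exact: cf].
  + by rewrite invr_gt0.
  + by rewrite ltrBlDr ltrDl invr_gt0.
  + exact: chif.
  + move=> x; rewrite /chi negb_and -!ltNge => /orP[xn|xn].
      rewrite step_le0 ?mul0r// subr_le0 mulrC -ler_pdivlMr// mul1r ltW//.
    rewrite (@step_le0 _ (_ * (1 - x) - 1)) ?mulr0 ?mul0r//.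
    by rewrite subr_le0 mulrC -ler_pdivlMr// mul1r lerBlDl -lerBlDr ltW.
- exact: L2_cst.
- move=> n x _; rewrite [leRHS]ger0_norm; last first.
    by rewrite addr_ge0// (le_trans _ (fM 0)).
  by rewrite (le_trans (ler_normB _ _))// lerD.
- move=> x; rewrite /= in_itv/= => /andP[x0 x1]; apply: cvg_near_cst; near=> n.
  have xn : 2 / x <= n.+1%:R.
    rewrite (@le_trans _ _ n%:R) ?ler_nat//; near: n; exact: nbhs_infty_ger.
  have yn : 2 / (1 - x) <= n.+1%:R.
    rewrite (@le_trans _ _ n%:R) ?ler_nat//; near: n; exact: nbhs_infty_ger.
  rewrite /chi !step_ge1 ?mul1r//.
    by move: yn; rewrite ler_pdivrMr; lra.
  by move: xn; rewrite ler_pdivrMr; lra.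
Unshelve. all: by end_near. Qed.

(** Continuous functions g approximate f in L^1. Clamping g to [-N, N] gives a continuous h with |f
    - h|^2 <= 2 N |f - g|, which turns the approximation into one in L^2. *)
Lemma test_dense_bounded f (N : R) : measurable_fun I f ->
  (forall x, I x -> `|f x| <= N) -> test_dense f.
Proof.
move=> mf fN.
have N0 : 0 <= N.
  by rewrite (le_trans _ (fN (2^-1) _))//= in_itv/=; apply/andP; split; lra.
have f2 : L2 f by exact: bounded_L2 fN.
have fi : mu.-integrable I (EFin \o f) by exact: bounded_integrable fN.
have mI : (mu I < +oo)%E by have := ltry (1 : R); rewrite -mu_I.
have [g [cg ig gf]] := @approximation_continuous_integrable R I f (measurable_itv _) mI fi.
apply: test_dense_lim => // e e0.
have e1 : 0 < e / (2 * N + 1) by rewrite divr_gt0//; lra.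
have /fine_cvgP[_ /cvgrPdist_lt/(_ _ e1)[n _ /(_ n (leqnn n))]] := gf.
rewrite /= sub0r normrN => /(le_lt_trans (ler_norm _)) gn.
pose h x : R := Num.max (- N) (Num.min N (g n x)).
have ch : continuous h.
  move=> x; apply: (@continuous_comp _ _ _ (g n) (fun y : R => Num.max (- N) (Num.min N y))).
    exact: cg.
  exact: continuous_clamp.
have hN x : `|h x| <= N by exact: clamp_itv.
exists h; first exact: test_dense_continuous hN.
have h2 : L2 h by apply: cont01_L2; exact: continuous_cont01.
have ifg : mu.-integrable I (EFin \o (fun x => `|f x - g n x|)).
  have ifB : mu.-integrable I (EFin \o (fun x => f x - g n x)).
    by apply: (integrableB _ fi (ig n)).
  exact: (integrable_norm ifB).
apply: (@le_trans _ _ (2 * N * \int[mu]_(x in I) `|f x - g n x|)).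
  rewrite -RintegralZl//; apply: le_Rintegral => //.
  - by apply: L2_integrable_mul; exact: L2B.
  - rewrite (_ : _ \o _ = (fun x => (2 * N)%:E * (`|f x - g n x|)%:E)%E)//.
    exact: integrableZl.
  - move=> x Ix; rewrite -expr2 -real_normK ?num_real// expr2 ler_pM//.
      by rewrite (le_trans (ler_normB _ _))// mulrDl mul1r lerD// fN.
    exact: clamp_dist (fN x Ix).
have J0 : 0 <= \int[mu]_(x in I) `|f x - g n x| by apply: Rintegral_ge0.
have scal (J : R) : 0 <= J -> J < e / (2 * N + 1) -> 2 * N * J <= e.
  by move=> ?; rewrite ltr_pdivlMr; [nra|lra].
exact: scal J0 gn.
Qed.

Lemma test_functions_dense f : L2 f -> test_dense f.
Proof.
move=> f2; pose f_ (n : nat) x := Num.max (- n%:R) (Num.min n%:R (f x)).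
have mf_ n : measurable_fun I (f_ n).
  by apply: measurable_maxr => //; apply: measurable_minr => //; exact: L2_measurable.
apply: (@test_dense_seq f f_ (fun x => 2 * f x)) => //.
- by move=> n; apply: (@test_dense_bounded _ n%:R) => // x _; exact: clamp_itv.
- exact: L2Z.
- move=> n x _; rewrite (le_trans (ler_normB _ _))// normrM ger0_norm//.
  by rewrite mulrDl mul1r lerD2l clamp_le.
- move=> x _; apply: cvg_near_cst; near=> n; rewrite /f_ clamp_id//.
  near: n; exact: nbhs_infty_ger.
Unshelve. all: by end_near. Qed.

End Density.

(** * The space H^1(0,1) *)

Section H1space.
Context {R : realType}.
Implicit Types (f g h k phi : R -> R) (a b e x y : R).

Local Notation mu := (@lebesgue_measure R).
Local Notation I := (`]0%R, 1%R[%classic : set R).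

Lemma L2norm_triangle f g : L2 f -> L2 g ->
  L2norm (fun x => f x + g x) <= L2norm f + L2norm g.
Proof.
move=> f2 g2; rewrite -ler_sqr ?nnegrE ?addr_ge0 ?L2norm_ge0//.
rewrite sqrrD !L2norm_sqr dot_sqrD// lerD2r lerD2l -mulr_natl.
by have := dot_le_norm f2 g2; rewrite ler_norml => /andP[_]; lra.
Qed.

Lemma dot_orth_test g h : L2 g -> (forall phi, test_function phi -> dot g phi = 0) ->
  L2 h -> dot g h = 0.
Proof.
move=> g2 gphi h2; apply/eqP; rewrite -normr_le0; apply/ler_addgt0Pr => e e0.
rewrite add0r; have d0 : 0 < (e / (1 + L2norm g)) ^+ 2.
  by rewrite exprn_gt0// divr_gt0// ltr_wpDr ?L2norm_ge0.
have [phi phit hphi] := (test_functions_dense h2).2 _ d0.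
have phi2 := test_function_L2 phit.
have <- : dot g (fun x => h x - phi x) = dot g h by rewrite dotBr// (gphi phi)// subr0.
apply: le_trans (dot_le_norm g2 (L2B h2 phi2)) _.
have g0 := L2norm_ge0 g; have n0 := L2norm_ge0 (fun x => h x - phi x).
have := hphi; rewrite -L2norm_sqr ler_sqr ?nnegrE//; last first.
  by rewrite divr_ge0 ?(ltW e0)// addr_ge0.
by rewrite ler_pdivlMr ?ltr_wpDr// => H; clear hphi d0; nra.
Qed.

Lemma L2norm_le_dual g (C : R) : L2 g -> 0 <= C ->
  (forall phi, test_function phi -> dot g phi <= C * L2norm phi) -> L2norm g <= C.
Proof.
move=> g2 C0 gphi; set n := L2norm g; rewrite leNgt; apply/negP => Cn.
have n0 : 0 < n by exact: le_lt_trans Cn.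
(* An approximation with error m <= e gives n^2 <= C (n + m) + n m, that is (n - C) n <= (C + n) m;
   this e makes the right side at most half of the left, a contradiction. *)
pose e := (n - C) * n / (2 * (C + n)).
have e0 : 0 < e by rewrite divr_gt0// ?mulr_gt0//; lra.
have [phi phit] := (test_functions_dense g2).2 _ (exprn_gt0 2 e0).
rewrite -L2norm_sqr ler_sqr ?nnegrE ?L2norm_ge0 ?(ltW e0)//.
set m := L2norm _ => me; have phi2 := test_function_L2 phit.
have gphi2 := L2B g2 phi2.
have phin : L2norm phi <= n + m.
  have := L2norm_triangle g2 (L2N gphi2).
  rewrite (_ : (fun x => _ + _) = phi); last by apply/funext => x; ring.
  suff -> : L2norm (fun x => - (g x - phi x)) = m by [].
  by rewrite /L2norm dotNl ?dotNr ?opprK//; exact: L2N.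
have : dot g g <= C * (n + m) + n * m.
  rewrite (_ : dot g g = dot g phi + dot g (fun x => g x - phi x)); last first.
    by rewrite dotBr//; ring.
  apply: lerD; first by rewrite (le_trans (gphi _ phit))// ler_wpM2l.
  exact: le_trans (ler_norm _) (dot_le_norm _ _).
rewrite -L2norm_sqr -/n; suff : (C + n) * m < (n - C) * n by nra.
have eE : e * (2 * (C + n)) = (n - C) * n by rewrite divfK// gt_eqF//; lra.
have : 0 < (n - C) * n by rewrite mulr_gt0// subr_gt0.
have : (C + n) * m <= (C + n) * e by rewrite ler_wpM2l// addr_ge0// ltW.
clear -eE; move: eE; set q := (n - C) * n; set r := _ * m; nra.
Qed.

Lemma cont01P f : cont01 f <-> forall x e, 0 <= x <= 1 -> 0 < e ->
  exists2 d : R, 0 < d & forall y, 0 <= y <= 1 -> `|x - y| < d -> `|f x - f y| <= e.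
Proof.
split=> [/subspace_continuousP cf x e x01 e0|H].
  have /cvgrPdist_le/(_ _ e0) : f @ within `[0, 1] (nbhs x) --> f x.
    by apply: cf; rewrite /= in_itv.
  move=> [d /= d0 Hd]; exists d => // y y01 xy; exact: Hd.
apply/subspace_continuousP => x /=; rewrite in_itv/= => x01.
apply/cvgrPdist_le => e e0; have [d d0 Hd] := H x e x01 e0.
by exists d => //= y xy; rewrite in_itv/= => y01; exact: Hd.
Qed.

(** A relation between a function and a derivative, so that any derivative at hand can be used
    instead of [wderiv]. Continuity on the closed interval gives meaning to f 0 and f 1. *)
Definition H1 f g : Prop := cont01 f /\ weak_derivative f g.

Lemma test_function_bd phi : test_function phi -> phi 0 = 0 /\ phi 1 = 0.
Proof.
move=> [_ _ [a [b [a0 b1 H]]]]; split; apply: H; rewrite negb_and -!ltNge ?a0//.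
by rewrite b1 orbT.
Qed.

Lemma test_function_isd phi x : test_function phi -> is_derive x 1 phi (derive1 phi x).
Proof. by move=> [d _ _]; rewrite derive1E; apply: DeriveDef. Qed.

Lemma test_function_dL2 phi : test_function phi -> L2 (derive1 phi).
Proof. by move=> [_ /continuous_cont01/cont01_L2]. Qed.

Lemma isd_weak_derivative (F f : R -> R) : (forall x, is_derive x 1 F (f x)) ->
  continuous f -> weak_derivative F f.
Proof.
move=> Ff cf; have cF : continuous F by move=> x; exact: isd_continuous (Ff x).
have f2 := cont01_L2 (continuous_cont01 cf).
have F2 := cont01_L2 (continuous_cont01 cF).
split=> // phi phit; have phi2 := test_function_L2 phit.
have dphi2 := test_function_dL2 phit.
have := @fundamental_theorem01 _ (fun x => F x * phi x) (fun x => f x * phi x + F x * derive1 phi x).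
have [-> ->] := test_function_bd phit; rewrite !mulr0 subrr.
rewrite RintegralD//; [|exact: L2_integrable_mul..].
rewrite -/(dot f phi) -/(dot F (derive1 phi)) => H; apply/eqP.
rewrite -addr_eq0 addrC; apply/eqP; apply: H.
  by move=> x; apply: isdM => //; exact: test_function_isd.
have cphi := test_function_continuous phit.
have cdphi : continuous (derive1 phi) by case: phit.
by move=> x; apply: cvgD; apply: cvgM; [exact: cf|exact: cphi|exact: cF|exact: cdphi].
Qed.


(** [hat x e] approximates the Dirac mass at x from the right, and its primitive [ramp x e] the
    Heaviside function. *)
Let hat x e y : R := e^-1 * dstep ((y - x) / e).
Let ramp x e y : R := step ((y - x) / e).

Let isd_ramp x e y : is_derive y 1 (ramp x e) (hat x e y).
Proof.
have A : is_derive y 1 (fun y => (y - x) / e) e^-1.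
  apply: isd_eq (isdZ e^-1 (isdB (isd_id y) (isd_cst x y))) _ _.
    by move=> z; rewrite mulrC.
  by rewrite subr0 mulr1.
exact: isd_comp A (isd_step _).
Qed.

Let continuous_hat x e : continuous (hat x e).
Proof.
move=> y; apply: cvgM; first exact: cvg_cst.
apply: (@continuous_comp _ _ _ (fun y : R => (y - x) / e) (@dstep R)); last exact: continuous_dstep.
apply: cvgM; last exact: cvg_cst.
by apply: cvgB; [exact: cvg_id|exact: cvg_cst].
Qed.

Let hat_ge0 x e y : 0 < e -> 0 <= hat x e y.
Proof. by move=> e0; rewrite mulr_ge0 ?invr_ge0 ?(ltW e0)// dstep_ge0. Qed.

Let hat_out x e y : 0 < e -> ~~ (x < y < x + e) -> hat x e y = 0.
Proof.
move=> e0 H; rewrite /hat dstep_out ?mulr0//; apply: contra H => /andP[].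
rewrite pmulr_lgt0 ?invr_gt0// subr_gt0 => -> /=.
by rewrite ltr_pdivrMr// mul1r ltrBlDl.
Qed.

Let hat_average k x e (eta : R) : cont01 k -> 0 < x -> 0 < eta -> x + eta < 1 -> 0 < e ->
  (forall y, x < y < x + eta -> `|k x - k y| <= e) -> `|dot k (hat x eta) - k x| <= e.
Proof.
move=> ck x0 eta0 xeta e0 ke.
have k2 := cont01_L2 ck; have h2 : L2 (hat x eta) by apply: cont01_L2; exact: continuous_cont01.
have one2 := @L2_cst R 1.
have hat1 : dot (fun=> 1) (hat x eta) = 1.
  rewrite /dot; under eq_Rintegral do rewrite mul1r.
  rewrite (fundamental_theorem01 (isd_ramp x eta))//.
  rewrite /ramp step_ge1 ?step_le0 ?subr0//; last by rewrite ler_pdivlMr// mul1r; lra.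
  by rewrite sub0r mulNr oppr_le0 divr_ge0// ltW.
rewrite [X in _ - X](_ : k x = dot (fun=> k x * 1) (hat x eta)); last first.
  by rewrite dotZl// hat1 mulr1.
have kx2 : L2 (fun y => k x * 1) by apply: L2Z; exact: L2_cst.
rewrite -dotBl//; have D2 := L2B k2 kx2; have ih := L2_integrable_mul D2 h2.
rewrite /dot (le_trans (le_normr_Rintegral _ ih))//.
rewrite [leRHS](_ : e = dot (fun=> e * 1) (hat x eta)); last first.
  by rewrite dotZl// hat1 mulr1.
apply: le_Rintegral => //.
- exact: (integrable_norm ih).
- by apply: L2_integrable_mul => //; apply: L2Z; exact: L2_cst.
- move=> y _; rewrite normrM (ger0_norm (hat_ge0 _ _ eta0)) !mulr1.
  have [xy|xy] := boolP (x < y < x + eta); last by rewrite hat_out// !mulr0.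
  by rewrite ler_wpM2r ?hat_ge0// distrC ke.
Qed.

(** Testing with [ramp x eta - ramp y eta] recovers k x - k y up to e on one side, while a test
    function of modulus at most 1 bounds the other side by |r|. This oscillation bound, without a
    power of |x - y|, suffices for the sup and trace estimates. *)
Lemma H1_holder_open k r x y : H1 k r -> 0 < x -> x < y -> y < 1 ->
  `|k x - k y| <= L2norm r.
Proof.
move=> [ck [r2 kr]] x0 xy y1; apply/ler_addgt0Pr => e e0.
have e2 : 0 < e / 2 by rewrite divr_gt0.
have x01 : 0 <= x <= 1 by apply/andP; split; lra.
have y01 : 0 <= y <= 1 by apply/andP; split; lra.
have [dx dx0 Hx] := (cont01P k).1 ck x _ x01 e2.
have [dy dy0 Hy] := (cont01P k).1 ck y _ y01 e2.
pose eta := Num.min (Num.min dx dy) ((1 - y) / 2).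
have eta0 : 0 < eta by rewrite !lt_min dx0 dy0 divr_gt0//; lra.
have etax : eta <= dx by rewrite /eta !ge_min lexx.
have etay : eta <= dy by rewrite /eta !ge_min lexx orbT.
have eta1 : eta <= (1 - y) / 2 by rewrite /eta !ge_min lexx orbT.
pose phi (z : R) : R := ramp x eta z - ramp y eta z.
have dphi (z : R) : is_derive z 1 phi (hat x eta z - hat y eta z) by exact: isdB.
have dphiE : derive1 phi = (fun z => hat x eta z - hat y eta z).
  by apply/funext => z; rewrite derive1E; have [] := dphi z.
have phit : test_function phi.
  split.
  - by move=> z; have [] := dphi z.
  - by rewrite dphiE => z; apply: cvgB; exact: continuous_hat.
  - exists x, (y + eta); split; [done|lra|move=> z].
    rewrite negb_and -!ltNge /phi /ramp => /orP[zx|yz].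
      rewrite !step_le0 ?subrr// pmulr_lle0 ?invr_gt0//; lra.
    rewrite !step_ge1 ?subrr// ler_pdivlMr// mul1r; lra.
have h2 z : L2 (hat z eta) by apply: cont01_L2; exact: continuous_cont01.
have phi2 := test_function_L2 phit.
have phi1 : L2norm phi <= 1.
  rewrite -sqrtr1 ler_wsqrtr//.
  have -> : (1 : R) = dot (fun=> 1) (fun=> 1).
    by rewrite /dot Rintegral_cst//= -/(mu I) mu_I /= !mulr1.
  apply: le_Rintegral => //; [exact: L2_integrable_mul| |].
    by apply: L2_integrable_mul; exact: L2_cst.
  move=> z _; have /andP[] := step_itv ((z - x) / eta).
  have /andP[] := step_itv ((z - y) / eta).
  rewrite /phi /ramp; nra.
have k2 := cont01_L2 ck.
have := kr phi phit; rewrite dphiE dotBr// => E.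
have Ax : `|dot k (hat x eta) - k x| <= e / 2.
  apply: hat_average => // [|z /andP[xz zx]]; first lra.
  by apply: Hx; [apply/andP; split; lra|rewrite ltr_norml; apply/andP; split; lra].
have Ay : `|dot k (hat y eta) - k y| <= e / 2.
  have y0 : 0 < y by lra.
  apply: hat_average => // [|z /andP[xz zx]]; first lra.
  by apply: Hy; [apply/andP; split; lra|rewrite ltr_norml; apply/andP; split; lra].
have := dot_le_norm r2 phi2.
have : L2norm r * L2norm phi <= L2norm r by rewrite ler_piMr// L2norm_ge0.
move: Ax Ay; rewrite !ler_norml => /andP[? ?] /andP[? ?] ? /andP[? ?].
apply/andP; split; lra.
Qed.

Lemma cont01_inner k x e : cont01 k -> 0 <= x <= 1 -> 0 < e ->
  exists2 y : R, 0 < y < 1 & `|k x - k y| <= e.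
Proof.
move=> ck x01 e0; have [d d0 Hd] := (cont01P k).1 ck x _ x01 e0.
(* A short move towards the midpoint 1/2 enters (0, 1) from either endpoint. *)
pose s : R := Num.min 2^-1 d.
have s0 : 0 < s by rewrite /s lt_min d0 andbT invr_gt0.
have sd : s <= d by rewrite /s ge_min lexx orbT.
have s1 : s <= 2^-1 by rewrite /s ge_min lexx.
have yI : 0 < x + (2^-1 - x) * s < 1.
  by move: x01 => /andP[? ?]; apply/andP; split; nra.
exists (x + (2^-1 - x) * s) => //; apply: Hd; first by case/andP: yI => /ltW -> /ltW ->.
by move: x01 => /andP[? ?]; rewrite ltr_norml; apply/andP; split; nra.
Qed.

Lemma H1_holder k r x y : H1 k r -> 0 <= x <= 1 -> 0 <= y <= 1 ->
  `|k x - k y| <= L2norm r.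
Proof.
move=> kr x01 y01; apply/ler_addgt0Pr => e e0.
have e2 : 0 < e / 2 by rewrite divr_gt0.
have [x' /andP[x'0 x'1] xx'] := cont01_inner kr.1 x01 e2.
have [y' /andP[y'0 y'1] yy'] := cont01_inner kr.1 y01 e2.
have : `|k x' - k y'| <= L2norm r.
  have [xy|xy|->] := ltgtP x' y'; first exact: H1_holder_open.
    by rewrite distrC; exact: H1_holder_open.
  by rewrite subrr normr0 L2norm_ge0.
move: xx' yy'; rewrite !ler_norml => /andP[? ?] /andP[? ?] /andP[? ?].
apply/andP; split; lra.
Qed.


Lemma H1_L2 f g : H1 f g -> L2 f.
Proof. by move=> [cf _]; exact: cont01_L2. Qed.

Lemma H1_dL2 f g : H1 f g -> L2 g.
Proof. by move=> [_ []]. Qed.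

Lemma weak_derivativeD f fx g gx : L2 f -> L2 g ->
  weak_derivative f fx -> weak_derivative g gx ->
  weak_derivative (fun x => f x + g x) (fun x => fx x + gx x).
Proof.
move=> f2 g2 [fx2 Hf] [gx2 Hg]; split; first exact: L2D.
move=> phi phit; have ? := test_function_L2 phit; have ? := test_function_dL2 phit.
by rewrite !dotDl// Hf// Hg// opprD.
Qed.

Lemma weak_derivativeZ a f fx : L2 f -> weak_derivative f fx ->
  weak_derivative (fun x => a * f x) (fun x => a * fx x).
Proof.
move=> f2 [fx2 Hf]; split; first exact: L2Z.
move=> phi phit; have ? := test_function_L2 phit; have ? := test_function_dL2 phit.
by rewrite !dotZl// Hf// mulrN.
Qed.

Lemma weak_derivativeB f fx g gx : L2 f -> L2 g ->
  weak_derivative f fx -> weak_derivative g gx ->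
  weak_derivative (fun x => f x - g x) (fun x => fx x - gx x).
Proof.
move=> f2 g2 [fx2 Hf] [gx2 Hg]; split; first exact: L2B.
move=> phi phit; have ? := test_function_L2 phit; have ? := test_function_dL2 phit.
by rewrite !dotBl// Hf// Hg// opprK opprB addrC.
Qed.

Lemma H1D f fx g gx : H1 f fx -> H1 g gx ->
  H1 (fun x => f x + g x) (fun x => fx x + gx x).
Proof.
move=> [cf Hf] [cg Hg]; split; first exact: cont01D.
by apply: weak_derivativeD => //; exact: cont01_L2.
Qed.

Lemma H1Z a f fx : H1 f fx -> H1 (fun x => a * f x) (fun x => a * fx x).
Proof.
move=> [cf Hf]; split; first exact: cont01Z.
by apply: weak_derivativeZ => //; exact: cont01_L2.
Qed.

Lemma H1B f fx g gx : H1 f fx -> H1 g gx ->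
  H1 (fun x => f x - g x) (fun x => fx x - gx x).
Proof.
move=> [cf Hf] [cg Hg]; split; first exact: cont01B.
by apply: weak_derivativeB => //; exact: cont01_L2.
Qed.

Lemma C1_H1 (F f : R -> R) : (forall x, is_derive x 1 F (f x)) ->
  continuous f -> H1 F f.
Proof.
move=> Ff cf; split; last exact: isd_weak_derivative.
by apply: continuous_cont01 => x; exact: isd_continuous (Ff x).
Qed.

Lemma weak_derivative_unique f g g' h : weak_derivative f g -> weak_derivative f g' ->
  L2 h -> dot g h = dot g' h.
Proof.
move=> [g2 Hg] [g'2 Hg'] h2; apply/eqP; rewrite -subr_eq0 -dotBl//; apply/eqP.
apply: dot_orth_test => //; first exact: L2B.
move=> phi phit; rewrite dotBl//; last exact: test_function_L2.
by apply/eqP; rewrite subr_eq0 -eqr_opp -Hg// -Hg'.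
Qed.

(** F is a primitive of a test function close to g, shifted to agree with f at 0. The oscillation
    bound then makes L^2 closeness of the derivatives into uniform closeness of the functions. *)
Lemma H1_approx f g e : H1 f g -> 0 < e -> exists F psi : R -> R,
  [/\ forall x, is_derive x 1 F (psi x), continuous psi,
      forall x, 0 <= x <= 1 -> `|f x - F x| <= e &
      L2norm (fun x => g x - psi x) <= e].
Proof.
move=> fg e0; have [psi psit] := (test_functions_dense (H1_dL2 fg)).2 _ (exprn_gt0 2 e0).
rewrite -L2norm_sqr ler_sqr ?nnegrE ?L2norm_ge0 ?(ltW e0)// => gpsi.
have cpsi := test_function_continuous psit.
have [|F [dF _]] := exists_primitive cpsi.
  move=> x x0; have [_ _ [a [b [a0 _]]]] := psit; apply.
  by rewrite negb_and -ltNge (le_lt_trans x0).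
have dF' x : is_derive x 1 (fun x => F x + (f 0 - F 0)) (psi x).
  by have := isdD (dF x) (isd_cst (f 0 - F 0) x); rewrite addr0.
exists (fun x => F x + (f 0 - F 0)), psi; split => // x x01.
have := H1_holder (H1B fg (C1_H1 dF cpsi)) x01 (_ : 0 <= 0 <= 1).
rewrite lexx ler01 => /(_ isT) H; apply: le_trans gpsi; apply: le_trans H.
by rewrite (_ : f x - _ = f x - F x - (f 0 - F 0))//; ring.
Qed.

Lemma dot_bound f g (M : R) : cont01 f -> L2 g -> (forall x, 0 <= x <= 1 -> `|f x| <= M) ->
  `|dot g f| <= L2norm g * M.
Proof.
move=> cf g2 fM; have f2 := cont01_L2 cf.
have M0 : 0 <= M by rewrite (le_trans _ (fM 0 _))// lexx ler01.
apply: le_trans (dot_le_norm g2 f2) _; rewrite ler_wpM2l ?L2norm_ge0//.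
rewrite -(ger0_norm M0) -sqrtr_sqr ler_wsqrtr//.
have -> : M ^+ 2 = dot (fun=> M) (fun=> M).
  rewrite /dot Rintegral_cst//= -[fine _]/(fine (mu I)) mu_I /= mulr1.
  by rewrite expr2.
have c2 := @L2_cst R M; apply: le_Rintegral => //; [exact: L2_integrable_mul..|].
move=> x /I_sub x01; rewrite -!expr2 -real_normK ?num_real//.
by rewrite ler_sqr ?nnegrE//; exact: fM.
Qed.

(** The failure of the product rule for f g k. It is linear in each pair, and controlled by the sup
    of the function and the L^2 norm of its derivative; by [H1_approx] it vanishes once it vanishes
    for C^1 functions. *)
Let defect f fx g gx k kx : R :=
  dot fx (fun x => g x * k x) + dot gx (fun x => f x * k x)
  + dot kx (fun x => f x * g x) - (f 1 * g 1 * k 1 - f 0 * g 0 * k 0).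

Let defect_closure f fx g gx k kx : cont01 g -> L2 gx -> cont01 k -> L2 kx ->
  (forall F psi : R -> R, (forall x, is_derive x 1 F (psi x)) -> continuous psi ->
     defect F psi g gx k kx = 0) ->
  H1 f fx -> defect f fx g gx k kx = 0.
Proof.
move=> cg gx2 ck kx2 H ffx; have [cf _] := ffx; have fx2 := H1_dL2 ffx.
have [Mg gM] := cont01_bounded cg; have [Mk kM] := cont01_bounded ck.
have z01 : 0 <= (0 : R) <= 1 by rewrite lexx ler01.
have o01 : 0 <= (1 : R) <= 1 by rewrite lexx ler01.
have Mg0 : 0 <= Mg by rewrite (le_trans _ (gM 0 _)).
have Mk0 : 0 <= Mk by rewrite (le_trans _ (kM 0 _)).
(* The sum of the errors in the three pairings and the two boundary values per unit of approximation
   error; the last 1 makes it positive. *)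
pose C := Mg * Mk + L2norm gx * Mk + L2norm kx * Mg + Mg * Mk + Mg * Mk + 1.
have C0 : 0 < C by rewrite ltr_wpDl// !addr_ge0 ?mulr_ge0 ?L2norm_ge0.
apply/eqP; rewrite -normr_le0; apply/ler_addgt0Pr => e e0; rewrite add0r.
have eC0 : 0 < e / C by rewrite divr_gt0.
have [F [psi [dF cpsi fF fxpsi]]] := H1_approx ffx eC0.
have [cF _] := C1_H1 dF cpsi.
have psi2 := cont01_L2 (continuous_cont01 cpsi).
have cfF := cont01B cf cF.
have fF2 := L2B fx2 psi2.
have bd x : 0 <= x <= 1 -> `|(f x - F x) * g x * k x| <= e / C * (Mg * Mk).
  by move=> x01; rewrite -mulrA !normrM ler_pM ?ler_pM ?mulr_ge0 ?fF ?gM ?kM.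
have -> : defect f fx g gx k kx =
    dot (fun x => fx x - psi x) (fun x => g x * k x)
    + dot gx (fun x => (f x - F x) * k x) + dot kx (fun x => (f x - F x) * g x)
    - ((f 1 - F 1) * g 1 * k 1 - (f 0 - F 0) * g 0 * k 0).
  have := H F psi dF cpsi; rewrite /defect => HF; apply/eqP; rewrite -subr_eq0.
  have cM h : cont01 h -> cont01 (fun x => f x * h x) by move=> ?; exact: cont01M.
  have cMF h : cont01 h -> cont01 (fun x => F x * h x) by move=> ?; exact: cont01M.
  have E h l : cont01 h -> L2 l -> dot l (fun x => (f x - F x) * h x) =
      dot l (fun x => f x * h x) - dot l (fun x => F x * h x).
    move=> ch l2; rewrite -dotBr//; [|exact: cont01_L2 (cM _ ch)|exact: cont01_L2 (cMF _ ch)].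
    by apply: eq_dot => // x _; ring.
  rewrite !E// dotBl//; last by apply: cont01_L2; exact: cont01M.
  by apply/eqP; rewrite -[RHS]HF; ring.
have n1 : `|dot (fun x => fx x - psi x) (fun x => g x * k x)| <= e / C * (Mg * Mk).
  apply: le_trans (_ : L2norm (fun x => fx x - psi x) * (Mg * Mk) <= _); last first.
    by rewrite ler_wpM2r ?mulr_ge0.
  apply: dot_bound => //; first exact: cont01M.
  by move=> x x01; rewrite normrM ler_pM ?gM ?kM.
have n2 : `|dot gx (fun x => (f x - F x) * k x)| <= L2norm gx * (e / C * Mk).
  apply: dot_bound => //; first exact: cont01M.
  by move=> x x01; rewrite normrM ler_pM ?fF ?kM.
have n3 : `|dot kx (fun x => (f x - F x) * g x)| <= L2norm kx * (e / C * Mg).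
  apply: dot_bound => //; first exact: cont01M.
  by move=> x x01; rewrite normrM ler_pM ?fF ?gM.
apply: le_trans (_ : e / C * C <= _); last by rewrite divfK ?gt_eqF.
move: n1 n2 n3 (bd 1 o01) (bd 0 z01).
set d1 := dot _ _; set d2 := dot _ _; set d3 := dot _ _.
set b1 := _ * k 1; set b0 := _ * k 0; rewrite /C; set ec := e / _; have ec0 : 0 < ec := eC0.
rewrite !ler_norml => /andP[? ?] /andP[? ?] /andP[? ?] /andP[? ?] /andP[? ?].
by apply/andP; split; lra.
Qed.

Let defect_swap f fx g gx k kx : defect f fx g gx k kx = defect g gx f fx k kx.
Proof.
rewrite /defect (@eq_dot _ kx kx (fun x => f x * g x) (fun x => g x * f x))//; first ring.
by move=> x _; ring.
Qed.

Let defect_rot f fx g gx k kx : defect f fx g gx k kx = defect k kx f fx g gx.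
Proof.
rewrite /defect (@eq_dot _ fx fx (fun x => g x * k x) (fun x => k x * g x))//; last by move=> x _; ring.
rewrite (@eq_dot _ gx gx (fun x => f x * k x) (fun x => k x * f x))//; last by move=> x _; ring.
ring.
Qed.

(** The factors are replaced by C^1 functions one at a time, each brought to the front by the
    symmetry of [defect]; the smooth case is the fundamental theorem. Three factors accommodate the
    convection term and the weight in the Poincare inequality. *)
Lemma integration_by_parts3 f fx g gx k kx : H1 f fx -> H1 g gx -> H1 k kx ->
  dot fx (fun x => g x * k x) + dot gx (fun x => f x * k x)
  + dot kx (fun x => f x * g x) = f 1 * g 1 * k 1 - f 0 * g 0 * k 0.
Proof.
move=> Hf Hg Hk; apply/eqP; rewrite -subr_eq0; apply/eqP; rewrite -/(defect f fx g gx k kx).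
apply: (defect_closure Hg.1 (H1_dL2 Hg) Hk.1 (H1_dL2 Hk) _ Hf) => F psi dF cpsi.
have HF := C1_H1 dF cpsi; rewrite defect_swap.
apply: (defect_closure HF.1 (H1_dL2 HF) Hk.1 (H1_dL2 Hk) _ Hg) => G psig dG cpsig.
have HG := C1_H1 dG cpsig; rewrite defect_rot.
apply: (defect_closure HG.1 (H1_dL2 HG) HF.1 (H1_dL2 HF) _ Hk) => K psik dK cpsik.
have HK := C1_H1 dK cpsik.
have cc f' : cont01 f' -> L2 f' := @cont01_L2 _ f'.
have cF x : {for x, continuous F} := isd_continuous (dF x).
have cG x : {for x, continuous G} := isd_continuous (dG x).
have cK x : {for x, continuous K} := isd_continuous (dK x).
have := @fundamental_theorem01 _ (fun x => K x * (G x * F x))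
  (fun x => psik x * (G x * F x) + K x * (psig x * F x + G x * psi x)).
have i1 := L2_integrable_mul (H1_dL2 HK) (cc _ (cont01M HG.1 HF.1)).
have i2 := L2_integrable_mul (H1_dL2 HG) (cc _ (cont01M HK.1 HF.1)).
have i3 := L2_integrable_mul (H1_dL2 HF) (cc _ (cont01M HK.1 HG.1)).
move=> FTC; apply/eqP; rewrite /defect subr_eq0 /dot -!RintegralD//; last first.
  by apply: (integrableD _ i1 i2).
apply/eqP; rewrite -!(mulrA (K _)); apply: (eq_trans _ (FTC _ _)).
- by apply: eq_Rintegral => x _; ring.
- by move=> x; apply: isdM => //; exact: isdM.
- move=> x; apply: cvgD; apply: cvgM; [exact: cpsik| |exact: cK|].
    by apply: cvgM; [exact: cG|exact: cF].
  apply: cvgD; apply: cvgM; [exact: cpsig|exact: cF|exact: cG|exact: cpsi].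
Qed.


Lemma H1_cst a : H1 (fun=> a) (fun=> 0).
Proof. by apply: (C1_H1 (isd_cst a)) => x; exact: cvg_cst. Qed.

Lemma H1_affine a : H1 (fun x => x - a) (fun=> 1).
Proof.
have dA x : is_derive x 1 (fun y : R => y - a) 1.
  by apply: isd_eq (isdB (isd_id x) (isd_cst a x)) _ _ => //; rewrite subr0.
by apply: (C1_H1 dA) => x; exact: cvg_cst.
Qed.

Lemma integration_by_parts2 f fx g gx : H1 f fx -> H1 g gx ->
  dot fx g + dot gx f = f 1 * g 1 - f 0 * g 0.
Proof.
move=> Hf Hg; have := integration_by_parts3 Hf Hg (H1_cst 1).
rewrite (@dot0l _ (fun=> 0))// addr0 !mulr1 => <-.
by congr (_ + _); apply: eq_dot => // x _; rewrite mulr1.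
Qed.

(** The weight x vanishes at 0 and equals 1 at 1, which isolates one boundary value; it is written x
    - 0 to fit [H1_affine]. *)
Lemma trace1 f fx : H1 f fx -> f 1 = dot f (fun=> 1) + dot fx (fun x => x - 0).
Proof.
move=> Hf; have := integration_by_parts2 Hf (H1_affine 0).
by rewrite subr0 mulr1 subrr mulr0 subr0 addrC dotC => ->.
Qed.

Lemma trace0 f fx : H1 f fx -> f 0 = dot f (fun=> 1) + dot fx (fun x => x - 1).
Proof.
move=> Hf; have := integration_by_parts2 Hf (H1_affine 1).
by rewrite subrr mulr0 sub0r sub0r mulrN1 opprK addrC dotC => ->.
Qed.

(** The weight x - 1/2 yields (f(0)^2 + f(1)^2) / 2 = |f|^2 + 2 (f_x, (x - 1/2) f). The constant 1
    in front of each term is what allows 2 alpha to be compared directly with nu and c_i + w_d in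
    [beta]. *)
Lemma poincare f fx : H1 f fx -> dot f f <= dot fx fx + f 0 ^+ 2 + f 1 ^+ 2.
Proof.
move=> Hf; have f2 := H1_L2 Hf; have fx2 := H1_dL2 Hf.
have := integration_by_parts3 Hf Hf (H1_affine 2^-1).
have cA : cont01 (fun x : R => x - 2^-1) by case: (H1_affine 2^-1).
have fA2 := cont01_L2M cA f2.
rewrite (@eq_dot _ fx fx (fun x => f x * (x - 2^-1)) (fun x => (x - 2^-1) * f x))//; last first.
  by move=> x _; rewrite mulrC.
have -> : dot (fun=> 1) (fun x => f x * f x) = dot f f.
  by apply: eq_Rintegral => x _; rewrite mul1r.
have nfx2 := L2N fx2; have half0 : 0 < 2^-1 :> R by rewrite invr_gt0.
have := dot_young half0 nfx2 fA2.
rewrite invrK !dotNl// dotNr// opprK.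
have : dot (fun x => (x - 2^-1) * f x) (fun x => (x - 2^-1) * f x) <= 2^-1 ^+ 2 * dot f f.
  apply: dot_bndM => //; first exact: cont01_measurable.
  by move=> x /I_sub /andP[? ?]; rewrite ler_norml; apply/andP; split; lra.
have := dot_ge0 f; set A := dot f f; set B := dot fx fx; set D := dot fx _; set E := dot _ _.
have ? := sqr_ge0 (f 0); have ? := sqr_ge0 (f 1); lra.
Qed.

Lemma H1_sup f fx x : H1 f fx -> 0 <= x <= 1 ->
  f x ^+ 2 <= 2 * f 0 ^+ 2 + 2 * dot fx fx.
Proof.
move=> Hf x01; have z01 : 0 <= (0 : R) <= 1 by rewrite lexx ler01.
have := H1_holder Hf x01 z01; rewrite -L2norm_sqr -ler_sqr ?nnegrE ?L2norm_ge0//.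
rewrite real_normK ?num_real//; have := sqr_ge0 (f x - f 0 - f 0).
move: (f x) (f 0) (L2norm fx) => a b n; nra.
Qed.

Let dot11 : dot (fun=> 1 : R) (fun=> 1) = 1.
Proof. by rewrite /dot Rintegral_cst//= -[fine _]/(fine (mu I)) mu_I /= !mulr1. Qed.

Let affine_dot a : 0 <= a <= 1 -> dot (fun x => x - a) (fun x => x - a) <= 1.
Proof.
move=> /andP[a0 a1]; have [cA _] := H1_affine a.
have := @dot_bndM _ 1 (fun x => x - a) (fun=> 1) (cont01_measurable cA) _ (L2_cst 1).
rewrite dot11 expr1n mulr1 (@eq_dot _ _ (fun x => x - a) _ (fun x => x - a)); last 2 first.
- by move=> x _; rewrite mulr1.
- by move=> x _; rewrite mulr1.
by apply=> x /I_sub /andP[? ?]; rewrite ler_norml; apply/andP; split; lra.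
Qed.

Let trace_le f fx (a b : R) : 0 <= a <= 1 -> H1 f fx ->
  b = dot f (fun=> 1) + dot fx (fun x => x - a) ->
  b ^+ 2 <= 2 * dot f f + 2 * dot fx fx.
Proof.
move=> a01 Hf ->; have f2 := H1_L2 Hf; have fx2 := H1_dL2 Hf.
have A2 : L2 (fun x => x - a) by exact: H1_L2 (H1_affine a).
have := dot_CS fx2 A2; have := dot_CS f2 (@L2_cst R 1); rewrite dot11 mulr1.
have := affine_dot a01; have := dot_ge0 fx.
set X := dot f _; set Y := dot fx (fun x => x - a); set B := dot fx fx; set D := dot _ _ => ? ? ? ?.
have ? : Y ^+ 2 <= B by nra.
by have := sqr_ge0 (X - Y); nra.
Qed.

Lemma trace0_le f fx : H1 f fx -> f 0 ^+ 2 <= 2 * dot f f + 2 * dot fx fx.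
Proof.
by move=> Hf; apply: (@trace_le _ _ 1) => //; [rewrite ler01 lexx|exact: trace0].
Qed.

Lemma trace1_le f fx : H1 f fx -> f 1 ^+ 2 <= 2 * dot f f + 2 * dot fx fx.
Proof.
by move=> Hf; apply: (@trace_le _ _ 0) => //; [rewrite ler01 lexx|exact: trace1].
Qed.

End H1space.

(** * Functions of time *)

Section ScalarTime.
Context {R : realType}.
Implicit Types (f g df dg : R -> R) (a t : R).

(** The weak equation holds only for t > 0; right continuity at 0 lets a monotone energy still be
    compared with its initial value. *)
Definition der0 f df : Prop :=
  (forall t, 0 < t -> is_derive t 1 f (df t)) /\ f t @[t --> 0^'+] --> f 0.

Lemma der0_eq f df g dg : der0 f df -> (forall t, 0 <= t -> f t = g t) ->
  (forall t, 0 < t -> df t = dg t) -> der0 g dg.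
Proof.
move=> [Hf f0] fg dfg; split=> [t t0|].
  rewrite -dfg//; apply: near_eq_is_derive (Hf t t0); near=> s.
  by apply: fg; apply: ltW; near: s; exact: lt_nbhsr.
rewrite -fg//; apply: cvg_trans f0; apply: near_eq_cvg; near=> s.
by apply: fg; near: s; exact: nbhs_right_ge.
Unshelve. all: by end_near. Qed.

Lemma der0D f df g dg : der0 f df -> der0 g dg ->
  der0 (fun t => f t + g t) (fun t => df t + dg t).
Proof.
move=> [Hf f0] [Hg g0]; split; last exact: cvgD.
by move=> t t0; apply: isdD; [exact: Hf|exact: Hg].
Qed.

Lemma der0Z a f df : der0 f df -> der0 (fun t => a * f t) (fun t => a * df t).
Proof.
move=> [Hf f0]; split; last by apply: cvgM => //; exact: cvg_cst.
by move=> t t0; apply: isdZ; exact: Hf.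
Qed.

Lemma der0M f df g dg : der0 f df -> der0 g dg ->
  der0 (fun t => f t * g t) (fun t => df t * g t + f t * dg t).
Proof.
move=> [Hf f0] [Hg g0]; split; last exact: cvgM.
by move=> t t0; apply: isdM; [exact: Hf|exact: Hg].
Qed.

Lemma der0_expR f df : der0 f df ->
  der0 (fun t => expR (f t)) (fun t => df t * expR (f t)).
Proof.
move=> [Hf f0]; split; first by move=> t t0; apply: isd_expR; exact: Hf.
by apply: (cvg_comp _ _ f0); exact: continuous_expR.
Qed.

Lemma der0_id : der0 (fun t => t) (fun=> 1).
Proof.
by split=> [t _|]; [exact: isd_id|apply: cvg_at_right_filter; exact: cvg_id].
Qed.

Lemma der0_shift h f df : 0 < h -> der0 f df ->
  der0 (fun t => f (t + h)) (fun t => df (t + h)).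
Proof.
move=> h0 [Hf _]; have H t : 0 <= t -> is_derive t 1 (fun t => f (t + h)) (df (t + h)).
  by move=> t0; apply: isd_shift; apply: Hf; rewrite ltr_wpDl.
split; first by move=> t /ltW; exact: H.
by apply: cvg_at_right_filter; exact: isd_continuous (H 0 (lexx _)).
Qed.

Lemma der0_within f df a b : der0 f df -> 0 <= a -> a < b ->
  {within `[a, b], continuous f}.
Proof.
move=> [Hf f0] a0 ab.
apply/continuous_within_itvP => //; split.
- move=> x; rewrite in_itv/= => /andP[ax _].
  exact: isd_continuous (Hf x (le_lt_trans a0 ax)).
- move: a0; rewrite le_eqVlt => /predU1P[<-//|a0].
  by apply: cvg_at_right_filter; exact: isd_continuous (Hf a a0).
- apply: cvg_at_left_filter; exact: isd_continuous (Hf b (le_lt_trans a0 ab)).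
Qed.

Lemma der0_nonincreasing f df a b : der0 f df -> (forall t, 0 < t -> df t <= 0) ->
  0 <= a <= b -> f b <= f a.
Proof.
move=> Hf df0 /andP[a0]; rewrite le_eqVlt => /predU1P[->//|ab].
apply: (isd_nonincreasing (ltW ab) (der0_within Hf a0 ab) (df := df)).
  by move=> x /andP[ax _]; apply: Hf.1; exact: le_lt_trans ax.
by move=> x /andP[ax _]; apply: df0; exact: le_lt_trans ax.
Qed.

Lemma der0_lipschitz f df a b L : der0 f df -> (forall t, 0 < t -> `|df t| <= L) ->
  0 <= a <= b -> `|f b - f a| <= L * (b - a).
Proof.
move=> Hf dfL /andP[a0]; rewrite le_eqVlt => /predU1P[->|ab].
  by rewrite !subrr normr0 mulr0.
apply: (isd_lipschitz (ltW ab) (der0_within Hf a0 ab) (df := df)).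
  by move=> x /andP[ax _]; apply: Hf.1; exact: le_lt_trans ax.
by move=> x /andP[ax _]; apply: dfL; exact: le_lt_trans ax.
Qed.

(** Applied to the pairing of two Lipschitz increments, the remainder in [WD_dot]. *)
Lemma isd_quadratic f t C : 0 < t -> 0 <= C ->
  (forall s, 0 <= s -> `|f s| <= C * (s - t) ^+ 2) -> is_derive t 1 f 0.
Proof.
move=> t0 C0 fC; apply/isdP/cvgrPdist_le => /= e e0.
have ft0 : f t = 0.
  by apply/eqP; rewrite -normr_le0 (le_trans (fC t (ltW t0)))// subrr expr0n/= mulr0.
have d0 : 0 < e / (C + 1) by rewrite divr_gt0// ltr_wpDl.
near=> h; have h0 : h != 0 by near: h; exact: nbhs_dnbhs_neq.
have ht : `|h| < t by near: h; exact: dnbhs0_lt.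
have he : `|h| <= e / (C + 1) by near: h; exact: dnbhs0_le.
rewrite sub0r normrN ft0 subr0 normrM normfV ler_pdivrMl ?normr_gt0//.
have th : 0 <= t + h by move: ht; rewrite ltr_norml => /andP[]; lra.
apply: le_trans (fC _ th) _; rewrite addrAC subrr add0r -real_normK ?num_real//.
rewrite expr2 mulrCA ler_wpM2l// (le_trans (ler_wpM2l C0 he))//.
rewrite mulrCA -[leRHS]mulr1 ler_wpM2l ?(ltW e0)// ler_pdivrMr ?mul1r; lra.
Unshelve. all: by end_near. Qed.

End ScalarTime.

(** * Lipschitz curves in L^2(0,1) and their weak derivatives *)

Section VectorTime.
Context {R : realType}.
Implicit Types (v y : R -> R -> R) (phi psi : R -> R) (a t L : R).

(* [v] is a Lipschitz map from [0, +oo) to L^2(0,1) whose weak derivative at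
   each t > 0 is [v' t]. *)
Definition WD L v v' : Prop :=
  [/\ forall t, 0 <= t -> L2 (v t),
      forall t, 0 <= t -> L2 (v' t),
      forall s t, 0 <= s -> 0 <= t -> L2norm (fun x => v t x - v s x) <= L * `|t - s| &
      forall t, 0 < t -> forall phi, L2 phi ->
        is_derive t 1 (fun s => dot (v s) phi) (dot (v' t) phi)].

(** The mean value theorem and duality give the Lipschitz bound from test functions alone, and the
    Lipschitz bound lets density extend differentiability to every phi in L^2. This form fits w_x
    and z_x, whose time derivatives are found by moving the space derivative to the test
    function. *)
Lemma WD_intro L v v' : 0 <= L ->
  (forall t, 0 <= t -> L2 (v t)) -> (forall t, 0 <= t -> L2 (v' t)) ->
  (forall t, 0 < t -> L2norm (v' t) <= L) ->
  (forall phi, test_function phi ->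
    der0 (fun t => dot (v t) phi) (fun t => dot (v' t) phi)) ->
  WD L v v'.
Proof.
move=> L0 v2 v'2 v'L Hv.
have lip s t : 0 <= s -> s <= t ->
    L2norm (fun x => v t x - v s x) <= L * (t - s).
  move=> s0 st; have t0 := le_trans s0 st.
  have vts2 := L2B (v2 t t0) (v2 s s0).
  apply: L2norm_le_dual => //; first by rewrite mulr_ge0// subr_ge0.
  move=> phi phit; have phi2 := test_function_L2 phit.
  rewrite dotBl; [|exact: v2|exact: v2|exact: phi2].
  apply: le_trans (ler_norm _) _.
  rewrite mulrAC; apply: (der0_lipschitz (Hv _ phit)); last by rewrite s0.
  move=> r r0; apply: le_trans (dot_le_norm (v'2 r (ltW r0)) phi2) _.
  by rewrite ler_wpM2r ?L2norm_ge0// v'L.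
have lip' s t : 0 <= s -> 0 <= t -> L2norm (fun x => v t x - v s x) <= L * `|t - s|.
  move=> s0 t0; have [st|ts] := leP s t.
    by rewrite ger0_norm ?subr_ge0// lip.
  rewrite distrC ger0_norm ?subr_ge0 ?(ltW ts)//.
  have -> : L2norm (fun x => v t x - v s x) = L2norm (fun x => v s x - v t x).
    by congr Num.sqrt; apply: eq_Rintegral => x _; ring.
  by apply: lip => //; exact: ltW.
split => // t t0 phi phi2; apply/isdP/cvgrPdist_le => /= e e0.
(* Replacing phi by psi costs at most L d <= e / 4 in the derivative and again in the quotient,
   leaving e / 2 for psi itself. *)
pose d := e / (4 * (L + 1)).
have d0 : 0 < d by rewrite divr_gt0// mulr_gt0// ltr_wpDl.
have dL : L * d <= e / 4.
  by rewrite /d mulrCA ler_pM2l// invfM mulrCA ler_piMr// ler_pdivrMr ?mul1r; lra.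
have [psi psit] := (test_functions_dense phi2).2 _ (exprn_gt0 2 d0).
rewrite -L2norm_sqr ler_sqr ?nnegrE ?L2norm_ge0 ?(ltW d0)// => phipsi.
have psi2 := test_function_L2 psit; have D2 := L2B phi2 psi2.
have e2 : 0 < e / 2 by rewrite divr_gt0.
have /isdP/cvgrPdist_le/(_ _ e2) Hpsi := (Hv psi psit).1 t t0.
near=> h; have h0 : h != 0 by near: h; exact: nbhs_dnbhs_neq.
have ht : `|h| < t by near: h; exact: dnbhs0_lt.
have th : 0 <= t + h by move: ht; rewrite ltr_norml => /andP[]; lra.
have : `|dot (v' t) psi - h^-1 * (dot (v (t + h)) psi - dot (v t) psi)| <= e / 2.
  by near: h; exact: Hpsi.
have t0' := ltW t0.
have : `|dot (v' t) (fun x => phi x - psi x)| <= L * d.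
  apply: le_trans (dot_le_norm (v'2 t t0') D2) _.
  by rewrite ler_pM ?L2norm_ge0// v'L.
have vth2 := L2B (v2 _ th) (v2 _ t0').
have : `|h^-1 * dot (fun x => v (t + h) x - v t x) (fun x => phi x - psi x)| <= L * d.
  rewrite normrM normfV ler_pdivrMl ?normr_gt0//.
  apply: le_trans (dot_le_norm vth2 D2) _; rewrite mulrA ler_pM ?L2norm_ge0//.
  by apply: le_trans (lip' _ _ t0' th) _; rewrite addrAC subrr add0r mulrC.
rewrite (dotBr phi2 psi2 (v'2 t t0')) (dotBr phi2 psi2 vth2).
rewrite !(dotBl (v2 _ th) (v2 _ t0'))//.
set a1 := dot (v' t) phi; set a2 := dot (v' t) psi.
set b1 := dot (v t) phi; set b2 := dot (v t) psi.
set c1 := dot _ phi; set c2 := dot _ psi.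
rewrite !mulrBr; set p1 := _ * c1; set p2 := _ * c2; set q1 := _ * b1; set q2 := _ * b2.
rewrite !ler_norml => /andP[? ?] /andP[? ?] /andP[? ?]; apply/andP; split; lra.
Unshelve. all: by end_near. Qed.

Lemma WD_L2 L v v' t : WD L v v' -> 0 <= t -> L2 (v t).
Proof. by case=> H *; exact: H. Qed.

Lemma eq_L2norm (f g : R -> R) : (forall x, f x = g x) -> L2norm f = L2norm g.
Proof. by move=> /funext ->. Qed.

(** This Lipschitz constant blows up as h tends to 0, which is harmless where only its existence
    matters; the bound uniform in h is [WD_quotient_le]. *)
Lemma WD_quotient L v v' h : 0 < h -> WD L v v' ->
  WD (h^-1 * (L + L)) (fun t x => h^-1 * (v (t + h) x - v t x))
     (fun t x => h^-1 * (v' (t + h) x - v' t x)).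
Proof.
move=> h0 [v2 v'2 Lv dv].
have sh t : 0 <= t -> 0 <= t + h by move=> t0; rewrite addr_ge0// ltW.
have vB t : 0 <= t -> L2 (fun x => v (t + h) x - v t x).
  by move=> t0; apply: L2B; apply: v2 => //; exact: sh.
have v'B t : 0 <= t -> L2 (fun x => v' (t + h) x - v' t x).
  by move=> t0; apply: L2B; apply: v'2 => //; exact: sh.
split.
- by move=> t t0; apply: L2Z; exact: vB.
- by move=> t t0; apply: L2Z; exact: v'B.
- move=> s t s0 t0.
  pose D := fun x => (v (t + h) x - v (s + h) x) + - (v t x - v s x).
  have D1 := L2B (v2 _ (sh _ t0)) (v2 _ (sh _ s0)).
  have D2 := L2B (v2 _ t0) (v2 _ s0).
  have DD : L2 D := L2D D1 (L2N D2).
  rewrite (@eq_L2norm _ (fun x => h^-1 * D x)); last by move=> x; rewrite /D; ring.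
  have -> : L2norm (fun x => h^-1 * D x) = h^-1 * L2norm D.
    rewrite /L2norm dotZl// ?dotZr//; last exact: L2Z.
    by rewrite mulrA -expr2 sqrtrM ?sqr_ge0// sqrtr_sqr ger0_norm// invr_ge0 ltW.
  rewrite -mulrA ler_wpM2l ?invr_ge0 ?(ltW h0)//.
  apply: le_trans (L2norm_triangle D1 (L2N D2)) _; rewrite mulrDl; apply: lerD.
    by apply: le_trans (Lv _ _ (sh _ s0) (sh _ t0)) _; rewrite opprD addrACA subrr addr0.
  rewrite (_ : L2norm _ = L2norm (fun x => v t x - v s x)); first exact: Lv.
  by rewrite /L2norm dotNl// ?dotNr// ?opprK//; exact: L2N.
- move=> t t0 phi phi2; have t0' := ltW t0.
  rewrite (dotZl h^-1 (v'B _ t0') phi2) (dotBl (v'2 _ (sh _ t0')) (v'2 _ t0') phi2).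
  have := isdZ h^-1 (isdB (isd_shift (dv (t + h) (ltr_wpDl t0' h0) phi phi2)) (dv t t0 phi phi2)).
  apply: near_eq_is_derive; near=> s; have s0 : 0 <= s.
    by apply: ltW; near: s; exact: lt_nbhsr.
  by rewrite (dotZl h^-1 (vB _ s0) phi2) (dotBl (v2 _ (sh _ s0)) (v2 _ s0) phi2).
Unshelve. all: by end_near. Qed.

Lemma WD_lipschitz L v v' s t : WD L v v' -> 0 <= s -> 0 <= t ->
  L2norm (fun x => v t x - v s x) <= L * `|t - s|.
Proof. by case=> _ _ H *; exact: H. Qed.

Lemma WD_quotient_le L v v' h t : 0 < h -> WD L v v' -> 0 <= t ->
  L2norm (fun x => h^-1 * (v (t + h) x - v t x)) <= L.
Proof.
move=> h0 Hv t0; have sh : 0 <= t + h by rewrite addr_ge0// ltW.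
have D2 := L2B (WD_L2 Hv sh) (WD_L2 Hv t0).
have -> : L2norm (fun x => h^-1 * (v (t + h) x - v t x)) =
    h^-1 * L2norm (fun x => v (t + h) x - v t x).
  rewrite /L2norm dotZl// ?dotZr//; last exact: L2Z.
  by rewrite mulrA -expr2 sqrtrM ?sqr_ge0// sqrtr_sqr ger0_norm// invr_ge0 ltW.
rewrite ler_pdivrMl// mulrC; apply: le_trans (WD_lipschitz Hv t0 sh) _.
by rewrite addrAC subrr add0r ger0_norm// ltW.
Qed.

Lemma cvg_right0_linear (f : R -> R) (C : R) :
  (forall s, 0 < s -> s < 1 -> `|f 0 - f s| <= C * s) -> f s @[s --> 0^'+] --> f 0.
Proof.
move=> H; have C1 : 0 < `|C| + 1 by rewrite ltr_wpDl.
apply/cvgrPdist_le => /= e e0; near=> s.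
have s0 : 0 < s by near: s; exact: nbhs_right_gt.
have s1 : s < 1 by near: s; exact: nbhs_right_lt.
apply: le_trans (H s s0 s1) _; apply: (@le_trans _ _ ((`|C| + 1) * s)).
  by rewrite ler_wpM2r ?(ltW s0)// (le_trans (ler_norm _))// lerDl.
rewrite mulrC -ler_pdivlMr//; near: s; apply: nbhs_right_le; exact: divr_gt0.
Unshelve. all: by end_near. Qed.

(** Expanding around t leaves the pairing of two increments, which the Lipschitz bounds make
    quadratic in s - t. Weak differentiability of both factors is therefore enough. *)
Lemma WD_dot L M v v' y y' : WD L v v' -> WD M y y' ->
  der0 (fun t => dot (v t) (y t)) (fun t => dot (v' t) (y t) + dot (v t) (y' t)).
Proof.
move=> Hv Hy; have [v2 v'2 Lv dv] := Hv; have [y2 y'2 Ly dy] := Hy.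
have expand s t : 0 <= s -> 0 <= t -> dot (v s) (y s) =
    dot (v s) (y t) + dot (v t) (y s) - dot (v t) (y t)
    + dot (fun x => v s x - v t x) (fun x => y s x - y t x).
  move=> s0 t0; have a := v2 _ s0; have b := v2 _ t0; have c := y2 _ s0; have d := y2 _ t0.
  have e := L2B c d.
  by rewrite dotBl// !dotBr//; ring.
have quad s t : 0 <= s -> 0 <= t ->
    `|dot (fun x => v s x - v t x) (fun x => y s x - y t x)| <= `|L| * `|M| * (s - t) ^+ 2.
  move=> s0 t0; have A := L2B (v2 _ s0) (v2 _ t0); have B := L2B (y2 _ s0) (y2 _ t0).
  apply: le_trans (dot_le_norm A B) _.
  rewrite -real_normK ?num_real// expr2 mulrACA ler_pM ?L2norm_ge0//.
    by apply: le_trans (Lv _ _ t0 s0) _; rewrite ler_wpM2r// ler_norm.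
  by apply: le_trans (Ly _ _ t0 s0) _; rewrite ler_wpM2r// ler_norm.
split.
  move=> t t0; have t0' := ltW t0.
  have H2 : is_derive t 1 (fun s => dot (v t) (y s)) (dot (v t) (y' t)).
    apply: isd_eq (dy t t0 (v t) (v2 _ t0')) _ _ => [s|]; exact: dotC.
  have H3 : is_derive t 1 (fun s => dot (fun x => v s x - v t x) (fun x => y s x - y t x)) 0.
    by apply: (isd_quadratic t0 (mulr_ge0 (normr_ge0 L) (normr_ge0 M))) => s s0; exact: quad.
  have := isdD (isdB (isdD (dv t t0 _ (y2 _ t0')) H2) (isd_cst (dot (v t) (y t)) t)) H3.
  rewrite subr0 addr0; apply: near_eq_is_derive; near=> s.
  have s0 : 0 <= s by apply: ltW; near: s; exact: lt_nbhsr.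
  by rewrite [RHS](expand s t).
have z0 := lexx (0 : R).
apply: (@cvg_right0_linear _ (`|L| * L2norm (y 0) + L2norm (v 0) * `|M| + `|L| * `|M|)) => s s0 s1.
have s0' := ltW s0; rewrite (expand s 0)//.
have A := L2B (v2 _ s0') (v2 _ z0); have B := L2B (y2 _ s0') (y2 _ z0).
have e1 : `|dot (v s) (y 0) - dot (v 0) (y 0)| <= `|L| * s * L2norm (y 0).
  rewrite -(dotBl (v2 _ s0') (v2 _ z0) (y2 _ z0)).
  apply: le_trans (dot_le_norm A (y2 _ z0)) _; rewrite ler_wpM2r ?L2norm_ge0//.
  by apply: le_trans (Lv _ _ z0 s0') _; rewrite subr0 (gtr0_norm s0) ler_wpM2r// ler_norm.
have e2 : `|dot (v 0) (y s) - dot (v 0) (y 0)| <= L2norm (v 0) * (`|M| * s).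
  rewrite -(dotBr (y2 _ s0') (y2 _ z0) (v2 _ z0)).
  apply: le_trans (dot_le_norm (v2 _ z0) B) _; rewrite ler_wpM2l ?L2norm_ge0//.
  by apply: le_trans (Ly _ _ z0 s0') _; rewrite subr0 (gtr0_norm s0) ler_wpM2r// ler_norm.
have e3 : `|dot (fun x => v s x - v 0 x) (fun x => y s x - y 0 x)| <= `|L| * `|M| * s.
  apply: le_trans (quad _ _ s0' z0) _; rewrite subr0 ler_wpM2l ?mulr_ge0//.
  by rewrite expr2 ler_piMr// ltW.
move: e1 e2 e3; rewrite !ler_norml => /andP[? ?] /andP[? ?] /andP[? ?].
apply/andP; split; lra.
Unshelve. all: by end_near. Qed.

Lemma WD_cst phi : L2 phi -> WD 0 (fun _ : R => phi) (fun _ : R => (fun=> 0)).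
Proof.
move=> phi2; split => // [t _|s t _ _|t t0 psi psi2]; first exact: L2_cst.
  rewrite mul0r; rewrite /L2norm dot0l ?sqrtr0// => x _; exact: subrr.
by rewrite [X in is_derive _ _ _ X](@dot0l _ (fun=> 0))//; exact: isd_cst.
Qed.

(** Viewing phi as a constant curve adds right continuity at 0 to the weak differentiability of
    [WD]. *)
Lemma WD_pair L v v' phi : WD L v v' -> L2 phi ->
  der0 (fun t => dot (v t) phi) (fun t => dot (v' t) phi).
Proof.
move=> Hv phi2; apply: der0_eq (WD_dot Hv (WD_cst phi2)) _ _ => // t _.
by rewrite [X in _ + X]dotC [X in _ + X]dot0l// addr0.
Qed.

(* Point evaluation at 0 and 1 is a linear functional of (v, v_x). *)
Lemma WD_trace1 L M v v' vx vx' : WD L v v' -> WD M vx vx' ->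
  (forall t, 0 <= t -> H1 (v t) (vx t)) -> (forall t, 0 < t -> H1 (v' t) (vx' t)) ->
  der0 (fun t => v t 1) (fun t => v' t 1).
Proof.
move=> Hv Hvx H H'; have A2 := H1_L2 (@H1_affine R 0).
apply: der0_eq (der0D (WD_pair Hv (L2_cst 1)) (WD_pair Hvx A2)) _ _ => t t0.
  by rewrite -trace1//; exact: H.
by rewrite -trace1//; exact: H'.
Qed.

Lemma WD_trace0 L M v v' vx vx' : WD L v v' -> WD M vx vx' ->
  (forall t, 0 <= t -> H1 (v t) (vx t)) -> (forall t, 0 < t -> H1 (v' t) (vx' t)) ->
  der0 (fun t => v t 0) (fun t => v' t 0).
Proof.
move=> Hv Hvx H H'; have A2 := H1_L2 (@H1_affine R 1).
apply: der0_eq (der0D (WD_pair Hv (L2_cst 1)) (WD_pair Hvx A2)) _ _ => t t0.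
  by rewrite -trace0//; exact: H.
by rewrite -trace0//; exact: H'.
Qed.

End VectorTime.

(** * The energy estimate *)

Section EnergySystem.
Context {R : realType}.
Context (p : params R).
Implicit Types (t x : R).

(* Common form of the equations satisfied by the solution w, with s = w / 2 and
   q = w^2, and by its time difference quotients w_h, for which
   s = (w(t + h) + w(t)) / 2 and q = w(t + h)^2 + w(t + h) w(t) + w(t)^2. *)
Record energy_system (S : R) (u ux uxx ut utx z zx s sx q q' : R -> R -> R)
    (lam lam' : R -> R) : Prop := {
  es_u : forall t, 0 <= t -> H1 (u t) (ux t);
  es_uxx : forall t, 0 <= t -> weak_derivative (ux t) (uxx t);
  es_ut : forall t, 0 < t -> H1 (ut t) (utx t);
  es_zx : forall t, 0 <= t -> weak_derivative (z t) (zx t);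
  es_s : forall t, 0 <= t -> H1 (s t) (sx t);
  es_Du : exists L, WD L u ut;
  es_Dux : exists L, WD L ux utx;
  es_Dz : exists L, WD L z (fun t x => ux t x - delta p * z t x);
  es_Dzx : exists L, WD L zx (fun t x => uxx t x - delta p * zx t x);
  es_eq : forall t, 0 < t -> forall phi phix, H1 phi phix ->
    dot (ut t) phi + nu p * dot (ux t) phix + wd p * dot (ux t) phi
    + dot (fun x => sx t x * u t x + s t x * ux t x) phi
    + rho p * dot (z t) phix
    + bsum p (fun c i =>
        ((c + wd p) * u t i + 2 / (9 * c) * (q t i * u t i)) * phi i) = 0;
  es_q : forall t x, 0 <= t -> 0 <= x <= 1 -> 3 * s t x ^+ 2 <= q t x <= S;
  es_Dq0 : der0 (fun t => q t 0) (fun t => q' t 0);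
  es_Dq1 : der0 (fun t => q t 1) (fun t => q' t 1);
  es_q' : forall t x, 0 < t -> 0 <= x <= 1 -> `|q' t x| <= S;
  es_sx : forall t, 0 <= t -> dot (sx t) (sx t) <= S;
  es_Dlam : der0 lam lam';
  es_lam : forall t, 0 <= t -> 0 <= lam t <= S;
  es_lam' : forall t x, 0 < t -> 0 <= x <= 1 -> s t x ^+ 2 <= - lam' t }.

End EnergySystem.

(** [Phi] is a Lyapunov functional that does not contain uxx; the last clause recovers uxx at a
    fixed time from ut and the terms of [Phi]. *)
Definition energy_decay (R : realType) (alpha c C : R)
    (u ux uxx ut z zx : R -> R -> R) : Prop :=
  exists Phi dPhi : R -> R,
  [/\ 0 < c, der0 Phi dPhi,
   forall t, 0 <= t -> c * (expR (2 * alpha * t) *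
     (dot (u t) (u t) + dot (ux t) (ux t) + dot (z t) (z t) + dot (zx t) (zx t))) <= Phi t,
   forall t, 0 < t -> c * (expR (2 * alpha * t) *
     (dot (u t) (u t) + dot (ux t) (ux t) + dot (uxx t) (uxx t) + dot (z t) (z t)
      + dot (zx t) (zx t) + dot (ut t) (ut t))) <= - dPhi t &
   Phi 0 <= C *
     (dot (u 0) (u 0) + dot (ux 0) (ux 0) + dot (z 0) (z 0) + dot (zx 0) (zx 0))] /\
   forall t, 0 < t -> c * dot (uxx t) (uxx t) <=
     dot (ut t) (ut t) + dot (u t) (u t) + dot (ux t) (ux t) + dot (zx t) (zx t).

Section Energy.
Context {R : realType} (p : params R) (hp : admissible_params p) (alpha S : R).
Context (halpha0 : 0 <= alpha) (hbeta : 0 < beta p alpha).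
Context (u ux uxx ut utx z zx s sx q q' : R -> R -> R) (lam lam' : R -> R).
Context (ES : energy_system p S u ux uxx ut utx z zx s sx q q' lam lam').
Implicit Types (t x : R).

Let nu0 : 0 < nu p. Proof. by case: hp => -[]. Qed.
Let rho0 : 0 < rho p. Proof. by case: hp => -[]. Qed.
Let delta0 : 0 < delta p. Proof. by case: hp => -[]. Qed.
Let c00 : 0 < c0 p. Proof. by case: hp => _ []. Qed.
Let c10 : 0 < c1 p. Proof. by case: hp => _ []. Qed.
Let wd0 : 0 <= wd p. Proof. by case: hp => _ []. Qed.

Let u2 t : 0 <= t -> L2 (u t). Proof. by move=> /(es_u ES)/H1_L2. Qed.
Let ux2 t : 0 <= t -> L2 (ux t). Proof. by move=> /(es_u ES)/H1_dL2. Qed.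
Let uxx2 t : 0 <= t -> L2 (uxx t). Proof. by move=> /(es_uxx ES)[]. Qed.
Let ut2 t : 0 < t -> L2 (ut t). Proof. by move=> /(es_ut ES)/H1_L2. Qed.
Let zx2 t : 0 <= t -> L2 (zx t). Proof. by move=> /(es_zx ES)[]. Qed.
Let z2 t : 0 <= t -> L2 (z t).
Proof. by move=> t0; have [L H] := es_Dz ES; exact: WD_L2 H t0. Qed.
Let S0 : 0 <= S.
Proof. by have /andP[a b] := es_lam ES (lexx 0); exact: le_trans b. Qed.
Let o01 : 0 <= (1 : R) <= 1. Proof. by rewrite lexx ler01. Qed.
Let z01 : 0 <= (0 : R) <= 1. Proof. by rewrite lexx ler01. Qed.

Let F t x := sx t x * u t x + s t x * ux t x.

Let su2 t : 0 <= t -> L2 (fun x => s t x * ux t x).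
Proof. by move=> t0; apply: cont01_L2M (ux2 t0); case: (es_s ES t0). Qed.

Let sxu2 t : 0 <= t -> L2 (fun x => u t x * sx t x).
Proof. by move=> t0; apply: cont01_L2M (H1_dL2 (es_s ES t0)); case: (es_u ES t0). Qed.

Let F2 t : 0 <= t -> L2 (F t).
Proof.
move=> t0; rewrite (_ : F t = fun x => u t x * sx t x + s t x * ux t x).
  exact: L2D (sxu2 t0) (su2 t0).
by apply/funext => x; rewrite /F mulrC.
Qed.

(** The sup of u is measured by u(0) and ux, both of which are dissipated; s^2 <= S follows from 3
    s^2 <= q <= S. *)
Lemma energy_F_le t : 0 < t ->
  dot (F t) (F t) <= 4 * S * u t 0 ^+ 2 + 6 * S * dot (ux t) (ux t).
Proof.
move=> t0; have t0' := ltW t0; have Hs := es_s ES t0'; have Hu := es_u ES t0'.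
rewrite (_ : F t = fun x => u t x * sx t x + s t x * ux t x); last first.
  by apply/funext => x; rewrite /F mulrC.
apply: le_trans (L2normD_sqr (sxu2 t0') (su2 t0')) _.
pose m := 2 * u t 0 ^+ 2 + 2 * dot (ux t) (ux t).
have m0 : 0 <= m by rewrite addr_ge0// mulr_ge0 ?sqr_ge0 ?dot_ge0.
have sqle (a b : R) : 0 <= b -> a ^+ 2 <= b -> `|a| <= Num.sqrt b.
  by move=> b0 ab; rewrite -sqrtr_sqr ler_wsqrtr.
have A : dot (fun x => u t x * sx t x) (fun x => u t x * sx t x) <= m * S.
  apply: le_trans (@dot_bndM _ (Num.sqrt m) _ _ (cont01_measurable Hu.1) _ (H1_dL2 Hs)) _.
    by move=> x /I_sub x01; apply: sqle => //; exact: H1_sup.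
  by rewrite sqr_sqrtr// ler_wpM2l// (es_sx ES).
have B : dot (fun x => s t x * ux t x) (fun x => s t x * ux t x) <= S * dot (ux t) (ux t).
  apply: le_trans (@dot_bndM _ (Num.sqrt S) _ _ (cont01_measurable Hs.1) _ (ux2 t0')) _.
    move=> x /I_sub x01; apply: sqle => //.
    have /andP[a b] := es_q ES t0' x01; have := sqr_ge0 (s t x); lra.
  by rewrite sqr_sqrtr.
rewrite /m in A; lra.
Qed.

(** Test functions vanish at the endpoints, so the weak equation becomes an interior identity in L^2
    between nu uxx + rho zx and ut + wd ux + (s u)_x. *)
Lemma energy_flux t : 0 < t -> forall phi, L2 phi ->
  nu p * dot (uxx t) phi + rho p * dot (zx t) phi =
  dot (ut t) phi + wd p * dot (ux t) phi + dot (F t) phi.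
Proof.
move=> t0 phi phi2; have t0' := ltW t0.
pose G x := (nu p * uxx t x + rho p * zx t x) - (ut t x + wd p * ux t x + F t x).
have a2 := L2Z (nu p) (uxx2 t0'); have b2 := L2Z (rho p) (zx2 t0').
have d2 := L2Z (wd p) (ux2 t0'); have ab2 := L2D a2 b2; have ud2 := L2D (ut2 t0) d2.
have udf2 := L2D ud2 (F2 t0'); have G2 : L2 G := L2B ab2 udf2.
have GE psi : L2 psi -> dot G psi =
    nu p * dot (uxx t) psi + rho p * dot (zx t) psi
    - (dot (ut t) psi + wd p * dot (ux t) psi + dot (F t) psi).
  move=> psi2; rewrite (dotBl ab2 udf2 psi2) (dotDl a2 b2 psi2) (dotDl ud2 (F2 t0') psi2).
  rewrite (dotDl (ut2 t0) d2 psi2).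
  by rewrite (dotZl _ (uxx2 t0') psi2) (dotZl _ (zx2 t0') psi2) (dotZl _ (ux2 t0') psi2).
suff : dot G phi = 0 by rewrite GE// => /eqP; rewrite subr_eq0 => /eqP.
apply: dot_orth_test => // psi psit; have psi2 := test_function_L2 psit.
rewrite GE//; have [_ Hux] := es_uxx ES t0'; have [_ Hz] := es_zx ES t0'.
have Hpsi : H1 psi (derive1 psi).
  by apply: C1_H1 => [x|]; [exact: test_function_isd|case: psit].
have := es_eq ES t0 Hpsi; rewrite -/(F t) Hux// Hz//.
rewrite /bsum; have [-> ->] := test_function_bd psit; lra.
Qed.

Let beta_nu : beta p alpha <= nu p - 2 * alpha.
Proof. by rewrite /beta !ge_min lexx. Qed.
Let beta_delta : beta p alpha <= delta p - 2 * alpha.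
Proof. by rewrite /beta !ge_min lexx orbT. Qed.
Let beta_c0 : beta p alpha <= c0 p + wd p - 2 * alpha.
Proof. by rewrite /beta !ge_min lexx !orbT. Qed.
Let beta_c1 : beta p alpha <= c1 p + wd p - 2 * alpha.
Proof. by rewrite /beta !ge_min lexx !orbT. Qed.

(* The boundary cubic dominates the boundary flux of the convection term:
   c + (4 / (3 c)) s^2 >= 2 |s|. *)
Let boundary_le (c s' q0 y : R) : 0 < c -> 3 * s' ^+ 2 <= q0 -> 0 <= y ->
  2 * s' * y <= (c + 2 * (2 / (9 * c)) * q0) * y.
Proof.
move=> c0' sq y0; rewrite ler_wpM2r//.
have -> : 2 * (2 / (9 * c)) * q0 = c^-1 * ((4 / 9) * q0).
  by field; rewrite gt_eqF.
have ci0 : 0 < c^-1 by rewrite invr_gt0.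
have cc : c * c^-1 = 1 by rewrite mulfV// gt_eqF.
have : c^-1 * ((4 / 3) * s' ^+ 2) <= c^-1 * ((4 / 9) * q0) by rewrite ler_pM2l//; lra.
have E : c + c^-1 * (4 / 3 * s' ^+ 2) - 2 * s' = c^-1 * ((c - s') ^+ 2 + 3^-1 * s' ^+ 2).
  by field; rewrite gt_eqF.
have : 0 <= c^-1 * ((c - s') ^+ 2 + 3^-1 * s' ^+ 2).
  by rewrite mulr_ge0 ?(ltW ci0)// addr_ge0 ?sqr_ge0// mulr_ge0 ?sqr_ge0// invr_ge0.
rewrite -E; lra.
Qed.

Let X t := dot (ux t) (ux t) + u t 0 ^+ 2 + u t 1 ^+ 2.
Let Z t := dot (z t) (z t).

Let dz_z t : 0 <= t -> dot (fun x => ux t x - delta p * z t x) (z t) =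
  dot (z t) (ux t) - delta p * Z t.
Proof.
move=> t0; have dz2 := L2Z (delta p) (z2 t0).
by rewrite (dotBl (ux2 t0) dz2 (z2 t0)) (dotZl _ (z2 t0) (z2 t0)) (dotC (ux t)).
Qed.

(** The multiplier is u. The terms rho (z, ux) cancel between the two equations, and integration by
    parts turns (F, u) into a boundary flux minus (s u, ux). Young's inequality leaves (2 / nu) |s
    u|^2, bounded through -lam': the one term that the factor [L] has to remove. *)
Lemma energy_basic t : 0 < t ->
  2 * dot (ut t) (u t)
  + rho p * (2 * dot (fun x => ux t x - delta p * z t x) (z t))
  + 2 * alpha * (dot (u t) (u t) + rho p * Z t)
  <= - beta p alpha * (X t + rho p * Z t) + 2 / nu p * (- lam' t) * dot (u t) (u t).
Proof.
move=> t0; have t0' := ltW t0; have Hu := es_u ES t0'; have Hs := es_s ES t0'.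
have E := es_eq ES t0 Hu.
have ibp := integration_by_parts3 Hs Hu Hu.
have ibpu := integration_by_parts2 Hu Hu.
have Fu : dot (F t) (u t) = dot (sx t) (fun x => u t x * u t x)
    + dot (ux t) (fun x => s t x * u t x).
  transitivity (dot (fun x => u t x * sx t x) (u t) + dot (fun x => s t x * ux t x) (u t)).
    rewrite -(dotDl (sxu2 t0') (su2 t0') (u2 t0')).
    by apply: eq_dot => // x _; rewrite /F mulrC.
  by congr (_ + _); apply: eq_Rintegral => x _; ring.
have su2' := cont01_L2M Hs.1 (u2 t0').
have nu2 : 0 < nu p / 2 by rewrite divr_gt0.
have := dot_young nu2 (ux2 t0') su2'.
have lamx x : 0 <= x <= 1 -> s t x ^+ 2 <= - lam' t by exact: es_lam' ES _ _ t0.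
have lam0 : 0 <= - lam' t by apply: le_trans (lamx 0 z01); exact: sqr_ge0.
have suU : dot (fun x => s t x * u t x) (fun x => s t x * u t x)
    <= - lam' t * dot (u t) (u t).
  apply: le_trans (@dot_bndM _ (Num.sqrt (- lam' t)) _ _ (cont01_measurable Hs.1) _ (u2 t0')) _.
    by move=> x /I_sub x01; rewrite -sqrtr_sqr ler_wsqrtr// lamx.
  by rewrite sqr_sqrtr.
have poin := poincare Hu.
have /andP[q0s _] := es_q ES t0' z01; have /andP[q1s _] := es_q ES t0' o01.
have := boundary_le c00 q0s (sqr_ge0 (u t 0)).
(* The flux s u^2 has opposite signs at the two endpoints, so at 1 the boundary inequality is used
   for -s. *)
have q1s' : 3 * (- s t 1) ^+ 2 <= q t 1 by rewrite sqrrN.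
have := boundary_le c10 q1s' (sqr_ge0 (u t 1)).
rewrite dz_z// /X; move: E; rewrite -/(F t) Fu /bsum.
have -> : (nu p / 2)^-1 = 2 / nu p by field; rewrite gt_eqF.
have b1 : 2 / nu p * dot (fun x => s t x * u t x) (fun x => s t x * u t x)
   <= 2 / nu p * (- lam' t * dot (u t) (u t)) by rewrite ler_wpM2l// divr_ge0 ?ltW.
have b2 : 2 * alpha * dot (u t) (u t) <= 2 * alpha *
   (dot (ux t) (ux t) + u t 0 ^+ 2 + u t 1 ^+ 2) by rewrite ler_wpM2l// mulr_ge0.
have x0 := dot_ge0 (ux t); have z0 := dot_ge0 (z t); rewrite -/(Z t) in z0.
have a0 := sqr_ge0 (u t 0); have a1 := sqr_ge0 (u t 1).
have b3 : beta p alpha * dot (ux t) (ux t) <= (nu p - 2 * alpha) * dot (ux t) (ux t).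
  by rewrite ler_wpM2r.
have b4 : beta p alpha * u t 0 ^+ 2 <= (c0 p + wd p - 2 * alpha) * u t 0 ^+ 2.
  by rewrite ler_wpM2r.
have b5 : beta p alpha * u t 1 ^+ 2 <= (c1 p + wd p - 2 * alpha) * u t 1 ^+ 2.
  by rewrite ler_wpM2r.
have b6 : beta p alpha * (rho p * Z t) <= (delta p - 2 * alpha) * (rho p * Z t).
  by rewrite ler_wpM2r// mulr_ge0// ltW.
have b7 : 0 <= delta p * (rho p * Z t) by rewrite !mulr_ge0// ltW.
have b8 : 0 <= nu p * dot (ux t) (ux t) by rewrite mulr_ge0// ltW.
have b9 : 0 <= wd p * u t 0 ^+ 2 by rewrite mulr_ge0.
have b10 : 0 <= wd p * u t 1 ^+ 2 by rewrite mulr_ge0.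
have b11 := congr1 ( *%R (wd p)) ibpu.
move: ibp ibpu poin suU b1 b2 b3 b4 b5 b6 b7 b8 b9 b10 b11 {lamx q0s q1s q1s'}.
rewrite (dotC (z t)).
rewrite !expr2; set U := dot (u t) (u t); set Xx := dot (ux t) (ux t).
set D := dot (ux t) (fun x => s t x * u t x); set V := dot (sx t) _.
set T := dot (ut t) (u t); set Y := dot (ux t) (z t); set W := dot (ux t) (u t).
set ZZ := Z t; set SU := dot (fun x => s t x * u t x) _.
set k0 := 2 / (9 * c0 p); set k1 := 2 / (9 * c1 p); set kn := 2 / nu p.
rewrite /F => *.
lra.
Qed.

(** * Dissipation of u_t, u_xx and zeta_x *)

Let T t := dot (ut t) (ut t).
Let W t := dot (zx t) (zx t).

Let X_ge0 t : 0 <= X t.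
Proof. by rewrite /X !addr_ge0 ?sqr_ge0 ?dot_ge0. Qed.
Let Z_ge0 t : 0 <= Z t. Proof. exact: dot_ge0. Qed.
Let T_ge0 t : 0 <= T t. Proof. exact: dot_ge0. Qed.
Let W_ge0 t : 0 <= W t. Proof. exact: dot_ge0. Qed.
Let k0 := 2 / (9 * c0 p).
Let k1 := 2 / (9 * c1 p).
Let k00 : 0 < k0. Proof. by rewrite divr_gt0// mulr_gt0. Qed.
Let k10 : 0 < k1. Proof. by rewrite divr_gt0// mulr_gt0. Qed.

(** The multiplier u_t produces half of the derivative of this functional: rho (z, utx) is the
    derivative of rho (z, ux) minus rho (zt, ux), and the coefficient q costs a term in q'. *)
Let Psi t := nu p * dot (ux t) (ux t) + 2 * rho p * dot (z t) (ux t)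
  + ((c0 p + wd p) * u t 0 ^+ 2 + k0 * (q t 0 * u t 0 ^+ 2)
  + ((c1 p + wd p) * u t 1 ^+ 2 + k1 * (q t 1 * u t 1 ^+ 2))).
Let dPsi t := nu p * (2 * dot (ux t) (utx t))
  + 2 * rho p * (dot (ux t) (ux t) - delta p * dot (z t) (ux t) + dot (z t) (utx t))
  + ((c0 p + wd p) * (2 * (u t 0 * ut t 0))
     + k0 * (q' t 0 * u t 0 ^+ 2 + q t 0 * (2 * (u t 0 * ut t 0)))
  + ((c1 p + wd p) * (2 * (u t 1 * ut t 1))
     + k1 * (q' t 1 * u t 1 ^+ 2 + q t 1 * (2 * (u t 1 * ut t 1))))).

Let der_sqr (f df : R -> R) : der0 f df ->
  der0 (fun t => f t ^+ 2) (fun t => 2 * (f t * df t)).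
Proof.
by move=> H; apply: der0_eq (der0M H H) _ _ => t _; ring.
Qed.

Let der_u0 : der0 (fun t => u t 0) (fun t => ut t 0).
Proof.
have [L H] := es_Du ES; have [M Hx] := es_Dux ES.
exact: WD_trace0 H Hx (es_u ES) (es_ut ES).
Qed.

Let der_u1 : der0 (fun t => u t 1) (fun t => ut t 1).
Proof.
have [L H] := es_Du ES; have [M Hx] := es_Dux ES.
exact: WD_trace1 H Hx (es_u ES) (es_ut ES).
Qed.

Let der_Psi : der0 Psi dPsi.
Proof.
have [M Hx] := es_Dux ES; have [N Hz] := es_Dz ES.
have b0 := der0D (der0Z (c0 p + wd p) (der_sqr der_u0))
                 (der0Z k0 (der0M (es_Dq0 ES) (der_sqr der_u0))).
have b1 := der0D (der0Z (c1 p + wd p) (der_sqr der_u1))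
                 (der0Z k1 (der0M (es_Dq1 ES) (der_sqr der_u1))).
have := der0D (der0D (der0Z (nu p) (WD_dot Hx Hx)) (der0Z (2 * rho p) (WD_dot Hz Hx))) (der0D b0 b1).
move=> H; apply: der0_eq H _ _ => // t t0; have t0' := ltW t0; rewrite /dPsi.
have dz2 := L2Z (delta p) (z2 t0').
rewrite (dotBl (ux2 t0') dz2 (ux2 t0')) (dotZl _ (z2 t0') (ux2 t0')) (dotC (utx t)).
by congr (_ + _ + _); ring.
Qed.

(** 2 rho and rho delta come from (zt, ux), 2 wd^2 and 20 S from Young's inequality against ut, and
    (k0 + k1) S from q'. *)
Let C1 := 2 * rho p + 2 * wd p ^+ 2 + rho p * delta p + 20 * S + (k0 + k1) * S.

(** The equation tested with ut contributes -2 T and the pairings of ut with wd ux and with F, each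
    of which costs T / 2. *)
Let Psi_dissipation t : 0 < t -> dPsi t <= - T t + C1 * (X t + Z t).
Proof.
move=> t0; have t0' := ltW t0; have Hut := es_ut ES t0.
have E := es_eq ES t0 Hut; rewrite -/(F t) in E.
have F2t := F2 t0'; have FF := energy_F_le t0.
have half0 : 0 < 2^-1 :> R by rewrite invr_gt0.
have y1 := dot_young_abs half0 (ut2 t0) F2t.
have wux2 := L2Z (wd p) (ux2 t0').
have := dot_young_abs half0 (ut2 t0) wux2.
rewrite (dotZl _ (ux2 t0') wux2) !(dotZr _ (ux2 t0')) ?invrK; [|exact: ux2 t0'|exact: ut2 t0].
move=> y2.
have y3 := dot_young_abs ltr01 (z2 t0') (ux2 t0').
have q0S := es_q' ES t0 z01; have q1S := es_q' ES t0 o01.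
have a0 := sqr_ge0 (u t 0); have a1 := sqr_ge0 (u t 1).
have b0 : k0 * (q' t 0 * u t 0 ^+ 2) <= k0 * (S * u t 0 ^+ 2).
  by rewrite ler_pM2l// ler_wpM2r// (le_trans (ler_norm _)).
have b1 : k1 * (q' t 1 * u t 1 ^+ 2) <= k1 * (S * u t 1 ^+ 2).
  by rewrite ler_pM2l// ler_wpM2r// (le_trans (ler_norm _)).
have x0 := dot_ge0 (ux t); have zz0 := Z_ge0 t.
have p1 : 0 <= S * Z t by rewrite mulr_ge0.
have p2 : 0 <= S * u t 0 ^+ 2 by rewrite mulr_ge0.
have p3 : 0 <= S * u t 1 ^+ 2 by rewrite mulr_ge0.
have p4 : 0 <= S * dot (ux t) (ux t) by rewrite mulr_ge0.
have kS0 : 0 <= k0 * S by rewrite mulr_ge0// ltW.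
have kS1 : 0 <= k1 * S by rewrite mulr_ge0// ltW.
have rd : 0 <= rho p * delta p by rewrite mulr_ge0// ltW.
have w0 : 0 <= wd p ^+ 2 by exact: sqr_ge0.
have r0 := ltW rho0.
have rdY : - (2 * rho p * delta p * dot (z t) (ux t)) <= rho p * delta p * (Z t + dot (ux t) (ux t)).
  have yn : 2 * - dot (z t) (ux t) <= Z t + dot (ux t) (ux t).
    have := ler_norm (- dot (z t) (ux t)); rewrite normrN.
    by move: y3; rewrite invr1 !mul1r -/(Z t); lra.
  by have := ler_wpM2l rd yn; lra.
have kn : 0 <= k0 + k1 by rewrite addr_ge0// ltW.
have Q0 : 0 <= (2 * rho p + 2 * wd p ^+ 2 + 20 * S + (k0 + k1) * S) * Z t.
  by rewrite mulr_ge0// !addr_ge0// mulr_ge0.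
have m1 a : 0 <= a -> 0 <= rho p * a by exact: mulr_ge0.
have m2 a : 0 <= a -> 0 <= wd p ^+ 2 * a by exact: mulr_ge0.
have m3 a : 0 <= a -> 0 <= rho p * delta p * a by exact: mulr_ge0.
have m4 a : 0 <= a -> 0 <= k0 * S * a by exact: mulr_ge0.
have m5 a : 0 <= a -> 0 <= k1 * S * a by exact: mulr_ge0.
have n10 := m1 _ a0; have n11 := m1 _ a1.
have n20 := m2 _ a0; have n21 := m2 _ a1.
have n30 := m3 _ a0; have n31 := m3 _ a1.
have n40 := m4 _ a0; have n41 := m4 _ a1; have n42 := m4 _ x0.
have n50 := m5 _ a0; have n51 := m5 _ a1; have n52 := m5 _ x0.
move: y1 y2; rewrite invrK.
have := ler_norm (- dot (ut t) (F t)); rewrite normrN.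
have := ler_norm (- (wd p * dot (ut t) (ux t))); rewrite normrN.
move=> g1 g2 y1 y2.
move: E FF b0 b1 rdY Q0 {y3 m1 m2 m3 m4 m5 q0S q1S}.
rewrite /dPsi /C1 /X /bsum -/k0 -/k1 (dotC (F t)) (dotC (ux t) (ut t)) !expr2 -/(T t).
rewrite !expr2 in n10 n11 n20 n21 n30 n31 n40 n41 n50 n51 a0 a1 p2 p3 w0 n42 n52 y1 y2 *.
move=> E FF b0 b1 rdY Q0.
rewrite -/(T t) in y1 y2.
lra.
Qed.

Let q_ge0 t x : 0 <= t -> 0 <= x <= 1 -> 0 <= q t x.
Proof.
move=> t0 x01; have /andP[a _] := es_q ES t0 x01.
by apply: le_trans a; rewrite mulr_ge0// sqr_ge0.
Qed.

Let q_le t x : 0 <= t -> 0 <= x <= 1 -> q t x <= S.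
Proof. by move=> t0 x01; have /andP[] := es_q ES t0 x01. Qed.

Let C0 := nu p + rho p + (c0 p + wd p) + (c1 p + wd p) + (k0 + k1) * S.

Let C0_gt0 : 0 < C0.
Proof.
rewrite /C0 ltr_wpDr ?mulr_ge0 ?addr_ge0 ?(ltW k00) ?(ltW k10)//.
have := nu0; have := rho0; have := c00; have := c10; have := wd0; lra.
Qed.

Let Psi_upper t : 0 <= t -> Psi t <= C0 * (X t + Z t).
Proof.
move=> t0; have := dot_young ltr01 (z2 t0) (ux2 t0); rewrite invr1 !mul1r -/(Z t) => y1.
have x0 := dot_ge0 (ux t); have zz0 := Z_ge0 t.
have a0 := sqr_ge0 (u t 0); have a1 := sqr_ge0 (u t 1).
rewrite /Psi /X /C0.
set x := dot (ux t) (ux t) in x0 y1 *; set Y := dot (z t) (ux t) in y1 *.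
set zz := Z t in zz0 y1 *; set a := u t 0 ^+ 2 in a0 *; set b := u t 1 ^+ 2 in a1 *.
have kS : 0 <= (k0 + k1) * S by rewrite mulr_ge0// addr_ge0// ltW.
have e1 : 2 * rho p * Y <= rho p * (x + zz).
  by rewrite (mulrC 2) -mulrA ler_pM2l// addrC.
have e2 : k0 * (q t 0 * a) <= (k0 + k1) * S * a.
  by rewrite mulrA ler_wpM2r// ler_pM ?(ltW k00) ?q_ge0 ?q_le// lerDl ltW.
have e3 : k1 * (q t 1 * b) <= (k0 + k1) * S * b.
  by rewrite mulrA ler_wpM2r// ler_pM ?(ltW k10) ?q_ge0 ?q_le// lerDr ltW.
have e4 (c y : R) : 0 <= c -> 0 <= y -> 0 <= c * y := @mulr_ge0 _ c y.
have cw0 : 0 <= c0 p + wd p by rewrite addr_ge0// ltW.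
have cw1 : 0 <= c1 p + wd p by rewrite addr_ge0// ltW.
have tot : 0 <= a + b by rewrite addr_ge0.
have totx : 0 <= x + b + zz by rewrite !addr_ge0.
have toty : 0 <= x + a + zz by rewrite !addr_ge0.
have f1 := e4 _ _ (ltW nu0) (addr_ge0 tot zz0).
have f2 := e4 _ _ (ltW rho0) tot.
have f3 := e4 _ _ cw0 totx; have f4 := e4 _ _ cw1 toty.
have f5 := e4 _ _ kS (addr_ge0 x0 zz0).
set kk := (k0 + k1) * S in e2 e3 f5 *; set cc0 := c0 p + wd p in f3 *; set cc1 := c1 p + wd p in f4 *.
set m0 := k0 * _ in e2 *; set m1 := k1 * _ in e3 *.
by lra.
Qed.

(** Half of nu |ux|^2 absorbs the cross term; the deficit in |z|^2 is made up by the L^2 energy,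
    which carries the factor A in [Phi]. *)
Let Psi_lower t : 0 <= t ->
  nu p / 2 * dot (ux t) (ux t) - 2 * rho p ^+ 2 / nu p * Z t <= Psi t.
Proof.
move=> t0; have e0 : 0 < nu p / (2 * rho p) by rewrite divr_gt0// mulr_gt0.
have := dot_young_abs e0 (ux2 t0) (z2 t0); rewrite -/(Z t) (dotC (ux t)).
have := ler_norm (- dot (z t) (ux t)); rewrite normrN => y0 y1'.
have y1 : 2 * - dot (z t) (ux t) <= nu p / (2 * rho p) * dot (ux t) (ux t)
   + (nu p / (2 * rho p))^-1 * Z t by apply: le_trans y1'; rewrite ler_pM2l.
have y2 : - (2 * rho p * dot (z t) (ux t)) <=
    nu p / 2 * dot (ux t) (ux t) + 2 * rho p ^+ 2 / nu p * Z t.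
  have := ler_wpM2l (ltW rho0) y1.
  have -> : rho p * (nu p / (2 * rho p) * dot (ux t) (ux t) + (nu p / (2 * rho p))^-1 * Z t)
     = nu p / 2 * dot (ux t) (ux t) + 2 * rho p ^+ 2 / nu p * Z t.
    by field; rewrite !gt_eqF.
  lra.
rewrite /Psi; have cw0 : 0 <= (c0 p + wd p) * u t 0 ^+ 2.
  by rewrite mulr_ge0 ?sqr_ge0// addr_ge0// ltW.
have cw1 : 0 <= (c1 p + wd p) * u t 1 ^+ 2.
  by rewrite mulr_ge0 ?sqr_ge0// addr_ge0// ltW.
have m0 : 0 <= k0 * (q t 0 * u t 0 ^+ 2).
  exact: mulr_ge0 (ltW k00) (mulr_ge0 (q_ge0 t0 z01) (sqr_ge0 _)).
have m1 : 0 <= k1 * (q t 1 * u t 1 ^+ 2).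
  exact: mulr_ge0 (ltW k10) (mulr_ge0 (q_ge0 t0 o01) (sqr_ge0 _)).
lra.
Qed.

Let G t x := ut t x + (wd p * ux t x + F t x).
Let C2 := 4 * wd p ^+ 2 + 40 * S.

Let G2 t : 0 < t -> L2 (G t).
Proof.
move=> t0; have t0' := ltW t0; apply: L2D (ut2 t0) _.
exact: L2D (L2Z _ (ux2 t0')) (F2 t0').
Qed.

Let G_le t : 0 < t -> dot (G t) (G t) <= 2 * T t + C2 * X t.
Proof.
move=> t0; have t0' := ltW t0; have wu2 := L2Z (wd p) (ux2 t0'); have Ft2 := F2 t0'.
have := L2normD_sqr (ut2 t0) (L2D wu2 Ft2); have := L2normD_sqr wu2 Ft2.
rewrite (dotZl _ (ux2 t0') wu2) (dotZr _ (ux2 t0') (ux2 t0')).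
have := energy_F_le t0; rewrite -/(G t) -/(T t) /C2 /X.
have x0 := dot_ge0 (ux t); have a0 := sqr_ge0 (u t 0); have a1 := sqr_ge0 (u t 1).
set FF := dot (F t) (F t); set x := dot (ux t) (ux t) in x0 *.
set a := u t 0 ^+ 2 in a0 *; set b := u t 1 ^+ 2 in a1 *; set gg := dot (G t) (G t).
set hh := dot (fun _ => _ + _) _.
have e1 := mulr_ge0 S0 x0; have e2 := mulr_ge0 S0 a0; have e3 := mulr_ge0 S0 a1.
have w0 := sqr_ge0 (wd p); have e4 := mulr_ge0 w0 a0; have e5 := mulr_ge0 w0 a1.
by lra.
Qed.

Let G_flux t phi : 0 < t -> L2 phi ->
  nu p * dot (uxx t) phi + rho p * dot (zx t) phi = dot (G t) phi.
Proof.
move=> t0 phi2; have t0' := ltW t0; rewrite energy_flux//.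
have wu2 := L2Z (wd p) (ux2 t0').
rewrite (dotDl (ut2 t0) (L2D wu2 (F2 t0')) phi2) (dotDl wu2 (F2 t0') phi2).
by rewrite (dotZl _ (ux2 t0') phi2) addrA.
Qed.

(** Substituting nu uxx = G - rho zx makes (uxx, zx) dissipative, and Young's inequality with weight
    2 rho spends exactly this gain. Of the damping 2 delta, one delta pays for 2 alpha. *)
Let zx_dissipation t : 0 < t ->
  2 * (dot (uxx t) (zx t) - delta p * W t) + 2 * alpha * W t
  <= - delta p * W t + (2 * nu p * rho p)^-1 * (2 * T t + C2 * X t).
Proof.
move=> t0; have t0' := ltW t0; have E := G_flux t0 (zx2 t0').
have r2 : 0 < 2 * rho p by rewrite mulr_gt0.
have := dot_young r2 (zx2 t0') (G2 t0); rewrite (dotC (zx t)) -E -/(W t) => y1.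
have y2 : 2 * dot (uxx t) (zx t) <= (2 * nu p * rho p)^-1 * dot (G t) (G t).
  have ni : 0 <= (nu p)^-1 by rewrite invr_ge0 ltW.
  have := ler_wpM2l ni y1.
  have -> : (nu p)^-1 * (2 * (nu p * dot (uxx t) (zx t) + rho p * W t)) =
     2 * dot (uxx t) (zx t) + (nu p)^-1 * (2 * rho p * W t) by field; rewrite gt_eqF.
  have -> : (nu p)^-1 * (2 * rho p * W t + (2 * rho p)^-1 * dot (G t) (G t)) =
     (2 * nu p * rho p)^-1 * dot (G t) (G t) + (nu p)^-1 * (2 * rho p * W t).
    by field; rewrite !gt_eqF.
  by rewrite lerD2r.
have y3 : (2 * nu p * rho p)^-1 * dot (G t) (G t) <= (2 * nu p * rho p)^-1 * (2 * T t + C2 * X t).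
  by rewrite ler_wpM2l ?G_le// invr_ge0 !mulr_ge0// ltW.
have w0 := W_ge0 t; have : 2 * alpha * W t <= delta p * W t.
  by rewrite ler_wpM2r//; have := hbeta; have := beta_delta; lra.
lra.
Qed.

Let E t := expR (2 * alpha * t).
Let L t := expR (2 / nu p * lam t).
Let e t := dot (u t) (u t) + rho p * Z t.

Let der_E : der0 E (fun t => 2 * alpha * E t).
Proof.
have := der0_expR (der0Z (2 * alpha) (@der0_id R)).
by move=> H; apply: der0_eq H _ _ => // t _; rewrite mulr1.
Qed.

Let der_L : der0 L (fun t => 2 / nu p * lam' t * L t).
Proof. exact: der0_expR (der0Z (2 / nu p) (es_Dlam ES)). Qed.

Let der_e : der0 e (fun t => 2 * dot (ut t) (u t)
  + rho p * (2 * dot (fun x => ux t x - delta p * z t x) (z t))).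
Proof.
have [M Hu] := es_Du ES; have [N Hz] := es_Dz ES.
have := der0D (WD_dot Hu Hu) (der0Z (rho p) (WD_dot Hz Hz)).
move=> H; apply: der0_eq H _ _ => // t t0.
by rewrite (dotC (u t)) (dotC (z t)); ring.
Qed.

Let der_W : der0 W (fun t => 2 * (dot (uxx t) (zx t) - delta p * W t)).
Proof.
have [M Hz] := es_Dzx ES; have H := WD_dot Hz Hz.
apply: der0_eq H _ _ => // t t0; have t0' := ltW t0.
have dz2 := L2Z (delta p) (zx2 t0').
rewrite (dotC (zx t)) (dotBl (uxx2 t0') dz2 (zx2 t0')) (dotZl _ (zx2 t0') (zx2 t0')).
by rewrite /W; ring.
Qed.

(** With this value, eps times the multiple of T in [zx_dissipation] is T / 2, half of what [Psi]
    dissipates. *)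
Let eps := nu p * rho p / 2.
Let eps0 : 0 < eps. Proof. by rewrite divr_gt0// mulr_gt0. Qed.
(** The coefficients of X + Z collected from [dPsi], from the weight exp(2 alpha t) on [Psi], and
    from eps times the bound on |G|^2. *)
Let C3 := C1 + 2 * alpha * C0 + C2 / 4.
(** The first summand makes the L^2 dissipation exceed C3 + 1 both in X and in Z; 2 rho / nu + 1 /
    rho offsets the deficit of [Psi_lower] with one unit to spare; the last 1 gives A >= 1. *)
Let A := (C3 + 1) * (1 + (rho p)^-1) / beta p alpha + 2 * rho p / nu p + (rho p)^-1 + 1.

Let C2_ge0 : 0 <= C2.
Proof. by rewrite /C2 addr_ge0 ?mulr_ge0 ?sqr_ge0. Qed.

Let C3_ge0 : 0 <= C3.
Proof.
have k := addr_ge0 (ltW k00) (ltW k10).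
rewrite /C3 /C1 !addr_ge0 ?mulr_ge0 ?sqr_ge0 ?(ltW C0_gt0)//; exact: ltW.
Qed.

Let A_bounds : [/\ C3 + 1 <= A * beta p alpha, C3 + 1 <= A * beta p alpha * rho p,
  2 * rho p ^+ 2 / nu p + 1 <= A * rho p & 1 <= A].
Proof.
have b0 := hbeta; have ri : 0 < (rho p)^-1 by rewrite invr_gt0.
have m1 : 0 <= (C3 + 1) * (1 + (rho p)^-1).
  by rewrite mulr_ge0// addr_ge0// ltW.
have m2 : 0 <= 2 * rho p / nu p by rewrite divr_ge0 ?mulr_ge0// ltW.
have m3 := divr_ge0 m1 (ltW b0).
have m4 : 0 <= (2 * rho p / nu p + (rho p)^-1 + 1) * beta p alpha.
  by rewrite mulr_ge0 ?(ltW b0)// !addr_ge0// ltW.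
have rr : (rho p)^-1 * rho p = 1 by rewrite mulVf// gt_eqF.
have Ab : A * beta p alpha = (C3 + 1) * (1 + (rho p)^-1)
    + (2 * rho p / nu p + (rho p)^-1 + 1) * beta p alpha.
  by rewrite /A; field; rewrite !gt_eqF.
have C31 : 0 <= C3 + 1 := addr_ge0 C3_ge0 ler01.
have c3 : 0 <= (C3 + 1) * (rho p)^-1 := mulr_ge0 C31 (ltW ri).
split.
- by rewrite Ab; lra.
- rewrite Ab mulrDl; have -> : (C3 + 1) * (1 + (rho p)^-1) * rho p = (C3 + 1) * rho p + (C3 + 1).
    by field; rewrite gt_eqF.
  have := mulr_ge0 m4 (ltW rho0); have : 0 <= (C3 + 1) * rho p := mulr_ge0 C31 (ltW rho0).
  lra.
- have -> : A * rho p = (C3 + 1) * (1 + (rho p)^-1) / beta p alpha * rho p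
     + 2 * rho p ^+ 2 / nu p + 1 + rho p by rewrite /A; field; rewrite !gt_eqF.
  have := mulr_ge0 m3 (ltW rho0); have := rho0; lra.
- by rewrite /A; have := ri; lra.
Qed.

Let Phi t := A * (E t * (L t * e t)) + E t * (Psi t + eps * W t).
Let dPhi t := A * (2 * alpha * E t * (L t * e t)
    + E t * (2 / nu p * lam' t * L t * e t + L t * (2 * dot (ut t) (u t)
  + rho p * (2 * dot (fun x => ux t x - delta p * z t x) (z t)))))
  + (2 * alpha * E t * (Psi t + eps * W t)
    + E t * (dPsi t + eps * (2 * (dot (uxx t) (zx t) - delta p * W t)))).

Let der_Phi : der0 Phi dPhi.
Proof.
exact: der0D (der0Z A (der0M der_E (der0M der_L der_e)))
  (der0M der_E (der0D der_Psi (der0Z eps der_W))).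
Qed.

Let L_ge1 t : 0 <= t -> 1 <= L t.
Proof.
move=> t0; have /andP[l0 _] := es_lam ES t0.
by rewrite -expR0 ler_expR mulr_ge0// divr_ge0// ltW.
Qed.

Let dPhi_le t : 0 < t ->
  dPhi t <= - E t * (2^-1 * T t + X t + Z t + eps * delta p * W t).
Proof.
move=> t0; have t0' := ltW t0; have E0 : 0 < E t := expR_gt0 _.
have L1 := L_ge1 t0'; have [A1 A2 A3 A4] := A_bounds.
have x0 := X_ge0 t; have zz0 := Z_ge0 t; have w0 := W_ge0 t; have b0 := hbeta.
have bb := energy_basic t0; have pp := Psi_dissipation t0.
have pu := Psi_upper t0'; have zd := zx_dissipation t0.
have lam0 : lam' t <= 0.
  have := es_lam' ES t0 z01; have := sqr_ge0 (s t 0); lra.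
set de := 2 * dot (ut t) (u t) + _ in bb.
(* The derivative of [L] cancels the term in -lam' |u|^2 of [energy_basic]; what it adds for z has
   the good sign because lam' <= 0. *)
have first : 2 * alpha * e t + 2 / nu p * lam' t * e t + de <=
    - (beta p alpha * (X t + rho p * Z t)).
  have : 2 / nu p * lam' t * (rho p * Z t) <= 0.
    by rewrite mulr_le0_ge0 ?mulr_ge0 ?(ltW rho0)// mulr_ge0_le0// divr_ge0// ltW.
  by move: bb; rewrite /e; lra.
have XZ0 : 0 <= beta p alpha * (X t + rho p * Z t).
  by rewrite mulr_ge0 ?(ltW b0)// addr_ge0// mulr_ge0// ltW.
have second : L t * (2 * alpha * e t + 2 / nu p * lam' t * e t + de) <=
    - (beta p alpha * (X t + rho p * Z t)).
  apply: le_trans (ler_wpM2l (le_trans ler01 L1) first) _.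
  by rewrite mulrN lerN2 ler_peMl.
have third : A * (L t * (2 * alpha * e t + 2 / nu p * lam' t * e t + de)) <=
    - ((C3 + 1) * (X t + Z t)).
  apply: le_trans (ler_wpM2l (le_trans ler01 A4) second) _.
  rewrite mulrN lerN2; have := ler_wpM2r x0 A1; have := ler_wpM2r zz0 A2; lra.
have fourth : 2 * alpha * (Psi t + eps * W t) +
    (dPsi t + eps * (2 * (dot (uxx t) (zx t) - delta p * W t))) <=
    C3 * (X t + Z t) - 2^-1 * T t - eps * delta p * W t.
  have := ler_wpM2l (ltW eps0) zd; rewrite mulrDr [leRHS]mulrDr.
  have -> : eps * ((2 * nu p * rho p)^-1 * (2 * T t + C2 * X t)) = 2^-1 * T t + C2 / 4 * X t.
    by rewrite /eps; field; rewrite !gt_eqF.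
  have aa : 0 <= 2 * alpha by rewrite mulr_ge0.
  have := ler_wpM2l aa pu; have : 0 <= C2 / 4 * Z t by rewrite mulr_ge0// divr_ge0.
  rewrite /C3; lra.
have -> : dPhi t = E t * (A * (L t * (2 * alpha * e t + 2 / nu p * lam' t * e t + de))
    + (2 * alpha * (Psi t + eps * W t) +
    (dPsi t + eps * (2 * (dot (uxx t) (zx t) - delta p * W t))))).
  by rewrite /dPhi -/de; ring.
by rewrite mulNr -mulrN ler_pM2l//; lra.
Qed.

Let CV := 2 / nu p ^+ 2 * (rho p ^+ 2 + 2 + C2).

Let CV_ge0 : 0 <= CV.
Proof.
have c2 := C2_ge0; have r2 := sqr_ge0 (rho p).
by apply: mulr_ge0; [rewrite divr_ge0 ?sqr_ge0|apply: addr_ge0 => //; apply: addr_ge0].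
Qed.

Let uxx_le t : 0 < t -> dot (uxx t) (uxx t) <= CV * (T t + X t + W t).
Proof.
move=> t0; have t0' := ltW t0; have v2 := uxx2 t0'; have zxt2 := zx2 t0'.
have H := G_flux t0 v2; have n4 : 0 < nu p / 2 by rewrite divr_gt0.
have := dot_young n4 v2 (G2 t0); have n5 : 0 < nu p / (2 * rho p) by rewrite divr_gt0// mulr_gt0.
have := dot_young_abs n5 v2 zxt2; rewrite (dotC (uxx t) (zx t)) -/(W t) (dotC (uxx t) (G t)) -H.
have := ler_norm (- dot (zx t) (uxx t)); rewrite normrN.
set V := dot (uxx t) (uxx t); set Y := dot (zx t) (uxx t) => h1 h2 h3.
have gl := G_le t0; set gg := dot (G t) (G t) in h3 gl.
have h4 : - (2 * rho p * Y) <= nu p / 2 * V + 2 * rho p ^+ 2 / nu p * W t.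
  have h5 : 2 * - Y <= nu p / (2 * rho p) * V + (nu p / (2 * rho p))^-1 * W t.
    by apply: le_trans h2; rewrite ler_pM2l.
  have := ler_wpM2l (ltW rho0) h5.
  have -> : rho p * (nu p / (2 * rho p) * V + (nu p / (2 * rho p))^-1 * W t)
     = nu p / 2 * V + 2 * rho p ^+ 2 / nu p * W t by field; rewrite !gt_eqF.
  lra.
have h6 : nu p * V <= 2 * rho p ^+ 2 / nu p * W t + 2 / nu p * gg.
  move: h3; have -> : (nu p / 2)^-1 = 2 / nu p by field; rewrite gt_eqF.
  rewrite mulrDr; lra.
have h7 : nu p * V <= 2 * rho p ^+ 2 / nu p * W t + 2 / nu p * (2 * T t + C2 * X t).
  apply: le_trans h6 _; rewrite lerD2l ler_wpM2l// divr_ge0// ltW//.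
have x0 := X_ge0 t; have w0 := W_ge0 t; have tt0 := T_ge0 t.
rewrite -(ler_pM2l nu0); apply: le_trans h7 _.
have -> : nu p * (CV * (T t + X t + W t)) =
   2 / nu p * ((rho p ^+ 2 + 2 + C2) * (T t + X t + W t)) by rewrite /CV; field; rewrite gt_eqF.
have -> : 2 * rho p ^+ 2 / nu p * W t + 2 / nu p * (2 * T t + C2 * X t) =
   2 / nu p * (rho p ^+ 2 * W t + 2 * T t + C2 * X t) by ring.
rewrite ler_wpM2l ?divr_ge0 ?(ltW nu0)//.
have m1 := mulr_ge0 C2_ge0 tt0; have m2 := mulr_ge0 C2_ge0 w0.
have r2 := sqr_ge0 (rho p); have m3 := mulr_ge0 r2 tt0; have m4 := mulr_ge0 r2 x0.
lra.
Qed.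

Let X_le t : 0 <= t -> X t <= 5 * (dot (u t) (u t) + dot (ux t) (ux t)).
Proof.
move=> t0; have Hu := es_u ES t0; rewrite /X.
by have := trace0_le Hu; have := trace1_le Hu; have := dot_ge0 (u t); lra.
Qed.

Let U_le t : 0 <= t -> dot (u t) (u t) <= X t.
Proof. by move=> t0; exact: poincare (es_u ES t0). Qed.

Let ux_le t : dot (ux t) (ux t) <= X t.
Proof. by rewrite /X -addrA lerDl addr_ge0 ?sqr_ge0. Qed.

Let min3_le (a b d : R) : [/\ Num.min (Num.min a b) d <= a,
  Num.min (Num.min a b) d <= b & Num.min (Num.min a b) d <= d].
Proof. by rewrite !ge_min !lexx !orbT. Qed.

Let cd := Num.min 2^-1 (eps * delta p) / (2 + CV).
Let cp := Num.min (Num.min 1 (nu p / 2)) eps.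
(** [cd] serves the dissipation, [cp] the coercivity of [Phi], and the last entry the recovery of
    uxx. *)
Let c := Num.min (Num.min cd cp) (5 * (CV + 1))^-1.
Let C := A * expR (2 / nu p * S) * (1 + rho p) + 5 * C0 + eps.

Lemma energy_estimate_constants : energy_decay alpha c C u ux uxx ut z zx.
Proof.
have cv2 : 0 < 2 + CV by rewrite ltr_wpDr.
have cv5 : 0 < 5 * (CV + 1) by rewrite mulr_gt0// ltr_wpDl.
have n2 : 0 < nu p / 2 by rewrite divr_gt0.
have ed : 0 < eps * delta p by rewrite mulr_gt0.
have half0 : 0 < 2^-1 :> R by rewrite invr_gt0.
have cd0 : 0 < cd by rewrite divr_gt0// lt_min half0.
have cp0 : 0 < cp by rewrite !lt_min ltr01 n2.
have c0' : 0 < c.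
  by rewrite /c lt_min; apply/andP; split; rewrite ?invr_gt0// lt_min cd0.
have [c_cd c_cp c_v] : [/\ c <= cd, c <= cp & c <= (5 * (CV + 1))^-1] := min3_le _ _ _.
have [A1 A2 A3 A4] := A_bounds.
exists Phi, dPhi; split; first split => //.
- move=> t t0; rewrite -/(E t) -/(Z t) -/(W t).
  have E0 : 0 < E t := expR_gt0 _; have w0 := W_ge0 t; have zz0 := Z_ge0 t.
  have U0 := dot_ge0 (u t); have X0 := dot_ge0 (ux t).
  have L1 := L_ge1 t0; have pl := Psi_lower t0.
  have -> : Phi t = E t * (A * (L t * e t) + (Psi t + eps * W t)) by rewrite /Phi; ring.
  rewrite mulrCA ler_pM2l//.
  have e0 : 0 <= e t by rewrite /e addr_ge0// mulr_ge0// ltW.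
  have Le : A * e t <= A * (L t * e t).
    by rewrite ler_wpM2l ?(le_trans ler01 A4)// ler_peMl.
  have [cp1 cp2 cp3] : [/\ cp <= 1, cp <= nu p / 2 & cp <= eps] := min3_le _ _ _.
  have f1 : c * dot (u t) (u t) <= A * dot (u t) (u t).
    by rewrite ler_wpM2r//; lra.
  have f2 : c * dot (ux t) (ux t) <= nu p / 2 * dot (ux t) (ux t).
    by rewrite ler_wpM2r//; lra.
  have f3 : c * Z t <= (A * rho p - 2 * rho p ^+ 2 / nu p) * Z t.
    by rewrite ler_wpM2r//; lra.
  have f4 : c * W t <= eps * W t by rewrite ler_wpM2r//; lra.
  move: Le; rewrite /e; lra.
- move=> t t0; rewrite -/(E t) -/(Z t) -/(W t) -/(T t).
  have t0' := ltW t0; have E0 : 0 < E t := expR_gt0 _; have w0 := W_ge0 t; have zz0 := Z_ge0 t.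
  have tt0 := T_ge0 t; have x0 := X_ge0 t.
  have dl := dPhi_le t0; rewrite mulNr in dl.
  rewrite lerNr; apply: le_trans dl _; rewrite lerN2.
  rewrite mulrCA ler_pM2l//.
  have m0 : 0 <= CV * Z t by rewrite mulr_ge0.
  have tot : dot (u t) (u t) + dot (ux t) (ux t) + dot (uxx t) (uxx t) + Z t + W t + T t
      <= (2 + CV) * (T t + X t + Z t + W t).
    have := U_le t0'; have := ux_le t; have := uxx_le t0; lra.
  apply: le_trans (ler_wpM2l (ltW c0') tot) _.
  have S0' : 0 <= T t + X t + Z t + W t := addr_ge0 (addr_ge0 (addr_ge0 tt0 x0) zz0) w0.
  have : c * (2 + CV) <= Num.min 2^-1 (eps * delta p).
    by rewrite -ler_pdivlMr.
  move=> cm; rewrite mulrA; apply: le_trans (ler_wpM2r S0' cm) _.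
  have mn1 : Num.min 2^-1 (eps * delta p) <= 2^-1 by rewrite ge_min lexx.
  have mn2 : Num.min 2^-1 (eps * delta p) <= eps * delta p by rewrite ge_min lexx orbT.
  set mm := Num.min _ _ in mn1 mn2 *.
  have := ler_wpM2r tt0 mn1; have := ler_wpM2r w0 mn2; have := ler_wpM2r x0 mn1.
  have := ler_wpM2r zz0 mn1; lra.
- have zr := lexx (0 : R); rewrite -/(Z 0) -/(W 0) /Phi /E mulr0 expR0 !mul1r.
  have U0 := dot_ge0 (u 0); have X0 := dot_ge0 (ux 0); have Z0 := Z_ge0 0; have W0 := W_ge0 0.
  have pu := Psi_upper zr; have xl := X_le zr.
  have L0 : L 0 <= expR (2 / nu p * S).
    rewrite ler_expR ler_wpM2l ?divr_ge0 ?(ltW nu0)//.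
    by have /andP[] := es_lam ES zr.
  have e0 : 0 <= e 0 by rewrite /e addr_ge0// mulr_ge0// ltW.
  have A0 : 0 <= A by exact: le_trans A4.
  have g0 := expR_gt0 (2 / nu p * S).
  have g1 : A * (L 0 * e 0) <= A * expR (2 / nu p * S) * e 0.
    by rewrite -mulrA ler_wpM2l// ler_wpM2r.
  set ee := expR (2 / nu p * S) in L0 g0 g1 *.
  have Ae0 : 0 <= A * ee by rewrite mulr_ge0// ltW.
  have g2 : C0 * (X 0 + Z 0) <= C0 * (5 * (dot (u 0) (u 0) + dot (ux 0) (ux 0)) + Z 0).
    by rewrite ler_wpM2l ?(ltW C0_gt0)// lerD2r.
  have r0 := ltW rho0; have rZ := mulr_ge0 r0 Z0; have cc0 := ltW C0_gt0; have ep0 := ltW eps0.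
  have h1 := mulr_ge0 Ae0 X0; have h2 := mulr_ge0 Ae0 W0; have h3 := mulr_ge0 Ae0 Z0.
  have h4 := mulr_ge0 (mulr_ge0 Ae0 r0) U0; have h5 := mulr_ge0 (mulr_ge0 Ae0 r0) X0.
  have h6 := mulr_ge0 (mulr_ge0 Ae0 r0) W0; have h7 := mulr_ge0 cc0 Z0; have h8 := mulr_ge0 cc0 W0.
  have h9 := mulr_ge0 ep0 U0; have h10 := mulr_ge0 ep0 X0; have h11 := mulr_ge0 ep0 Z0.
  move: g1; rewrite /C /e -/ee; lra.
- move=> t t0; rewrite -/(W t) -/(T t).
  have v0 := dot_ge0 (uxx t); have w0 := W_ge0 t; have tt0 := T_ge0 t.
  have x0 := X_ge0 t; have U0 := dot_ge0 (u t); have ux0 := dot_ge0 (ux t).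
  apply: le_trans (ler_wpM2r v0 c_v) _; rewrite ler_pdivrMl//.
  have := uxx_le t0; have := X_le (ltW t0) => xl vl.
  have := ler_wpM2l CV_ge0 xl; have := mulr_ge0 CV_ge0 tt0; have := mulr_ge0 CV_ge0 w0.
  by lra.
Qed.

End Energy.

(** The constants are fixed before the functions: they depend on p, alpha and S alone, hence are
    common to the solution and all its difference quotients. *)
Lemma energy_estimate (R : realType) (p : params R) (alpha S : R) :
  admissible_params p -> 0 <= alpha -> 0 < beta p alpha ->
  exists c C : R, forall u ux uxx ut utx z zx s sx q q' lam lam',
  energy_system p S u ux uxx ut utx z zx s sx q q' lam lam' ->
  energy_decay alpha c C u ux uxx ut z zx.
Proof.
move=> hp a0 b0; eexists; eexists => u ux uxx ut utx z zx s sx q q' lam lam' ES.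
exact: (energy_estimate_constants hp a0 b0 ES).
Qed.

(** * Weak derivatives and Sobolev norms *)

Section Sobolev.
Context {R : realType}.
Implicit Types (f g : R -> R).

Lemma wderivP f g : weak_derivative f g -> weak_derivative f (wderiv f).
Proof. by move=> fg; apply: (xgetPex (fun=> 0) (P := [set g | weak_derivative f g])); exists g. Qed.

(** [sobolev] provides one derivative and [wderiv] another; they agree against test functions, so a
    second derivative of one is a second derivative of the other. *)
Lemma weak_derivative_transfer f g g' h : weak_derivative f g -> weak_derivative f g' ->
  weak_derivative g h -> weak_derivative g' h.
Proof.
move=> fg fg' [h2 gh]; split=> // phi phit.
by rewrite -(weak_derivative_unique fg fg' (test_function_dL2 phit)) gh.
Qed.

Lemma sobolev1_wderiv f : sobolev 1 f -> weak_derivative f (wderiv f).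
Proof. by move=> [_ [g [fg _]]]; exact: wderivP fg. Qed.

Lemma sobolev2_wderiv f : sobolev 2 f ->
  weak_derivative f (wderiv f) /\ weak_derivative (wderiv f) (wderiv (wderiv f)).
Proof.
move=> [_ [g [fg [_ [h [gh _]]]]]]; have fw := wderivP fg.
split; first exact: fw.
exact: wderivP (weak_derivative_transfer fg fw gh).
Qed.

Lemma weak_derivative_sobolev1 f g : L2 f -> weak_derivative f g -> sobolev 1 f.
Proof. by move=> f2 fg; split=> //; exists g; split=> //; case: fg. Qed.

Lemma Hnorm1_sqr f : Hnorm 1 f ^+ 2 = dot f f + dot (wderiv f) (wderiv f).
Proof.
rewrite sqr_sqrtr ?sumr_ge0// => [|k _]; last exact: sqr_ge0.
by rewrite !big_ord_recr big_ord0/= add0r !L2norm_sqr.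
Qed.

Lemma Hnorm2_sqr f : Hnorm 2 f ^+ 2 = dot f f + dot (wderiv f) (wderiv f)
  + dot (wderiv (wderiv f)) (wderiv (wderiv f)).
Proof.
rewrite sqr_sqrtr ?sumr_ge0// => [|k _]; last exact: sqr_ge0.
rewrite !big_ord_recr big_ord0/= add0r.
by congr (_ + _ + _); exact: L2norm_sqr.
Qed.

Lemma tnorm_sqr f : tnorm f ^+ 2 =
  dot (wderiv f) (wderiv f) + f 0 ^+ 2 + f 1 ^+ 2.
Proof. by rewrite sqr_sqrtr ?L2norm_sqr// !addr_ge0 ?sqr_ge0 ?dot_ge0. Qed.

Lemma H1_sup_norm f fx x (M : R) : H1 f fx -> dot f f + dot fx fx <= M ->
  0 <= x <= 1 -> f x ^+ 2 <= 6 * M.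
Proof.
move=> Hf fM x01; apply: le_trans (H1_sup Hf x01) _.
by have := trace0_le Hf; have := dot_ge0 f; have := dot_ge0 fx; lra.
Qed.

Lemma time_derivative_isd (v : R -> R -> R) (t : R) g phi : 0 < t ->
  (forall s, 0 <= s -> L2 (v s)) -> time_derivative v t g -> L2 phi ->
  is_derive t 1 (fun s => dot (v s) phi) (dot g phi).
Proof.
move=> t0 v2 [g2 vg] phi2; apply/isdP/cvgrPdist_le => /= e e0.
have d0 : 0 < e / (1 + L2norm phi) by rewrite divr_gt0// ltr_wpDr ?L2norm_ge0.
have /cvgrPdist_le/(_ _ d0) Hn := vg; rewrite near_withinE in Hn.
near=> h; have h0 : h != 0 by near: h; exact: nbhs_dnbhs_neq.
have ht : `|h| < t by near: h; exact: dnbhs0_lt.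
have th : 0 <= t + h by move: ht; rewrite ltr_norml => /andP[]; lra.
have t0' := ltW t0; have D2 := L2B (v2 _ th) (v2 _ t0'); have hD2 := L2Z h^-1 D2.
have : `|0 - L2norm (fun x => h^-1 * (v (t + h) x - v t x) - g x)| <= e / (1 + L2norm phi).
  by move: th; near: h; exact: Hn.
rewrite sub0r normrN (ger0_norm (L2norm_ge0 _)) ler_pdivlMr ?ltr_wpDr ?L2norm_ge0// => Hle.
rewrite -(dotBl (v2 _ th) (v2 _ t0') phi2) -(dotZl _ D2 phi2) distrC -(dotBl hD2 g2 phi2).
apply: le_trans (dot_le_norm (L2B hD2 g2) phi2) _; apply: le_trans Hle.
by rewrite ler_wpM2l ?L2norm_ge0// lerDr.
Unshelve. all: by end_near. Qed.

Lemma time_derivative_right0 (v : R -> R -> R) g phi :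
  (forall s, 0 <= s -> L2 (v s)) -> time_derivative v 0 g -> L2 phi ->
  dot (v s) phi @[s --> 0^'+] --> dot (v 0) phi.
Proof.
move=> v2 [g2 vg] phi2; have z0 := lexx (0 : R).
have /cvgrPdist_le/(_ _ ltr01) Hn0 := vg; rewrite !near_withinE in Hn0.
have Hn : \forall h \near 0^'+,
    `|0 - L2norm (fun x => h^-1 * (v (0 + h) x - v 0 x) - g x)| <= 1.
  rewrite near_withinE; move: Hn0; apply: filterS => h H h0; apply: H; first by rewrite gt_eqF.
  by rewrite /= add0r ltW.
apply/cvgrPdist_le => /= e e0; pose C := (1 + L2norm g) * L2norm phi + 1.
have C0 : 0 < C by rewrite ltr_wpDl// mulr_ge0 ?addr_ge0 ?L2norm_ge0.
near=> h; have h0 : 0 < h by near: h; exact: nbhs_right_gt.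
have h0' := ltW h0.
have : `|0 - L2norm (fun x => h^-1 * (v (0 + h) x - v 0 x) - g x)| <= 1.
  by near: h; exact: Hn.
rewrite sub0r normrN (ger0_norm (L2norm_ge0 _)) add0r => Hle.
have D2 := L2B (v2 _ h0') (v2 _ z0); have hD2 := L2Z h^-1 D2; have B2 := L2B hD2 g2.
rewrite distrC -(dotBl (v2 _ h0') (v2 _ z0) phi2).
have -> : dot (fun x => v h x - v 0 x) phi = h * (dot (fun x => h^-1 * (v h x - v 0 x) - g x) phi + dot g phi).
  rewrite (dotBl hD2 g2 phi2) subrK (dotZl _ D2 phi2) mulrA mulfV ?mul1r// gt_eqF//.
rewrite normrM (gtr0_norm h0).
have : `|dot (fun x => h^-1 * (v h x - v 0 x) - g x) phi + dot g phi| <= C.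
  apply: le_trans (ler_normD _ _) _.
  have := dot_le_norm B2 phi2; have := dot_le_norm g2 phi2.
  have := ler_wpM2r (L2norm_ge0 phi) Hle; rewrite /C; lra.
move=> /(ler_wpM2l h0') /le_trans; apply.
rewrite -ler_pdivlMr//; near: h; apply: nbhs_right_le; exact: divr_gt0.
Unshelve. all: by end_near. Qed.

End Sobolev.

(** * Integrals of derivatives and lower limits *)

Section Integrals.
Context {R : realType}.
Local Notation mu := (@lebesgue_measure R).
Implicit Types (f g : R -> R) (a e h s t x N : R).

(** The integral of a nonnegative function is a supremum over the simple functions below it, and
    this set grows with the function; measurability does not enter. This matters because the
    integrands of the final estimate are not shown to be measurable in time. *)
Lemma ge0_integral_mono (D : set R) (f g : R -> \bar R) :
  (forall x, D x -> (0 <= f x)%E) -> (forall x, D x -> (f x <= g x)%E) ->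
  (\int[mu]_(x in D) f x <= \int[mu]_(x in D) g x)%E.
Proof.
move=> f0 fg; rewrite (@integral_mkcond _ _ _ mu D f) (@integral_mkcond _ _ _ mu D g).
rewrite !ge0_integralTE; last 2 first.
- by apply: erestrict_ge0 => x Dx; exact: le_trans (f0 _ Dx) (fg _ Dx).
- exact: erestrict_ge0.
apply: ereal_sup_le => _ [k /= kf <-]; exists k => // x.
by apply: le_trans (kf x) _; exact: lee_restrict.
Qed.

Lemma near_le_limn_einf (y : nat -> R) a :
  (forall e, 0 < e -> \forall n \near \oo, a - e <= y n) ->
  (a%:E <= limn_einf (EFin \o y))%E.
Proof.
move=> ya; rewrite limn_einf_lim; apply/lee_addgt0Pr => e e0.
rewrite -leeBlDr// -EFinB; apply: lime_ge; first exact: is_cvg_einfs.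
have [n0 _ Hn0] := ya _ e0.
near=> n; apply: le_ereal_inf_tmp => _ [k /= nk <-]; rewrite lee_fin; apply: Hn0 => /=.
by apply: leq_trans nk; near: n; exists n0.
Unshelve. all: by end_near. Qed.

Lemma fatou_le (D : set R) (y : nat -> R -> R) N : measurable D ->
  (forall n, measurable_fun D (y n)) -> (forall n s, D s -> 0 <= y n s) ->
  (forall n, (\int[mu]_(s in D) (y n s)%:E <= N%:E)%E) ->
  (\int[mu]_(s in D) limn_einf (fun n => (y n s)%:E) <= N%:E)%E.
Proof.
move=> mD my y0 yN; have my' n : measurable_fun D (fun s => (y n s)%:E) by exact/measurable_EFinP.
have y0' n s : D s -> (0 <= (y n s)%:E)%E by move=> Ds; rewrite lee_fin y0.
apply: le_trans (@fatou _ _ _ mu D mD _ my' y0') _.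
rewrite limn_einf_lim; apply: lime_le; first exact: is_cvg_einfs.
apply: nearW => n; apply: le_trans (yN n); apply: ereal_inf_lbound.
by exists n => //=.
Qed.

Lemma integral_le_liminf (f : R -> R) (y : nat -> R -> R) t N :
  (forall n, measurable_fun `]0, t] (y n)) ->
  (forall n s, 0 < s -> 0 <= y n s) ->
  (forall n, (\int[mu]_(s in `]0%R, t]) (y n s)%:E <= N%:E)%E) ->
  (forall s, 0 <= s -> 0 <= f s) ->
  (forall s, 0 < s -> forall e, 0 < e -> \forall n \near \oo, f s - e <= y n s) ->
  (\int[mu]_(s in `[0%R, t]) (f s)%:E <= N%:E)%E.
Proof.
move=> my y0 yN f0 fy; pose F s := limn_einf (fun n => (y n s)%:E).
have mF : measurable_fun `]0, t] F.
  apply: measurableT_comp => //; apply: measurable_fun_limn_esup => n.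
  by apply: measurableT_comp => //; exact/measurable_EFinP.
(* The lower limit dominates f only for s > 0; the value +oo at 0 extends the comparison to the
   closed interval, and a single point does not change the integral. *)
pose G s := if s == 0 then +oo%E else F s.
have GF s : 0 < s -> G s = F s by rewrite /G => /gt_eqF ->.
have mG : measurable_fun `]0, t] G.
  by apply: eq_measurable_fun mF => s; rewrite inE/= in_itv/= => /andP[/GF].
apply: (@le_trans _ _ (\int[mu]_(s in `[0%R, t]) G s)%E).
  apply: ge0_integral_mono => s; rewrite /= in_itv/= => /andP[s0 _]; first by rewrite lee_fin f0.
  rewrite /G; case: eqP => [_|/eqP sn0]; first exact: leey.
  by apply: near_le_limn_einf => e e0; apply: fy => //; rewrite lt_neqAle eq_sym sn0.
rewrite -integral_itv_obnd_cbnd//.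
rewrite (@eq_integral _ _ _ mu _ F); last by move=> s; rewrite inE/= in_itv/= => /andP[/GF].
apply: fatou_le => // n s; rewrite /= in_itv/= => /andP[s0 _]; exact: y0.
Qed.

(* The derivative is a limit of difference quotients, whose integrals are
   bounded by [f 0] because [f] is nonincreasing. *)
Lemma der0_integral f df t : der0 f df -> (forall s, 0 <= s -> 0 <= f s) ->
  (forall s, 0 < s -> df s <= 0) -> 0 < t ->
  measurable_fun `]0, t] (fun s => - df s) /\
  (\int[mu]_(s in `]0%R, t]) (- df s)%:E <= (f 0)%:E)%E.
Proof.
(* Extending f by its initial value makes it continuous and nonincreasing on the whole line. *)
move=> Hf f0 df0 t0; pose k s := f (Num.max 0 s).
have kE s : 0 <= s -> k s = f s by move=> s0; rewrite /k max_r.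
have k_ni a b : a <= b -> k b <= k a.
  move=> ab; apply: der0_nonincreasing Hf df0 _.
  by rewrite le_max lexx/= ge_max !le_max lexx ab !orbT.
have kc : continuous k.
  move=> s; have [s0|s0] := ltP 0 s.
    apply: (@continuous_comp R R R (fun x : R => Num.max 0 x) f s); first exact: continuous_max0.
    by rewrite /continuous_at (max_r (ltW s0)); exact: isd_continuous (Hf.1 s s0).
  have ks : k s = f 0 by rewrite /k max_l.
  apply/cvgrPdist_le => e e0; have /cvgrPdist_le/(_ e e0) Hd := Hf.2.
  rewrite near_withinE in Hd; have /nbhs_ballP[d /= d0 {}Hd] := Hd; near=> x.
  have [x0|x0] := leP x 0; first by rewrite ks /k max_l// subrr normr0 ltW.
  have -> : k x = f x by apply: kE; exact: ltW.
  rewrite ks; have := Hd x; apply => //; rewrite -ball_normE /= sub0r normrN gtr0_norm//.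
  apply: (@le_lt_trans _ _ (x - s)); first by rewrite lerBrDl gerDr.
  apply: le_lt_trans (ler_norm _) _; rewrite distrC.
  by near: x; exists d.
(* Subtracting f 0 makes the function vanish for s <= 0, as [exists_primitive] requires; the
   constant cancels in the quotients. *)
pose k0 s := k s - f 0.
have [P [dP P0]] : exists P : R -> R, (forall x, is_derive x 1 P (k0 x)) /\
    (forall x, x <= 0 -> P x = 0).
  apply: exists_primitive => [x|x x0]; first by apply: cvgB; [exact: kc|exact: cvg_cst].
  by rewrite /k0 /k max_l// subrr.
pose h n : R := n.+1%:R^-1.
have h0 n : 0 < h n by rewrite invr_gt0.
pose y n s := (h n)^-1 * (k s - k (s + h n)).
have yc n : continuous (y n).
  move=> s; apply: cvgM; first exact: cvg_cst.
  apply: cvgB; first exact: kc.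
  apply: (@continuous_comp R R R (fun s : R => s + h n) k s); last exact: kc.
  by apply: cvgD; [exact: cvg_id|exact: cvg_cst].
have y0 n s : 0 <= y n s by rewrite mulr_ge0 ?invr_ge0 ?(ltW (h0 n))// subr_ge0 k_ni// lerDl ltW.
have my n : measurable_fun `]0, t] (y n).
  by apply: measurable_funTS; exact: continuous_measurable_fun.
have y_cvg s : 0 < s -> y n s @[n --> \oo] --> - df s.
  move=> s0; have /isdP Hs := Hf.1 s s0.
  have hc : h n @[n --> \oo] --> 0^'.
    by apply: cvg_dnbhs0 => [|n]; [exact: cvg_harmonic|rewrite gt_eqF].
  rewrite (_ : (fun n => y n s) = (fun n => - ((h n)^-1 * (f (s + h n) - f s)))).
    exact: cvgN (cvg_comp _ _ hc Hs).
  by apply/funext => n; rewrite /y !kE ?addr_ge0 ?ltW// -mulrN opprB.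
have yt s : `]0, t]%classic s -> (y n s)%:E @[n --> \oo] --> (- df s)%:E.
  by rewrite /= in_itv/= => /andP[s0 _]; apply: cvg_EFin; [exact: nearW|exact: y_cvg].
split; first by apply: measurable_fun_cvg my _ => s; rewrite /= in_itv/= => /andP[s0 _]; exact: y_cvg.
rewrite (@eq_integral _ _ _ mu _ (fun s => limn_einf (fun n => (y n s)%:E))); last first.
  by move=> s; rewrite inE => /yt /cvg_limn_einf_sup[-> _].
apply: fatou_le => // n.
rewrite integral_itv_obnd_cbnd; last exact/measurable_EFinP.
pose Q s := (h n)^-1 * (P s - P (s + h n)).
have dQ s : is_derive s 1 Q (y n s).
  have := isdZ (h n)^-1 (isdB (dP s) (isd_shift (dP (s + h n)))).
  by move/isd_eq; apply => //; rewrite /y /k0; congr (_ * _); ring.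
rewrite (@continuous_FTC2 _ (y n) Q 0 t)//; last first.
- by move=> s _; rewrite derive1E; exact: derive_val.
- have Qc s : {for s, continuous Q} by exact: isd_continuous (dQ s).
  split; first by move=> s _; exact: ex_derive.
    by apply: cvg_at_right_filter; exact: Qc.
  by apply: cvg_at_left_filter; exact: Qc.
- exact: continuous_subspaceT.
rewrite -EFinB lee_fin /Q add0r.
(* The integral of [y n] is the mean of k over [0, h n] minus its mean over [t, t + h n], and each
   mean is a value of k. *)
have MVT a : exists c, P (a + h n) - P a = k0 c * h n.
  have ah : a <= a + h n by rewrite lerDl ltW.
  have [c [_ ->]] := isd_MVT ah (continuous_subspaceT (fun s => isd_continuous (dP s))) (fun s _ => dP s).
  by exists c; congr (_ * _); ring.
have [a Ea] := MVT t; have [b Eb] := MVT 0; rewrite add0r in Eb.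
have -> : (h n)^-1 * (P t - P (t + h n)) - (h n)^-1 * (P 0 - P (h n)) = k b - k a.
  rewrite -mulrBr (_ : _ - _ = (k0 b - k0 a) * h n); last by rewrite mulrBl -Ea -Eb; ring.
  by rewrite mulrCA mulVf ?gt_eqF// /k0; ring.
have : k b <= f 0.
  rewrite -(kE 0)//; have [b0|b0] := leP 0 b; first exact: k_ni.
  by rewrite /k !max_l// ltW.
by have : 0 <= k a; [apply: f0; rewrite le_max lexx|lra].
Unshelve. all: by end_near. Qed.

End Integrals.

(** * Difference quotients in the limit *)

Section WeakLimits.
Context {R : realType}.
Implicit Types (f psi : R -> R) (e t L : R).

(** Separates a genuine derivative from the default value, whose norm is 0 and for which lower
    semicontinuity is trivial. *)
Lemma wderiv_default f : weak_derivative f (wderiv f) \/ wderiv f = fun=> 0.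
Proof.
have [[g fg]|nf] := pselect (exists g, weak_derivative f g); first by left; exact: wderivP fg.
by right; rewrite /wderiv xgetPN// => g fg; apply: nf; exists g.
Qed.

(** |f|^2 is the supremum over psi of the left side, which is affine in f; this form of the norm
    passes to weak limits. *)
Lemma dot_dual_le f psi : L2 f -> L2 psi -> 2 * dot f psi - dot psi psi <= dot f f.
Proof.
move=> f2 psi2; have := dot_ge0 (fun x => f x - psi x).
by rewrite (dot_sqrB f2 psi2); lra.
Qed.

Lemma dot_dual_approx f e : L2 f -> 0 < e ->
  exists2 psi, test_function psi & dot f f - e <= 2 * dot f psi - dot psi psi.
Proof.
move=> f2 e0; have [_ /(_ e e0)[psi psit fpsi]] := test_functions_dense f2.
exists psi => //; move: fpsi; rewrite (dot_sqrB f2 (test_function_L2 psit)); lra.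
Qed.

Lemma WD_quotient_cvg L (v v' : R -> R -> R) t psi : WD L v v' -> 0 < t -> L2 psi ->
  dot (fun x => (n.+1%:R^-1)^-1 * (v (t + n.+1%:R^-1) x - v t x)) psi
    @[n --> \oo] --> dot (v' t) psi.
Proof.
move=> Hv t0 psi2; have [v2 _ _ dv] := Hv; have /isdP H := dv t t0 psi psi2.
have hc : (n.+1%:R^-1 : R) @[n --> \oo] --> 0^'.
  by apply: cvg_dnbhs0 => [|n]; [exact: cvg_harmonic|rewrite gt_eqF].
have t0' := ltW t0.
have th n : 0 <= t + n.+1%:R^-1 by rewrite addr_ge0.
rewrite (_ : (fun n => dot _ psi) = (fun n => (n.+1%:R^-1)^-1 *
    (dot (v (t + n.+1%:R^-1)) psi - dot (v t) psi))).
  exact: cvg_comp hc H.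
apply/funext => n; rewrite -(dotBl (v2 _ (th n)) (v2 _ t0') psi2).
exact: dotZl (L2B (v2 _ (th n)) (v2 _ t0')) psi2.
Qed.

End WeakLimits.

(** * Constants determined by the bound of (A2) *)

Section Bounds.
Context {R : realType} (p : params R) (M : R).

(* With [M] the bound of (A2): a Lipschitz constant of w, w_x, z and z_x as
   L^2-valued functions of time. *)
Definition lipschitz_bound : R :=
  (1 + delta p) * (1 + (rho p)^-1 * (1 + wd p + 3 * Num.sqrt M + nu p)) * Num.sqrt M.

(** Coercivity constant of the L^2 dissipation of w: 2 nu on w_x and one copy of c_i at each
    endpoint, the other copy being spent on the cubic flux. *)
Definition min_coef : R := Num.min (2 * nu p) (Num.min (c0 p) (c1 p)).

(** 36 M bounds q' for difference quotients, since w^2 and w_t^2 are at most 6 M; the second summand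
    bounds lam(t) + lam(t + h). *)
Definition coef_bound : R := 36 * M + 4 / min_coef * ((1 + rho p) * M).

(** Bounds [Phi] at time 0: M accounts for the solution, and 4 counts the norms of u, u_x, zeta and
    zeta_x for a difference quotient. *)
Definition decay_bound (C : R) : R := `|C| * (M + 4 * lipschitz_bound ^+ 2).

End Bounds.

(** * Decay of the solution *)

Section Solution.
Context {R : realType} (p : params R) (hp : admissible_params p) (M : R).
Context (w0 : R -> R) (w wt z : R -> R -> R).
Context (WS : weak_solution p w0 w wt z).
Context (Hcont : forall t : R, 0 <= t -> cont01 (wt t) /\ cont01 (z t)).
Context (Hw : forall t : R, 0 <= t -> sobolev 2 (w t)).
Context (Hwt : forall t : R, 0 <= t -> sobolev 1 (wt t)).
Context (HM : forall t : R, 0 <= t ->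
  Hnorm 2 (w t) ^+ 2 + Hnorm 1 (wt t) ^+ 2 + L2norm (z t) ^+ 2 <= M).
Context (wx wxx wtx : R -> R -> R).
Context (wxE : forall t, wx t = wderiv (w t)).
Context (wxxE : forall t, wxx t = wderiv (wderiv (w t))).
Context (wtxE : forall t, wtx t = wderiv (wt t)).
Implicit Types (t x : R).

Let nu0 : 0 < nu p. Proof. by case: hp => -[]. Qed.
Let rho0 : 0 < rho p. Proof. by case: hp => -[]. Qed.
Let delta0 : 0 < delta p. Proof. by case: hp => -[]. Qed.
Let c00 : 0 < c0 p. Proof. by case: hp => _ []. Qed.
Let c10 : 0 < c1 p. Proof. by case: hp => _ []. Qed.
Let wd0 : 0 <= wd p. Proof. by case: hp => _ []. Qed.
Let o01 : 0 <= (1 : R) <= 1. Proof. by rewrite lexx ler01. Qed.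
Let z01 : 0 <= (0 : R) <= 1. Proof. by rewrite lexx ler01. Qed.

Let H1w t : 0 <= t -> H1 (w t) (wx t).
Proof.
by move=> t0; rewrite wxE; split; [exact: (ws_w WS t0).2|exact: (sobolev2_wderiv (Hw t0)).1].
Qed.

Let Hwxx t : 0 <= t -> weak_derivative (wx t) (wxx t).
Proof. by move=> t0; rewrite wxE wxxE; exact: (sobolev2_wderiv (Hw t0)).2. Qed.

Let H1wt t : 0 <= t -> H1 (wt t) (wtx t).
Proof.
by move=> t0; rewrite wtxE; split; [exact: (Hcont t0).1|exact: (sobolev1_wderiv (Hwt t0))].
Qed.

Let w2 t : 0 <= t -> L2 (w t). Proof. by move=> /H1w/H1_L2. Qed.
Let wx2 t : 0 <= t -> L2 (wx t). Proof. by move=> /H1w/H1_dL2. Qed.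
Let wxx2 t : 0 <= t -> L2 (wxx t). Proof. by move=> /Hwxx[]. Qed.
Let wt2 t : 0 <= t -> L2 (wt t). Proof. by move=> /H1wt/H1_L2. Qed.
Let wtx2 t : 0 <= t -> L2 (wtx t). Proof. by move=> /H1wt/H1_dL2. Qed.
Let z2 t : 0 <= t -> L2 (z t). Proof. by move=> t0; exact: ws_z WS _ t0. Qed.

Let bound_all t : 0 <= t -> dot (w t) (w t) + dot (wx t) (wx t) + dot (wxx t) (wxx t)
  + (dot (wt t) (wt t) + dot (wtx t) (wtx t)) + dot (z t) (z t) <= M.
Proof.
by move=> t0; have := HM t0; rewrite Hnorm2_sqr Hnorm1_sqr L2norm_sqr wxE wxxE wtxE.
Qed.

Let bound t : 0 <= t -> [/\ [/\ dot (w t) (w t) <= M, dot (wx t) (wx t) <= M &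
  dot (wxx t) (wxx t) <= M], dot (wt t) (wt t) <= M, dot (wtx t) (wtx t) <= M,
  dot (z t) (z t) <= M & dot (w t) (w t) + dot (wx t) (wx t) <= M /\
  dot (wt t) (wt t) + dot (wtx t) (wtx t) <= M].
Proof.
move=> t0; have := bound_all t0.
have := dot_ge0 (w t); have := dot_ge0 (wx t); have := dot_ge0 (wxx t).
have := dot_ge0 (wt t); have := dot_ge0 (wtx t); have := dot_ge0 (z t).
by move=> *; repeat split; lra.
Qed.

Let M0 : 0 <= M.
Proof. by have [_ _ _ h _] := bound (lexx 0); exact: le_trans (dot_ge0 _) h. Qed.

Let norm_le f (N : R) : dot f f <= N -> L2norm f <= Num.sqrt N.
Proof. by move=> H; rewrite ler_wsqrtr. Qed.

Let w_sup t x : 0 <= t -> 0 <= x <= 1 -> w t x ^+ 2 <= 6 * M.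
Proof. by move=> t0; apply: H1_sup_norm (H1w t0) _; have [_ _ _ _ []] := bound t0. Qed.

Let wt_sup t x : 0 <= t -> 0 <= x <= 1 -> wt t x ^+ 2 <= 6 * M.
Proof. by move=> t0; apply: H1_sup_norm (H1wt t0) _; have [_ _ _ _ []] := bound t0. Qed.

Let der_w phi : L2 phi -> der0 (fun t => dot (w t) phi) (fun t => dot (wt t) phi).
Proof.
move=> phi2; split.
  move=> t t0; apply: (time_derivative_isd t0 w2) => //.
  exact: ws_wt WS _ (ltW t0).
exact: time_derivative_right0 w2 (ws_wt WS (lexx 0)) phi2.
Qed.

Let zt t x := wx t x - delta p * z t x.

Let zt2 t : 0 <= t -> L2 (zt t).
Proof. by move=> t0; exact: L2B (wx2 t0) (L2Z _ (z2 t0)). Qed.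

Let der_z phi : L2 phi -> der0 (fun t => dot (z t) phi) (fun t => dot (zt t) phi).
Proof.
move=> phi2; split.
  move=> t t0; apply: (time_derivative_isd t0 z2) => //.
  rewrite /zt wxE; exact: ws_zt WS _ (ltW t0).
exact: time_derivative_right0 z2 (ws_zt WS (lexx 0)) phi2.
Qed.

Let der_wx phi : test_function phi ->
  der0 (fun t => dot (wx t) phi) (fun t => dot (wtx t) phi).
Proof.
move=> phit; apply: der0_eq (der0Z (-1) (der_w (test_function_dL2 phit))) _ _ => t t0.
  by have [_ [_ ->]] := H1w t0; rewrite // mulN1r opprK.
by have [_ [_ ->]] := H1wt (ltW t0); rewrite // mulN1r opprK.
Qed.

Let eq_H1 t phi phix : 0 < t -> H1 phi phix ->
  dot (wt t) phi + nu p * dot (wx t) phix + wd p * dot (wx t) phi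
    + dot (fun x => w t x * wx t x) phi + rho p * dot (z t) phix
    + bsum p (fun c i =>
        ((c + wd p) * w t i + 2 / (9 * c) * w t i ^+ 3) * phi i) = 0.
Proof.
move=> t0 Hphi; have t0' := ltW t0.
have s1 : sobolev 1 phi := weak_derivative_sobolev1 (H1_L2 Hphi) Hphi.2.
rewrite -(ws_eq WS t0 s1 Hphi.1) -wxE.
have U f : L2 f -> dot f phix = dot f (wderiv phi).
  by move=> f2; rewrite !(dotC f); exact: weak_derivative_unique Hphi.2 (sobolev1_wderiv s1) f2.
by rewrite (U _ (wx2 t0')) (U _ (z2 t0')).
Qed.

Let wwx2 t : 0 <= t -> L2 (fun x => w t x * wx t x).
Proof. by move=> t0; exact: cont01_L2M (H1w t0).1 (wx2 t0). Qed.

Let G t x := wt t x + (wd p * wx t x + w t x * wx t x).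
(** The equation solved for z_x, which is possible only for t > 0; at t = 0 the value 0 is the
    derivative of the initial datum of z. *)
Let zx t : R -> R := if 0 < t then fun x => (rho p)^-1 * (G t x - nu p * wxx t x) else fun=> 0.

Let G2 t : 0 <= t -> L2 (G t).
Proof. by move=> t0; exact: L2D (wt2 t0) (L2D (L2Z _ (wx2 t0)) (wwx2 t0)). Qed.

Let zx2 t : 0 <= t -> L2 (zx t).
Proof.
move=> t0; rewrite /zx; case: ifP => _; last exact: L2_cst.
exact: L2Z _ (L2B (G2 t0) (L2Z _ (wxx2 t0))).
Qed.

Let Hzx t : 0 <= t -> weak_derivative (z t) (zx t).
Proof.
move=> t0; split; first exact: zx2.
move=> phi phit; have phi2 := test_function_L2 phit; have dphi2 := test_function_dL2 phit.
have [t1|t1] := ltP 0 t; last first.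
  have tE : t = 0 by apply/eqP; rewrite eq_le t1 t0.
  rewrite tE dot0l => [|x /I_sub x01]; last exact: ws_z_init WS _ x01.
  by rewrite /zx ltxx dot0l ?oppr0.
have Hphi : H1 phi (derive1 phi).
  by apply: C1_H1 => [x|]; [exact: test_function_isd|case: phit].
have := eq_H1 t1 Hphi; have [_ Hx] := Hwxx t0; rewrite Hx//.
have [b0 b1] := test_function_bd phit; rewrite /bsum b0 b1 !mulr0 !addr0 => E.
have wu2 := L2Z (wd p) (wx2 t0).
rewrite /zx t1 (dotZl _ (L2B (G2 t0) (L2Z _ (wxx2 t0))) phi2).
rewrite (dotBl (G2 t0) (L2Z (nu p) (wxx2 t0)) phi2) (dotZl _ (wxx2 t0) phi2).
rewrite (dotDl (wt2 t0) (L2D wu2 (wwx2 t0)) phi2) (dotDl wu2 (wwx2 t0) phi2) (dotZl _ (wx2 t0) phi2).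
apply: (mulfI (lt0r_neq0 rho0)); rewrite mulrN mulrA mulfV ?gt_eqF// mul1r.
by move: E; set A := dot (fun x => _) phi; lra.
Qed.

Let Lip := lipschitz_bound p M.

Let sM0 : 0 <= Num.sqrt M. Proof. exact: sqrtr_ge0. Qed.

Let zx_norm t : 0 <= t -> L2norm (zx t) <=
  (rho p)^-1 * (1 + wd p + 3 * Num.sqrt M + nu p) * Num.sqrt M.
Proof.
move=> t0; have ri : 0 <= (rho p)^-1 by rewrite invr_ge0 ltW.
have K0 : 0 <= (rho p)^-1 * (1 + wd p + 3 * Num.sqrt M + nu p) * Num.sqrt M.
  by rewrite !mulr_ge0// !addr_ge0 ?mulr_ge0// ltW.
have [t1|t1] := ltP 0 t; last first.
  by rewrite /zx ltNge t1 /= /L2norm dot0l ?sqrtr0.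
have [[_ wxM wxxM] wtM _ _ _] := bound t0.
have nZ (a : R) f : 0 <= a -> L2 f -> L2norm (fun x => a * f x) = a * L2norm f.
  move=> a0 f2; rewrite /L2norm (dotZl _ f2 (L2Z a f2)) (dotZr _ f2 f2).
  by rewrite mulrA -expr2 sqrtrM ?sqr_ge0// sqrtr_sqr ger0_norm.
have nN f : L2 f -> L2norm (fun x => - f x) = L2norm f.
  by move=> f2; rewrite /L2norm (dotNl f2 (L2N f2)) (dotNr f2 f2) opprK.
have wu2 := L2Z (wd p) (wx2 t0); have nw2 := L2Z (nu p) (wxx2 t0).
rewrite /zx t1 nZ//; last exact: L2B (G2 t0) nw2.
rewrite -mulrA ler_wpM2l//.
apply: le_trans (L2norm_triangle (G2 t0) (L2N nw2)) _; rewrite (nN _ nw2) (nZ _ _ (ltW nu0) (wxx2 t0)).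
have g1 := L2norm_triangle (wt2 t0) (L2D wu2 (wwx2 t0)).
have g2 := L2norm_triangle wu2 (wwx2 t0); rewrite (nZ _ _ wd0 (wx2 t0)) in g2.
(* w^2 <= 6 M <= (3 sqrt M)^2. *)
have g3 : L2norm (fun x => w t x * wx t x) <= 3 * Num.sqrt M * Num.sqrt M.
  rewrite -ler_sqr ?nnegrE ?L2norm_ge0 ?mulr_ge0// L2norm_sqr.
  apply: le_trans (@dot_bndM _ (3 * Num.sqrt M) _ _ (cont01_measurable (H1w t0).1) _ (wx2 t0)) _.
    move=> x /I_sub x01; rewrite -ler_sqr ?nnegrE ?mulr_ge0// real_normK ?num_real//.
    rewrite exprMn sqr_sqrtr//; apply: le_trans (w_sup t0 x01) _.
    by rewrite ler_wpM2r// -natrX ler_nat.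
  by rewrite [leRHS]exprMn ler_wpM2l ?sqr_ge0// sqr_sqrtr.
have n1 := norm_le wtM; have n2 := ler_wpM2l wd0 (norm_le wxM).
have n3 := ler_wpM2l (ltW nu0) (norm_le wxxM).
rewrite /G in g1 *; lra.
Qed.

Let ri0 : 0 <= (rho p)^-1 * (1 + wd p + 3 * Num.sqrt M + nu p).
Proof. by rewrite mulr_ge0 ?invr_ge0 ?(ltW rho0)// !addr_ge0 ?mulr_ge0// ltW. Qed.

Let Lip_ge (N : R) : N <= Num.sqrt M -> N <= Lip.
Proof.
move/le_trans; apply; rewrite /Lip /lipschitz_bound ler_peMl//; have d0 := delta0.
have rI := ri0; set k := (rho p)^-1 * _ in rI *; have := mulr_ge0 (ltW d0) rI; lra.
Qed.

Let Lip0 : 0 <= Lip. Proof. exact: Lip_ge. Qed.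

Let diff_norm (f g : R -> R) (a b : R) : L2 f -> L2 g -> L2norm f <= a -> L2norm g <= b ->
  L2norm (fun x => f x - delta p * g x) <= a + delta p * b.
Proof.
move=> f2 g2 fa gb; have d2 := L2Z (delta p) g2.
apply: le_trans (L2norm_triangle f2 (L2N d2)) _; apply: lerD => //.
rewrite /L2norm (dotNl d2 (L2N d2)) (dotNr d2 d2) opprK.
rewrite (dotZl _ g2 d2) (dotZr _ g2 g2) mulrA -expr2 sqrtrM ?sqr_ge0// sqrtr_sqr.
by rewrite ger0_norm ?(ltW delta0)// ler_wpM2l// ltW.
Qed.

Let WDw : WD Lip w wt.
Proof.
apply: WD_intro => // [t /ltW t0|phi /test_function_L2]; last exact: der_w.
by apply: Lip_ge; apply: norm_le; have [] := bound t0.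
Qed.

Let WDwx : WD Lip wx wtx.
Proof.
apply: WD_intro => // t /ltW t0.
by apply: Lip_ge; apply: norm_le; have [] := bound t0.
Qed.

Let WDz : WD Lip z zt.
Proof.
apply: WD_intro => // [t /ltW t0|phi /test_function_L2]; last exact: der_z.
have [[_ wxM _] _ _ zM _] := bound t0.
apply: le_trans (diff_norm (wx2 t0) (z2 t0) (norm_le wxM) (norm_le zM)) _.
rewrite /Lip /lipschitz_bound; have rI := ri0; set k := (rho p)^-1 * _ in rI *; have d0 := ltW delta0.
have := mulr_ge0 sM0 rI; have := mulr_ge0 d0 (mulr_ge0 sM0 rI); lra.
Qed.

Let WDzx : WD Lip zx (fun t x => wxx t x - delta p * zx t x).
Proof.
apply: WD_intro => // [t t0|t /ltW t0|phi phit].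
- exact: L2B (wxx2 t0) (L2Z _ (zx2 t0)).
- have [[_ _ wxxM] _ _ _ _] := bound t0.
  apply: le_trans (diff_norm (wxx2 t0) (zx2 t0) (norm_le wxxM) (zx_norm t0)) _.
  rewrite /Lip /lipschitz_bound; have rI := ri0; set k := (rho p)^-1 * _ in rI *; have d0 := ltW delta0.
  have := mulr_ge0 sM0 rI; have := mulr_ge0 d0 sM0; lra.
- have phi2 := test_function_L2 phit; have dphi2 := test_function_dL2 phit.
  apply: der0_eq (der0Z (-1) (der_z dphi2)) _ _ => t t0.
    by have [_ ->] := Hzx t0; rewrite // mulN1r opprK.
  have t0' := ltW t0; have dz2 := L2Z (delta p) (z2 t0'); have dzx2 := L2Z (delta p) (zx2 t0').
  rewrite (dotBl (wx2 t0') dz2 dphi2) (dotZl _ (z2 t0') dphi2).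
  rewrite (dotBl (wxx2 t0') dzx2 phi2) (dotZl _ (zx2 t0') phi2).
  have [_ ->] := Hzx t0' => //; have [_ ->] := Hwxx t0' => //; ring.
Qed.

Let X t := dot (wx t) (wx t) + w t 0 ^+ 2 + w t 1 ^+ 2.
Let m := min_coef p.
Let m0 : 0 < m. Proof. by rewrite /m /min_coef !lt_min c00 c10 !mulr_gt0. Qed.

(* The L^2 energy of (w, z), normalized so that its decay rate dominates the
   square of the sup norm of w. *)
Let lam t := 2 / m * (dot (w t) (w t) + rho p * dot (z t) (z t)).
Let lam' t := 2 / m * (2 * dot (wt t) (w t) + rho p * (2 * dot (zt t) (z t))).

Let der_lam : der0 lam lam'.
Proof.
have H := der0Z (2 / m) (der0D (WD_dot WDw WDw) (der0Z (rho p) (WD_dot WDz WDz))).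
apply: der0_eq H _ _ => // t t0.
by rewrite (dotC (w t)) (dotC (z t)) /lam'; ring.
Qed.

(** The factor 2 / 3 is that of the flux 2 (w w_x, w) = (2 / 3) (w(1)^3 - w(0)^3). The gap is y^2 /
    c times a sum of squares. *)
Let cubic_le (c y : R) : 0 < c ->
  `|y ^+ 3| * 2 / 3 <= (c + 2 * (2 / (9 * c)) * y ^+ 2) * y ^+ 2.
Proof.
move=> cp; have -> : `|y ^+ 3| * 2 / 3 = 2 / 3 * `|y| * y ^+ 2.
  by rewrite exprS normrM [`|y ^+ 2|]ger0_norm ?sqr_ge0//; ring.
rewrite ler_wpM2r ?sqr_ge0// -[y ^+ 2]real_normK ?num_real//.
set a := `|y|; have -> : c + 2 * (2 / (9 * c)) * a ^+ 2 = 2 / 3 * a + c^-1 *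
   ((c - a / 3) ^+ 2 + 3 / 9 * a ^+ 2) by field; rewrite gt_eqF.
by rewrite lerDl mulr_ge0 ?invr_ge0 ?(ltW cp)// addr_ge0 ?sqr_ge0// mulr_ge0 ?sqr_ge0// divr_ge0.
Qed.

(** The multiplier is w; the cubic feedback absorbs the flux with one of the two copies of c_i
    w(i)^2. The normalization 2 / m turns the remaining dissipation into 2 X, which dominates w^2 by
    [X_sup]. *)
Let lam'_le t : 0 < t -> 2 * X t <= - lam' t.
Proof.
move=> t0; have t0' := ltW t0; have Hwt0 := H1w t0'.
have E := eq_H1 t0 Hwt0.
have i3 := integration_by_parts3 Hwt0 Hwt0 Hwt0.
have i2 := integration_by_parts2 Hwt0 Hwt0.
have wwE : dot (fun x => w t x * wx t x) (w t) = dot (wx t) (fun x => w t x * w t x).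
  by apply: eq_Rintegral => x _; ring.
have dz2 := L2Z (delta p) (z2 t0').
have ztE : dot (zt t) (z t) = dot (z t) (wx t) - delta p * dot (z t) (z t).
  by rewrite /zt (dotBl (wx2 t0') dz2 (z2 t0')) (dotZl _ (z2 t0') (z2 t0')) (dotC (wx t)).
have q0 := cubic_le (w t 0) c00; have q1 := cubic_le (w t 1) c10.
have n0 := ler_norm (w t 0 ^+ 3); have n1 := ler_norm (- w t 1 ^+ 3); rewrite normrN in n1.
have a0 := sqr_ge0 (w t 0); have a1 := sqr_ge0 (w t 1); have x0 := dot_ge0 (wx t).
have zz0 := dot_ge0 (z t).
have mX : m * X t <= 2 * nu p * dot (wx t) (wx t) + c0 p * w t 0 ^+ 2 + c1 p * w t 1 ^+ 2.
  have e1 : m <= 2 * nu p by rewrite /m /min_coef ge_min lexx.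
  have e2 : m <= c0 p by rewrite /m /min_coef ge_min ge_min lexx orbT.
  have e3 : m <= c1 p by rewrite /m /min_coef ge_min ge_min lexx !orbT.
  by rewrite /X; have := ler_wpM2r x0 e1; have := ler_wpM2r a0 e2; have := ler_wpM2r a1 e3; lra.
have key : m * X t <= - (2 * dot (wt t) (w t) + rho p * (2 * dot (zt t) (z t))).
  apply: le_trans mX _; rewrite ztE; move: E; rewrite wwE /bsum.
  have b11 := congr1 ( *%R (wd p)) i2.
  have b9 := mulr_ge0 wd0 a0; have b10 := mulr_ge0 wd0 a1.
  have b7 := mulr_ge0 (mulr_ge0 (ltW delta0) (ltW rho0)) zz0.
  move: i3 b11 q0 q1 n0 n1 b9 b10 b7.
  rewrite -(mulrA (w t 1)) -(mulrA (w t 0)) -!expr2 -!exprS.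
  set k0 := 2 / (9 * c0 p); set k1 := 2 / (9 * c1 p).
  set A := w t 0; set D := w t 1; set N0 := `|A ^+ 3|; set N1 := `|D ^+ 3|.
  have e4 (a : R) : a ^+ 3 * a = a ^+ 2 * a ^+ 2 by ring.
  set V := dot (wx t) (fun x => _); set Y := dot (z t) (wx t).
  set T := dot (wt t) (w t); set WW := dot (wx t) (w t).
  set Z := dot (z t) (z t); set XX := dot (wx t) (wx t).
  have k00 : 0 < k0 by rewrite divr_gt0// mulr_gt0.
  have k10 : 0 < k1 by rewrite divr_gt0// mulr_gt0.
  lra.
rewrite /lam' -mulrN; apply: le_trans (ler_wpM2l _ key); last by rewrite divr_ge0// ltW.
by rewrite mulrA divfK ?gt_eqF.
Qed.

Let X_sup t x : 0 <= t -> 0 <= x <= 1 -> w t x ^+ 2 <= 2 * X t.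
Proof.
move=> t0 x01; apply: le_trans (H1_sup (H1w t0) x01) _; rewrite /X.
by have := sqr_ge0 (w t 1); lra.
Qed.

Let lam_bound t : 0 <= t -> 0 <= lam t <= 2 / m * ((1 + rho p) * M).
Proof.
move=> t0; have [[wM _ _] _ _ zM _] := bound t0.
have m2 : 0 <= 2 / m by rewrite divr_ge0// ltW.
rewrite mulr_ge0//=; last by rewrite addr_ge0 ?mulr_ge0 ?dot_ge0// ltW.
by rewrite ler_wpM2l//; have := ler_wpM2l (ltW rho0) zM; lra.
Qed.

Let S := coef_bound p M.

Let S_ge : 36 * M <= S /\ 4 / m * ((1 + rho p) * M) <= S.
Proof.
have : 0 <= 4 / m * ((1 + rho p) * M).
  by rewrite mulr_ge0 ?divr_ge0 ?(ltW m0)// mulr_ge0// addr_ge0// ltW.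
by rewrite /S /coef_bound -/m; have := M0; split; lra.
Qed.

Let der_w0 : der0 (fun t => w t 0) (fun t => wt t 0).
Proof. by apply: WD_trace0 WDw WDwx H1w _ => t /ltW; exact: H1wt. Qed.

Let der_w1 : der0 (fun t => w t 1) (fun t => wt t 1).
Proof. by apply: WD_trace1 WDw WDwx H1w _ => t /ltW; exact: H1wt. Qed.

Let der_sqr (f df : R -> R) : der0 f df ->
  der0 (fun t => f t ^+ 2) (fun t => 2 * (f t * df t)).
Proof. by move=> H; apply: der0_eq (der0M H H) _ _ => t _; ring. Qed.

Let mul_le (a b : R) : a ^+ 2 <= 6 * M -> b ^+ 2 <= 6 * M -> `|a * b| <= 6 * M.
Proof.
move=> aM bM; rewrite ler_norml; have := sqr_ge0 (a - b); have := sqr_ge0 (a + b).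
by rewrite !expr2 in aM bM *; move=> *; apply/andP; split; lra.
Qed.

Lemma solution_energy_system : energy_system p S w wx wxx wt wtx z zx
  (fun t x => 2^-1 * w t x) (fun t x => 2^-1 * wx t x)
  (fun t x => w t x ^+ 2) (fun t x => 2 * (w t x * wt t x)) lam lam'.
Proof.
have [S1 S2] := S_ge; have hM := M0.
split => //.
- by move=> t /ltW; exact: H1wt.
- by move=> t t0; exact: H1Z (H1w t0).
- by exists Lip.
- by exists Lip.
- by exists Lip.
- by exists Lip.
- move=> t t0 phi phix Hphi; rewrite -(eq_H1 t0 Hphi); congr (_ + _ + _ + _ + _).
    by apply: eq_dot => // x _; field.
  by rewrite /bsum; congr (_ + _); ring.
- move=> t x t0 x01; have := w_sup t0 x01; have := sqr_ge0 (w t x).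
  by rewrite exprMn => *; apply/andP; split; lra.
- exact: der_sqr der_w0.
- exact: der_sqr der_w1.
- move=> t x /ltW t0 x01; rewrite normrM ger0_norm//.
  by have := mul_le (w_sup t0 x01) (wt_sup t0 x01); lra.
- move=> t t0; have [[_ wxM _] _ _ _ _] := bound t0.
  rewrite (dotZl _ (wx2 t0) (L2Z _ (wx2 t0))) (dotZr _ (wx2 t0) (wx2 t0)).
  by have := dot_ge0 (wx t); lra.
- move=> t /lam_bound/andP[-> h]; apply: le_trans h (le_trans _ S2).
  have : 0 <= 2 / m * ((1 + rho p) * M).
    by rewrite mulr_ge0 ?divr_ge0 ?(ltW m0)// mulr_ge0// addr_ge0// ltW.
  lra.
- move=> t x t0 x01; apply: le_trans (lam'_le t0); have := X_sup (ltW t0) x01.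
  by have := sqr_ge0 (w t x); rewrite exprMn; lra.
Qed.

(** With a = w(t + h) and b = w(t), the identities a a_x - b b_x = ((a + b) / 2 (a - b))_x and a^3 -
    b^3 = (a^2 + a b + b^2) (a - b) dictate s and q, and q - 3 s^2 = (a - b)^2 / 4. The sum of [lam]
    and its shift serves because s^2 <= (a^2 + b^2) / 2. *)
Lemma quotient_energy_system h : 0 < h ->
  energy_system p S
    (fun t x => h^-1 * (w (t + h) x - w t x)) (fun t x => h^-1 * (wx (t + h) x - wx t x))
    (fun t x => h^-1 * (wxx (t + h) x - wxx t x))
    (fun t x => h^-1 * (wt (t + h) x - wt t x)) (fun t x => h^-1 * (wtx (t + h) x - wtx t x))
    (fun t x => h^-1 * (z (t + h) x - z t x)) (fun t x => h^-1 * (zx (t + h) x - zx t x))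
    (fun t x => 2^-1 * (w (t + h) x + w t x)) (fun t x => 2^-1 * (wx (t + h) x + wx t x))
    (fun t x => w (t + h) x ^+ 2 + w (t + h) x * w t x + w t x ^+ 2)
    (fun t x => 2 * (w (t + h) x * wt (t + h) x)
      + (wt (t + h) x * w t x + w (t + h) x * wt t x) + 2 * (w t x * wt t x))
    (fun t => lam t + lam (t + h)) (fun t => lam' t + lam' (t + h)).
Proof.
move=> h0; have [S1 S2] := S_ge; have hM := M0; have hn := lt0r_neq0 h0.
have sh t : 0 <= t -> 0 <= t + h by move=> t0; rewrite addr_ge0// ltW.
have sh' t : 0 < t -> 0 < t + h by move=> t0; rewrite addr_gt0.
have derq f df : der0 f df -> der0 (fun t => f (t + h) ^+ 2 + f (t + h) * f t + f t ^+ 2)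
   (fun t => 2 * (f (t + h) * df (t + h)) + (df (t + h) * f t + f (t + h) * df t)
      + 2 * (f t * df t)).
  move=> H; have H' := der0_shift h0 H.
  exact: der0D (der0D (der_sqr H') (der0M H' H)) (der_sqr H).
split.
- by move=> t t0; exact: H1Z (H1B (H1w (sh _ t0)) (H1w t0)).
- move=> t t0; have t0' := sh _ t0; apply: weak_derivativeZ; first exact: L2B (wx2 t0') (wx2 t0).
  exact: weak_derivativeB (wx2 t0') (wx2 t0) (Hwxx t0') (Hwxx t0).
- by move=> t /ltW t0; exact: H1Z (H1B (H1wt (sh _ t0)) (H1wt t0)).
- move=> t t0; have t0' := sh _ t0; apply: weak_derivativeZ; first exact: L2B (z2 t0') (z2 t0).
  exact: weak_derivativeB (z2 t0') (z2 t0) (Hzx t0') (Hzx t0).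
- by move=> t t0; exact: H1Z (H1D (H1w (sh _ t0)) (H1w t0)).
- by eexists; exact: WD_quotient h0 WDw.
- by eexists; exact: WD_quotient h0 WDwx.
- eexists; have := WD_quotient h0 WDz; congr (WD _ _ _).
  by apply/funext => t; apply/funext => x; rewrite /zt; ring.
- eexists; have := WD_quotient h0 WDzx; congr (WD _ _ _).
  by apply/funext => t; apply/funext => x; ring.
- move=> t t0 phi phix Hphi; have t0' := ltW t0.
  have th := sh' _ t0; have th' := ltW th.
  have phi2 := H1_L2 Hphi; have phix2 := H1_dL2 Hphi.
  rewrite (dotZl _ (L2B (wt2 th') (wt2 t0')) phi2) (dotBl (wt2 th') (wt2 t0') phi2).
  rewrite (dotZl _ (L2B (wx2 th') (wx2 t0')) phi2) (dotBl (wx2 th') (wx2 t0') phi2).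
  rewrite (dotZl _ (L2B (wx2 th') (wx2 t0')) phix2) (dotBl (wx2 th') (wx2 t0') phix2).
  rewrite (dotZl _ (L2B (z2 th') (z2 t0')) phix2) (dotBl (z2 th') (z2 t0') phix2).
  have -> : dot (fun x => 2^-1 * (wx (t + h) x + wx t x) * (h^-1 * (w (t + h) x - w t x))
      + 2^-1 * (w (t + h) x + w t x) * (h^-1 * (wx (t + h) x - wx t x))) phi =
     h^-1 * (dot (fun x => w (t + h) x * wx (t + h) x) phi - dot (fun x => w t x * wx t x) phi).
    rewrite -(dotBl (wwx2 th') (wwx2 t0') phi2) -(dotZl _ (L2B (wwx2 th') (wwx2 t0')) phi2).
    by apply: eq_dot => // x _; field.
  have := eq_H1 th Hphi; have := eq_H1 t0 Hphi; rewrite /bsum.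
  set e1 := (X in X = 0) => E1; set e2 := (X in X = 0) => E2.
  rewrite [RHS](_ : 0 = h^-1 * (e2 - e1)); last by rewrite E1 E2 subrr mulr0.
  by rewrite /e1 /e2; ring.
- move=> t x t0 x01; have := w_sup t0 x01; have := w_sup (sh _ t0) x01.
  have := sqr_ge0 (w t x - w (t + h) x); have := sqr_ge0 (w t x + w (t + h) x).
  by rewrite exprMn !expr2 => *; apply/andP; split; lra.
- exact: derq der_w0.
- exact: derq der_w1.
- move=> t x /ltW t0 x01; have t0' := sh _ t0.
  have := mul_le (w_sup t0' x01) (wt_sup t0' x01).
  have := mul_le (wt_sup t0' x01) (w_sup t0 x01).
  have := mul_le (w_sup t0' x01) (wt_sup t0 x01).
  have := mul_le (w_sup t0 x01) (wt_sup t0 x01).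
  rewrite !ler_norml => /andP[? ?] /andP[? ?] /andP[? ?] /andP[? ?].
  by apply/andP; split; lra.
- move=> t t0; have t0' := sh _ t0.
  have [[_ wxM _] _ _ _ _] := bound t0; have [[_ wxM' _] _ _ _ _] := bound t0'.
  have sum2 := L2D (wx2 t0') (wx2 t0).
  rewrite (dotZl _ sum2 (L2Z _ sum2)) (dotZr _ sum2 sum2).
  by have := L2normD_sqr (wx2 t0') (wx2 t0); lra.
- exact: der0D der_lam (der0_shift h0 der_lam).
- move=> t t0; have /andP[a b] := lam_bound t0; have /andP[a' b'] := lam_bound (sh _ t0).
  by apply/andP; split; lra.
- move=> t x t0 x01; have := lam'_le t0; have := lam'_le (sh' _ t0).
  have := X_sup (ltW t0) x01; have := X_sup (ltW (sh' _ t0)) x01.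
  have := sqr_ge0 (w t x - w (t + h) x); have := sqr_ge0 (w t x); have := sqr_ge0 (w (t + h) x).
  by rewrite exprMn !expr2; lra.
Qed.

(** * From the energies to the norms of the solution *)

Context (alpha c C : R).
Context (HE : forall u ux uxx ut utx z zx s sx q q' lam lam',
  energy_system p S u ux uxx ut utx z zx s sx q q' lam lam' ->
  energy_decay alpha c C u ux uxx ut z zx).

Let N := decay_bound p M C.
Let e t := expR (2 * alpha * t).
Let h n : R := n.+1%:R^-1.
Let h0 n : 0 < h n. Proof. by rewrite invr_gt0. Qed.

Let e0 t : 0 < e t. Proof. exact: expR_gt0. Qed.

Let M_le : `|C| * M <= N /\ `|C| * (4 * Lip ^+ 2) <= N.
Proof.
have a := mulr_ge0 (normr_ge0 C) M0.
have b := mulr_ge0 (normr_ge0 C) (sqr_ge0 Lip).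
by rewrite /N /decay_bound -/Lip; split; lra.
Qed.

Let decay_mono (Phi dPhi : R -> R) (a : R -> R) t : der0 Phi dPhi ->
  (forall s, 0 < s -> c * (e s * a s) <= - dPhi s) -> 0 < c ->
  (forall s, 0 <= a s) -> 0 <= t -> Phi t <= Phi 0.
Proof.
move=> Hd Ha cp a0 t0; apply: (der0_nonincreasing Hd); last by rewrite lexx.
move=> s s0; rewrite -oppr_ge0; apply: le_trans (Ha s s0).
exact: mulr_ge0 (ltW cp) (mulr_ge0 (ltW (e0 s)) (a0 s)).
Qed.

Let D t := dot (w t) (w t) + dot (wx t) (wx t) + dot (z t) (z t) + dot (zx t) (zx t).
Let DD t := dot (w t) (w t) + dot (wx t) (wx t) + dot (wxx t) (wxx t) + dot (z t) (z t)
  + dot (zx t) (zx t) + dot (wt t) (wt t).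

Let D0 t : 0 <= D t.
Proof.
rewrite /D; have := dot_ge0 (w t); have := dot_ge0 (wx t).
by have := dot_ge0 (z t); have := dot_ge0 (zx t); lra.
Qed.

Let DD0 t : 0 <= DD t.
Proof.
have := D0 t; rewrite /D /DD; have := dot_ge0 (wxx t).
by have := dot_ge0 (wt t); lra.
Qed.

Let solution_decay : exists Phi dPhi, [/\ [/\ 0 < c, der0 Phi dPhi &
    forall t, 0 <= t -> 0 <= Phi t],
  forall t, 0 < t -> c * (e t * DD t) <= - dPhi t, Phi 0 <= `|C| * M,
  forall t, 0 <= t -> c * (e t * D t) <= `|C| * M &
  forall t, 0 < t -> c * dot (wxx t) (wxx t) <=
    dot (wt t) (wt t) + dot (w t) (w t) + dot (wx t) (wx t) + dot (zx t) (zx t)].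
Proof.
have [Phi [dPhi [[cp Hd lo hi ini] xx]]] := HE solution_energy_system.
have iniM : Phi 0 <= `|C| * M.
  apply: le_trans ini _; have a := bound_all (lexx 0).
  (* z vanishes initially, so (A2) controls all of D(0). The sign of C is not recorded in
     [energy_decay], hence the absolute value. *)
  have zx0 : dot (zx 0) (zx 0) = 0 by rewrite /zx ltxx; exact: dot0l.
  rewrite zx0 addr0; apply: le_trans (ler_wpM2r _ (ler_norm C)) _.
    by have := D0 0; rewrite /D zx0 addr0.
  apply: ler_wpM2l => //; have := dot_ge0 (wxx 0); have := dot_ge0 (wt 0); have := dot_ge0 (wtx 0).
  lra.
exists Phi, dPhi; split=> //.
  by split=> // t t0; apply: le_trans (lo t t0); exact: mulr_ge0 (ltW cp) (mulr_ge0 (ltW (e0 t)) (D0 t)).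
move=> t t0; apply: le_trans (lo t t0) (le_trans _ iniM).
exact: decay_mono Hd hi cp DD0 t0.
Qed.

Let Q (v : R -> R -> R) n t x := (h n)^-1 * (v (t + h n) x - v t x).

Let QD (v v' : R -> R -> R) n : WD Lip v v' -> dot (Q v n 0) (Q v n 0) <= Lip ^+ 2.
Proof.
move=> Hv; have := WD_quotient_le (h0 n) Hv (lexx 0); rewrite -/(Q v n 0).
by move=> H; rewrite -L2norm_sqr ler_sqr ?nnegrE ?L2norm_ge0.
Qed.

(** The initial bound is uniform in n, because each of the four norms of a quotient at time 0 is at
    most the Lipschitz constant. *)
Let quotient_decay n : exists Phi dPhi, [/\ [/\ 0 < c, der0 Phi dPhi &
    forall t, 0 <= t -> 0 <= Phi t],
  forall t, 0 < t -> c * (e t * (dot (Q w n t) (Q w n t) + dot (Q wx n t) (Q wx n t)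
    + dot (Q wxx n t) (Q wxx n t))) <= - dPhi t,
  Phi 0 <= `|C| * (4 * Lip ^+ 2) &
  forall t, 0 <= t -> c * (e t * (dot (Q w n t) (Q w n t) + dot (Q wx n t) (Q wx n t)))
    <= `|C| * (4 * Lip ^+ 2)].
Proof.
have [Phi [dPhi [[cp Hd lo hi ini] _]]] := HE (quotient_energy_system (h0 n)).
rewrite -/(Q w n 0) -/(Q wx n 0) -/(Q z n 0) -/(Q zx n 0) in ini.
have iniM : Phi 0 <= `|C| * (4 * Lip ^+ 2).
  have q1 := QD n WDw; have q2 := QD n WDwx; have q3 := QD n WDz; have q4 := QD n WDzx.
  apply: le_trans ini _; apply: le_trans (ler_wpM2r _ (ler_norm C)) _.
    have := dot_ge0 (Q w n 0); have := dot_ge0 (Q wx n 0); have := dot_ge0 (Q z n 0).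
    by have := dot_ge0 (Q zx n 0); lra.
  by apply: ler_wpM2l => //; lra.
have hi' t : 0 < t -> c * (e t * (dot (Q w n t) (Q w n t) + dot (Q wx n t) (Q wx n t)
    + dot (Q wxx n t) (Q wxx n t))) <= - dPhi t.
  move=> t0; apply: le_trans (hi t t0); apply: ler_wpM2l; first exact: ltW.
  apply: ler_wpM2l; first exact: ltW.
  rewrite -/(Q w n t) -/(Q wx n t) -/(Q wxx n t) -/(Q z n t) -/(Q zx n t) -/(Q wt n t).
  by have := dot_ge0 (Q z n t); have := dot_ge0 (Q zx n t); have := dot_ge0 (Q wt n t); lra.
have lo' t : 0 <= t -> c * (e t * (dot (Q w n t) (Q w n t) + dot (Q wx n t) (Q wx n t))) <= Phi t.
  move=> t0; apply: le_trans (lo t t0); apply: ler_wpM2l; first exact: ltW.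
  apply: ler_wpM2l; first exact: ltW.
  rewrite -/(Q w n t) -/(Q wx n t) -/(Q z n t) -/(Q zx n t).
  by have := dot_ge0 (Q z n t); have := dot_ge0 (Q zx n t); lra.
have pos2 t : 0 <= dot (Q w n t) (Q w n t) + dot (Q wx n t) (Q wx n t).
  by have := dot_ge0 (Q w n t); have := dot_ge0 (Q wx n t); lra.
exists Phi, dPhi; split=> //.
  split=> // t t0; apply: le_trans (lo' t t0).
  exact: mulr_ge0 (ltW cp) (mulr_ge0 (ltW (e0 t)) (pos2 t)).
move=> t t0; apply: le_trans (lo' t t0) (le_trans _ iniM).
apply: decay_mono Hd hi' cp _ t0 => s.
by have := pos2 s; have := dot_ge0 (Q wxx n s); lra.
Qed.

Let Q_L2 v v' n t : WD Lip v v' -> 0 < t -> L2 (Q v n t).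
Proof.
move=> Hv t0; apply: L2Z; apply: L2B; apply: (WD_L2 Hv); last exact: ltW.
by rewrite addr_ge0// ltW.
Qed.

(** Weak lower semicontinuity by duality: with [wt t] and [wtx t] as dual elements, [dot_dual_le]
    gives lower bounds of the quotient energies that converge to the energy of the limit. *)
Let wt_decay t : 0 < t ->
  c * (e t * (dot (wt t) (wt t) + dot (wtx t) (wtx t))) <= `|C| * (4 * Lip ^+ 2).
Proof.
move=> t0; have t0' := ltW t0; have wt2' := wt2 t0'; have wtx2' := wtx2 t0'.
have cp : 0 < c by have [? [? [[]]]] := solution_decay.
pose y n := c * (e t * ((2 * dot (Q w n t) (wt t) - dot (wt t) (wt t))
  + (2 * dot (Q wx n t) (wtx t) - dot (wtx t) (wtx t)))).
have yc : y n @[n --> \oo] --> c * (e t * (dot (wt t) (wt t) + dot (wtx t) (wtx t))).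
  rewrite [X in _ --> X](_ : _ = c * (e t * ((2 * dot (wt t) (wt t) - dot (wt t) (wt t))
    + (2 * dot (wtx t) (wtx t) - dot (wtx t) (wtx t))))); last by ring.
  apply: cvgM; first exact: cvg_cst.
  apply: cvgM; first exact: cvg_cst.
  apply: cvgD; (apply: cvgB; last exact: cvg_cst); (apply: cvgM; first exact: cvg_cst).
    exact: WD_quotient_cvg WDw t0 wt2'.
  exact: WD_quotient_cvg WDwx t0 wtx2'.
apply: ler_cvg_to yc (cvg_cst _) _; apply: nearW => n.
have [Phi [dPhi [_ _ _ /(_ t t0')]]] := quotient_decay n; apply: le_trans.
apply: ler_wpM2l; first exact: ltW.
apply: ler_wpM2l; first exact: ltW.
apply: lerD; [exact: dot_dual_le (Q_L2 n WDw t0) wt2'|exact: dot_dual_le (Q_L2 n WDwx t0) wtx2'].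
Qed.

Let c_gt0 : 0 < c. Proof. by have [? [? [[]]]] := solution_decay. Qed.

(** The norms in [D] and those of wt and wtx contribute c^-1 N each, and wxx is recovered from wt
    and [D] at the cost of c^-1 times both. *)
Lemma solution_pointwise_decay t : 0 < t ->
  Hnorm 2 (w t) ^+ 2 + Hnorm 1 (wt t) ^+ 2 + L2norm (z t) ^+ 2
    <= (2 + 2 * c^-1) * c^-1 * decay_bound p M C * expR (- 2 * alpha * t).
Proof.
move=> t0; have t0' := ltW t0; rewrite -/N.
have [Phi [dPhi [_ _ _ /(_ t t0') H1 /(_ t t0) H2]]] := solution_decay.
have H3 := wt_decay t0; have [N1 N2] := M_le.
rewrite Hnorm2_sqr Hnorm1_sqr L2norm_sqr -wxxE -wxE -wtxE.
have ci : 0 < c^-1 by rewrite invr_gt0.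
have ce : 0 < c * e t by rewrite mulr_gt0.
have eE : expR (- 2 * alpha * t) = (e t)^-1 by rewrite /e -expRN; congr expR; ring.
have scale (a : R) : c * (e t * a) <= N -> a <= c^-1 * N * expR (- 2 * alpha * t).
  move=> H; rewrite eE; have -> : a = c^-1 * (c * (e t * a)) * (e t)^-1.
    by field; rewrite !gt_eqF.
  by rewrite ler_wpM2r ?invr_ge0 ?(ltW (e0 t))// ler_wpM2l// ltW.
have K1 := scale (D t) (le_trans H1 N1).
have K2 := scale _ (le_trans H3 N2).
have K3 : dot (wxx t) (wxx t) <= c^-1 * (dot (wt t) (wt t) + D t).
  rewrite -(ler_pM2l c_gt0) mulrA mulfV ?gt_eqF// mul1r; apply: le_trans H2 _.
  by rewrite /D; have := dot_ge0 (z t); lra.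
have K4 : c^-1 * (dot (wt t) (wt t) + D t) <= c^-1 * (2 * (c^-1 * N * expR (- 2 * alpha * t))).
  by apply: ler_wpM2l; [exact: ltW|have := dot_ge0 (wtx t); lra].
rewrite (_ : (2 + 2 * c^-1) * c^-1 * N * expR (- 2 * alpha * t) =
  2 * (c^-1 * N * expR (- 2 * alpha * t)) + c^-1 * (2 * (c^-1 * N * expR (- 2 * alpha * t)))); last by ring.
by have := dot_ge0 (zx t); rewrite /D in K1 *; lra.
Qed.

Let wtxx t := wderiv (wderiv (wt t)).

(** The quotients of wxx are known to converge only against test functions, where a derivative moves
    to psi; this costs an approximation error of d / 2, and convergence the other half. *)
Let quotient_liminf t (d : R) : 0 < t -> 0 < d -> \forall n \near \oo,
  c * (e t * (dot (wt t) (wt t) + dot (wtx t) (wtx t) + dot (wtxx t) (wtxx t))) - d <=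
  c * (e t * (dot (Q w n t) (Q w n t) + dot (Q wx n t) (Q wx n t) + dot (Q wxx n t) (Q wxx n t))).
Proof.
move=> t0 d0; have t0' := ltW t0; have wt2' := wt2 t0'; have wtx2' := wtx2 t0'.
have ce : 0 < c * e t by rewrite mulr_gt0.
have d2 : 0 < d / 2 / (c * e t) by rewrite !divr_gt0.
have wtxx2 : L2 (wtxx t).
  by rewrite /wtxx; have [[]|->] := wderiv_default (wderiv (wt t)) => //; exact: L2_cst.
have [psi [psi2 Hpsi psic]] : exists psi, [/\ L2 psi,
    dot (wtxx t) (wtxx t) - d / 2 / (c * e t) <= 2 * dot (wtxx t) psi - dot psi psi &
    dot (Q wxx n t) psi @[n --> \oo] --> dot (wtxx t) psi].
  (* If [wtx t] has no weak derivative, [wtxx t] is the default 0 and psi = 0 serves. *)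
  have [H|H] := wderiv_default (wderiv (wt t)); last first.
    exists (fun=> 0); split; first exact: L2_cst.
      rewrite {1 2 3}/wtxx H !dot0l// mulr0 subrr; lra.
    rewrite dotC dot0l//; under eq_fun do rewrite dotC dot0l//; exact: cvg_cst.
  have [psi psit Hpsi] := dot_dual_approx wtxx2 d2.
  exists psi; split=> //; first exact: test_function_L2.
  have dpsi2 := test_function_dL2 psit.
  have -> : dot (wtxx t) psi = - dot (wtx t) (derive1 psi).
    by rewrite wtxE; have [_ ->] := H; rewrite // opprK.
  have E n : dot (Q wxx n t) psi = - dot (Q wx n t) (derive1 psi).
    have th : 0 <= t + h n by rewrite addr_ge0// ltW.
    have [_ ->] : weak_derivative (Q wx n t) (Q wxx n t) => //; last by rewrite opprK.
    apply: weak_derivativeZ; first exact: L2B (wx2 th) (wx2 t0').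
    exact: weak_derivativeB (wx2 th) (wx2 t0') (Hwxx th) (Hwxx t0').
  under eq_fun do rewrite E; apply: cvgN; exact: WD_quotient_cvg WDwx t0 dpsi2.
pose y n := c * (e t * ((2 * dot (Q w n t) (wt t) - dot (wt t) (wt t))
  + (2 * dot (Q wx n t) (wtx t) - dot (wtx t) (wtx t))
  + (2 * dot (Q wxx n t) psi - dot psi psi))).
pose l := c * (e t * (dot (wt t) (wt t) + dot (wtx t) (wtx t) + (2 * dot (wtxx t) psi - dot psi psi))).
have yc : y n @[n --> \oo] --> l.
  rewrite [X in _ --> X](_ : _ = c * (e t * ((2 * dot (wt t) (wt t) - dot (wt t) (wt t))
    + (2 * dot (wtx t) (wtx t) - dot (wtx t) (wtx t)) + (2 * dot (wtxx t) psi - dot psi psi)))); last first.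
    by rewrite /l; ring.
  apply: cvgM; first exact: cvg_cst.
  apply: cvgM; first exact: cvg_cst.
  apply: cvgD; first apply: cvgD; (apply: cvgB; last exact: cvg_cst);
    (apply: cvgM; first exact: cvg_cst) => //.
    exact: WD_quotient_cvg WDw t0 wt2'.
  exact: WD_quotient_cvg WDwx t0 wtx2'.
have dh : 0 < d / 2 by rewrite divr_gt0.
have /cvgrPdist_le/(_ _ dh) yl := yc.
near=> n.
have ny : `|l - y n| <= d / 2 by near: n; exact: yl.
have ly : l - d / 2 <= y n by move: ny; rewrite ler_distl => /andP[_]; lra.
have th : 0 <= t + h n by rewrite addr_ge0// ltW.
have Qxx2 : L2 (Q wxx n t) by exact: L2Z _ (L2B (wxx2 th) (wxx2 t0')).
have yQ : y n <= c * (e t * (dot (Q w n t) (Q w n t) + dot (Q wx n t) (Q wx n t)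
    + dot (Q wxx n t) (Q wxx n t))).
  apply: ler_wpM2l; first exact: ltW.
  apply: ler_wpM2l; first exact: ltW.
  apply: lerD; last exact: dot_dual_le Qxx2 psi2.
  apply: lerD; [exact: dot_dual_le (Q_L2 n WDw t0) wt2'|exact: dot_dual_le (Q_L2 n WDwx t0) wtx2'].
apply: le_trans (le_trans ly yQ).
have := ler_wpM2l (ltW ce) Hpsi; rewrite mulrBr [X in _ - X]mulrC divfK ?gt_eqF// -!mulrA.
rewrite /l !mulrDr; lra.
Unshelve. all: by end_near. Qed.

(** One statement for both integrals of the theorem. The norms of w and z are bounded by -dPhi of
    the solution, those of wt by the lower limit of -dPhi of the quotients. *)
Lemma solution_integral_decay (f : R -> R) (A t : R) : 0 < t -> 0 <= A ->
  (forall s, 0 <= s -> 0 <= f s) ->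
  (forall s, 0 < s -> f s <= A * (expR (2 * alpha * s) *
     (Hnorm 2 (w s) ^+ 2 + Hnorm 2 (wt s) ^+ 2 + L2norm (z s) ^+ 2))) ->
  (\int[@lebesgue_measure R]_(s in `[0%R, t]) (f s)%:E <= (A * c^-1 * (2 * decay_bound p M C))%:E)%E.
Proof.
rewrite -/N.
move=> t0 A0 f0 fA.
have [Phi [dPhi [[_ Hd Phi0] hi ini _ _]]] := solution_decay.
have [N1 N2] := M_le.
have /choice[Phin /choice[dPhin Hn]] := quotient_decay.
pose g n s := - dPhi s + - dPhin n s.
have Ac : 0 <= A * c^-1 by rewrite mulr_ge0// invr_ge0 ltW.
have d_le s : 0 < s -> dPhi s <= 0.
  move=> s0; rewrite -oppr_ge0; apply: le_trans (hi s s0).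
  exact: mulr_ge0 (ltW c_gt0) (mulr_ge0 (ltW (e0 s)) (DD0 s)).
have dn_le n s : 0 < s -> dPhin n s <= 0.
  move=> s0; have [_ /(_ s s0) H _ _] := Hn n; rewrite -oppr_ge0; apply: le_trans H.
  apply: mulr_ge0 (ltW c_gt0) (mulr_ge0 (ltW (e0 s)) _).
  by have := dot_ge0 (Q w n s); have := dot_ge0 (Q wx n s); have := dot_ge0 (Q wxx n s); lra.
have [mP iP] := der0_integral Hd Phi0 d_le t0.
have gpos n s : 0 < s -> 0 <= g n s.
  by move=> s0; have := d_le s s0; have := dn_le n s s0; rewrite /g; lra.
apply: (@integral_le_liminf _ f (fun n s => A * c^-1 * g n s)) => //.
- move=> n; have [[_ Hdn Phin0] _ _ _] := Hn n.
  have [mPn _] := der0_integral Hdn Phin0 (dn_le n) t0.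
  by apply: measurable_funM => //; exact: measurable_funD.
- by move=> n s s0; exact: mulr_ge0 Ac (gpos n s s0).
- move=> n; have [[_ Hdn Phin0] _ inin _] := Hn n.
  have [mPn iPn] := der0_integral Hdn Phin0 (dn_le n) t0.
  under eq_integral do rewrite EFinM.
  rewrite ge0_integralZl_EFin//; last 2 first.
  + by move=> s; rewrite /= in_itv/= lee_fin => /andP[s0 _]; exact: gpos.
  + by apply/measurable_EFinP; exact: measurable_funD.
  rewrite [leRHS]EFinM; apply: lee_wpmul2l; first by rewrite lee_fin.
  under eq_integral do rewrite /g EFinD.
  rewrite ge0_integralD//; last 4 first.
  + by move=> s; rewrite /= in_itv/= lee_fin oppr_ge0 => /andP[s0 _]; exact: d_le.
  + exact/measurable_EFinP.
  + by move=> s; rewrite /= in_itv/= lee_fin oppr_ge0 => /andP[s0 _]; exact: dn_le.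
  + exact/measurable_EFinP.
  apply: le_trans (leeD iP iPn) _; rewrite -EFinD lee_fin.
  by have := le_trans ini N1; have := le_trans inin N2; lra.
- move=> s s0 d d0.
  (* A may be 0, hence the added 1. *)
  have dA : 0 < d / (A * c^-1 + 1) by rewrite divr_gt0// ltr_wpDl.
  have := quotient_liminf s0 dA; apply: filterS => n Hq.
  have [_ /(_ s s0) Hqn _ _] := Hn n.
  apply: (@le_trans _ _ (A * c^-1 * (c * (e s * (Hnorm 2 (w s) ^+ 2 + Hnorm 2 (wt s) ^+ 2
    + L2norm (z s) ^+ 2)) - d / (A * c^-1 + 1)))).
    rewrite mulrBr lerB//; last first.
      by rewrite mulrCA ger_pMr// ler_pdivrMr ?ltr_wpDl// mul1r lerDl.
    by rewrite -mulrA mulKf ?gt_eqF//; exact: fA.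
  apply: ler_wpM2l => //.
  have H1 := hi s s0; have H2 := le_trans Hq Hqn.
  rewrite Hnorm2_sqr Hnorm2_sqr L2norm_sqr -wxxE -wxE -/(wtxx s).
  rewrite -wtxE addrAC mulrDr mulrDr -addrA; apply: lerD H2.
  apply: le_trans H1; apply: ler_wpM2l; first exact: ltW.
  apply: ler_wpM2l; first exact: ltW.
  by rewrite /DD; have := dot_ge0 (zx s); have := dot_ge0 (wt s); lra.
Qed.

End Solution.

(** * Boundary energies and the final estimate *)

Section BoundaryEnergies.
Context {R : realType} (p : params R) (hp : admissible_params p).
Implicit Types (f : R -> R) (a b k x M : R).

Lemma trace_sqr_le f x : sobolev 1 f -> cont01 f -> 0 <= x <= 1 ->
  f x ^+ 2 <= 6 * Hnorm 1 f ^+ 2.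
Proof.
move=> sf cf x01; apply: (@H1_sup_norm _ f (wderiv f)) => //; last by rewrite Hnorm1_sqr.
by split=> //; exact: sobolev1_wderiv.
Qed.

Lemma Hnorm12_sqr f : Hnorm 1 f ^+ 2 <= Hnorm 2 f ^+ 2.
Proof. by rewrite Hnorm1_sqr Hnorm2_sqr lerDl dot_ge0. Qed.

Lemma bsum_le (F : R -> R -> R) (G : R -> R) : (forall c x, 0 < c -> 0 <= x <= 1 -> F c x <= G c) ->
  bsum p F <= G (c0 p) + G (c1 p).
Proof.
case: hp => _ [c00 c10 _] FG.
by apply: lerD; apply: FG; rewrite ?lexx ?ler01.
Qed.

(* E, E_1 and E_2 are the instances k = 1/9 (with u = v), 4/3 and 2/3. *)
Lemma boundary_energy_le (u v : R -> R) (k M P : R) : 0 <= k ->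
  (forall x, 0 <= x <= 1 -> u x ^+ 2 <= 6 * P) ->
  (forall x, 0 <= x <= 1 -> v x ^+ 2 <= 6 * M) ->
  bsum p (fun c i => (c + wd p) * u i ^+ 2 + k / c * (u i ^+ 2 * v i ^+ 2))
    <= ((c0 p + wd p + k / c0 p * (6 * M)) + (c1 p + wd p + k / c1 p * (6 * M))) * 6 * P.
Proof.
move=> k0 uP vM; have [_ [c00 c10 wd0]] := hp.
apply: le_trans (bsum_le (G := fun c => (c + wd p + k / c * (6 * M)) * (6 * P)) _) _; last first.
  by rewrite le_eqVlt; apply/orP; left; apply/eqP; ring.
move=> c x cp x01; rewrite [leRHS]mulrDl; apply: lerD.
  by rewrite ler_wpM2l ?uP// addr_ge0// ltW.
rewrite -[leRHS]mulrA; apply: ler_wpM2l; first by rewrite divr_ge0// ltW.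
rewrite [u x ^+ 2 * _]mulrC.
apply: (@le_trans _ _ (6 * M * u x ^+ 2)); first by rewrite ler_wpM2r ?sqr_ge0// vM.
by rewrite ler_wpM2l ?uP//; exact: le_trans (sqr_ge0 _) (vM _ x01).
Qed.

Lemma bsum_ge0 (F : R -> R -> R) : (forall c x, 0 < c -> 0 <= F c x) -> 0 <= bsum p F.
Proof. by case: hp => _ [c00 c10 _] H; rewrite addr_ge0 ?H. Qed.

Definition boundary_const k M : R :=
  ((c0 p + wd p + k / c0 p * (6 * M)) + (c1 p + wd p + k / c1 p * (6 * M))) * 6.

Lemma boundary_const_ge0 k M : 0 <= k -> 0 <= M -> 0 <= boundary_const k M.
Proof.
case: hp => _ [c00 c10 wd0] k0 M0; have := ltW c00; have := ltW c10 => d1 d0.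
have h0 : 0 <= k / c0 p * (6 * M) by rewrite mulr_ge0// ?mulr_ge0// invr_ge0.
have h1 : 0 <= k / c1 p * (6 * M) by rewrite mulr_ge0// ?mulr_ge0// invr_ge0.
by rewrite /boundary_const; lra.
Qed.

(** The constant depends on w0 only through r. As M = K r^2 and [lipschitz_bound] is a multiple of
    sqrt M, [decay_bound] contains the factor r^2 of the right-hand side; the other occurrences of M
    go into C. *)
Lemma decay_of_norm (alpha K r : R) : 0 <= alpha -> 0 < beta p alpha -> 0 < K ->
  exists C : R, 0 < C /\
  forall (w0 : R -> R) (w wt z : R -> R -> R), Hnorm 3 w0 = r ->
    (forall t : R, 0 <= t -> cont01 (wt t) /\ cont01 (z t)) ->
    assumption_A2 p K w0 w wt z ->
    forall t : R, 0 < t ->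
    ((Hnorm 2 (w t) ^+ 2 + Hnorm 1 (wt t) ^+ 2 + L2norm (z t) ^+ 2
       + E p w t + E2 p w wt t)%:E
     + (expR (- 2 * alpha * t))%:E *
         \int[@lebesgue_measure R]_(s in `[0%R, t])
           (expR (2 * alpha * s) *
             (tnorm (w s) ^+ 2 + Hnorm 2 (wt s) ^+ 2 + Hnorm 2 (w s) ^+ 2))%:E
     + (expR (- 2 * alpha * t))%:E *
         \int[@lebesgue_measure R]_(s in `[0%R, t])
           (expR (2 * alpha * s) *
             (L2norm (z s) ^+ 2 + E1 p w wt s + w s 1 ^+ 4 + w s 0 ^+ 4))%:E
     <= (C * expR (- 2 * alpha * t) * r ^+ 2)%:E)%E.
Proof.
move=> alpha0 beta0 K0; pose M := K * r ^+ 2.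
have M0 : 0 <= M by rewrite mulr_ge0 ?sqr_ge0// ltW.
have [c [C HE]] := energy_estimate (coef_bound p M) hp alpha0 beta0.
pose B := (1 + delta p) * (1 + (rho p)^-1 * (1 + wd p + 3 * Num.sqrt M + nu p)).
have NE : decay_bound p M C = `|C| * K * (1 + 4 * B ^+ 2) * r ^+ 2.
  by rewrite /decay_bound /lipschitz_bound -/B [(B * _) ^+ 2]exprMn sqr_sqrtr// /M; ring.
pose kE := boundary_const (1 / 9) M.
pose kE1 := boundary_const (4 / 3) M.
pose kE2 := boundary_const (2 / 3) M.
have kE0 : 0 <= kE by apply: boundary_const_ge0 => //; lra.
have kE10 : 0 <= kE1 by apply: boundary_const_ge0 => //; lra.
have kE20 : 0 <= kE2 by apply: boundary_const_ge0 => //; lra.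
(* 1 for z, kE1 for [E1], and 36 M for each of the two fourth powers. *)
pose A2 := 1 + kE1 + 72 * M.
have A20 : 0 <= A2 by rewrite /A2; lra.
pose T := (1 + kE + kE2) * ((2 + 2 * c^-1) * c^-1) + 14 * c^-1 * 2 + A2 * c^-1 * 2.
exists (1 + `|T * (`|C| * K * (1 + 4 * B ^+ 2))|); split.
  exact: ltr_pwDl ltr01 (normr_ge0 _).
move=> w0 w wt z w0r Hcont HA t t0; have WS := A2_solution HA.
have Hw := A2_w HA; have Hwt := A2_wt HA.
have HM s : 0 <= s -> Hnorm 2 (w s) ^+ 2 + Hnorm 1 (wt s) ^+ 2 + L2norm (z s) ^+ 2 <= M.
  move=> s0; rewrite -lee_fin /M -w0r; apply: le_trans (A2_bound HA s0).
  apply: leeDl; apply: integral_ge0 => y _; rewrite lee_fin.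
  by apply: addr_ge0; last exact: sqr_ge0; apply: addr_ge0; exact: sqr_ge0.
have wxE : forall s, wderiv (w s) = wderiv (w s) by [].
have wxxE : forall s, wderiv (wderiv (w s)) = wderiv (wderiv (w s)) by [].
have wtxE : forall s, wderiv (wt s) = wderiv (wt s) by [].
have Hpt := solution_pointwise_decay hp WS Hcont Hw Hwt HM wxE wxxE wtxE HE t0.
have Hint := fun f A => solution_integral_decay hp WS Hcont Hw Hwt HM wxE wxxE wtxE HE (f := f) (A := A) t0.
have wx s x : 0 <= s -> 0 <= x <= 1 -> w s x ^+ 2 <= 6 * Hnorm 1 (w s) ^+ 2.
  by move=> s0; apply: trace_sqr_le; [exact: (ws_w WS s0).1|exact: (ws_w WS s0).2].
have wtx s x : 0 <= s -> 0 <= x <= 1 -> wt s x ^+ 2 <= 6 * Hnorm 1 (wt s) ^+ 2.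
  by move=> s0; apply: trace_sqr_le; [exact: Hwt|exact: (Hcont s s0).1].
have w12 s := Hnorm12_sqr (w s); have wt12 s := Hnorm12_sqr (wt s).
have w2_0 s := sqr_ge0 (Hnorm 2 (w s)); have wt1_0 s := sqr_ge0 (Hnorm 1 (wt s)).
have z_0 s := sqr_ge0 (L2norm (z s)).
have w1_0 s := sqr_ge0 (Hnorm 1 (w s)).
have wM s x : 0 <= s -> 0 <= x <= 1 -> w s x ^+ 2 <= 6 * M.
  move=> s0 x01; apply: le_trans (wx _ _ s0 x01) (ler_wpM2l (ler0n _ 6) (le_trans (w12 s) _)).
  apply: le_trans (HM s s0); rewrite -addrA lerDl; exact: addr_ge0 (wt1_0 s) (z_0 s).
pose P s := Hnorm 2 (w s) ^+ 2 + Hnorm 2 (wt s) ^+ 2 + L2norm (z s) ^+ 2.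
have sqr4 (y : R) : y ^+ 4 = y ^+ 2 * y ^+ 2 by rewrite -exprD.
have E_le s : 0 <= s -> E p w s <= kE * Hnorm 2 (w s) ^+ 2.
  move=> s0; rewrite /kE /boundary_const.
  rewrite (_ : E p w s = bsum p (fun c i => (c + wd p) * w s i ^+ 2
      + (1 / 9) / c * (w s i ^+ 2 * w s i ^+ 2))).
    apply: boundary_energy_le => [|x x01|x x01]; [lra| |exact: wM].
    exact: le_trans (wx _ _ s0 x01) (ler_wpM2l (ler0n _ 6) (w12 s)).
  rewrite /E /bsum !sqr4; congr (_ + _ * _ + (_ + _ * _)); rewrite invfM mulrA//.
have E2_le s : 0 <= s -> E2 p w wt s <= kE2 * Hnorm 1 (wt s) ^+ 2.
  move=> s0; rewrite /kE2 /boundary_const.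
  rewrite (_ : E2 p w wt s = bsum p (fun c i => (c + wd p) * wt s i ^+ 2
      + (2 / 3) / c * (wt s i ^+ 2 * w s i ^+ 2))).
    apply: boundary_energy_le => [|x x01|x x01]; [lra|exact: wtx|exact: wM].
  by rewrite /E2 /bsum; congr (_ + _ * _ + (_ + _ * _)); rewrite invfM mulrA.
have E1_le s : 0 <= s -> E1 p w wt s <= kE1 * Hnorm 2 (wt s) ^+ 2.
  move=> s0; rewrite /kE1 /boundary_const.
  rewrite (_ : E1 p w wt s = bsum p (fun c i => (c + wd p) * wt s i ^+ 2
      + (4 / 3) / c * (wt s i ^+ 2 * w s i ^+ 2))).
    apply: boundary_energy_le => [|x x01|x x01]; [lra| |exact: wM].
    exact: le_trans (wtx _ _ s0 x01) (ler_wpM2l (ler0n _ 6) (wt12 s)).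
  by rewrite /E1 /bsum; congr (_ + _ * _ + (_ + _ * _)); rewrite invfM mulrA.
have E1_ge s : 0 <= E1 p w wt s.
  have [_ [_ _ wd0]] := hp.
  apply: bsum_ge0 => c' x c'0; rewrite addr_ge0// mulr_ge0 ?sqr_ge0 ?addr_ge0 ?(ltW c'0)//.
    by rewrite divr_ge0// mulr_ge0// ltW.
  by rewrite mulr_ge0 ?sqr_ge0.
have w4_le s x : 0 <= s -> 0 <= x <= 1 -> w s x ^+ 4 <= 36 * M * Hnorm 2 (w s) ^+ 2.
  move=> s0 x01; rewrite sqr4.
  rewrite (_ : 36 * M * Hnorm 2 (w s) ^+ 2 = 6 * M * (6 * Hnorm 2 (w s) ^+ 2)); last by ring.
  apply: ler_pM; rewrite ?sqr_ge0//; first exact: wM.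
  exact: le_trans (wx _ _ s0 x01) (ler_wpM2l (ler0n _ 6) (w12 s)).
have z01 : 0 <= (0 : R) <= 1 by rewrite lexx ler01.
have o01 : 0 <= (1 : R) <= 1 by rewrite lexx ler01.
set ex := expR (- 2 * alpha * t); have ex0 : 0 <= ex by exact: expR_ge0.
(* 14 is 13 for [tnorm], namely 1 for the derivative and 6 for each endpoint value, plus 1 for the
   H^2 norm of w. *)
have I1 : (\int[@lebesgue_measure R]_(s in `[0%R, t]) (expR (2 * alpha * s) *
    (tnorm (w s) ^+ 2 + Hnorm 2 (wt s) ^+ 2 + Hnorm 2 (w s) ^+ 2))%:E
    <= (14 * c^-1 * (2 * decay_bound p M C))%:E)%E.
  apply: Hint => // [s s0|s s0].
    by rewrite mulr_ge0 ?expR_ge0// !addr_ge0 ?sqr_ge0.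
  rewrite mulrCA ler_wpM2l ?expR_ge0// tnorm_sqr.
  have := wx s 0 (ltW s0) z01; have := wx s 1 (ltW s0) o01; have := w12 s; have := z_0 s.
  have := sqr_ge0 (Hnorm 2 (wt s)).
  have : dot (wderiv (w s)) (wderiv (w s)) <= Hnorm 1 (w s) ^+ 2.
    by rewrite Hnorm1_sqr lerDr dot_ge0.
  move: (Hnorm 1 (w s) ^+ 2) (Hnorm 2 (w s) ^+ 2) (Hnorm 2 (wt s) ^+ 2) (L2norm (z s) ^+ 2).
  by move: (dot _ _) => x a b d y; lra.
have I2 : (\int[@lebesgue_measure R]_(s in `[0%R, t]) (expR (2 * alpha * s) *
    (L2norm (z s) ^+ 2 + E1 p w wt s + w s 1 ^+ 4 + w s 0 ^+ 4))%:E
    <= (A2 * c^-1 * (2 * decay_bound p M C))%:E)%E.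
  apply: Hint => // [s s0|s s0].
    have w40 x : 0 <= w s x ^+ 4 by rewrite sqr4; exact: mulr_ge0 (sqr_ge0 _) (sqr_ge0 _).
    exact: mulr_ge0 (expR_ge0 _) (addr_ge0 (addr_ge0 (addr_ge0 (z_0 s) (E1_ge s)) (w40 1)) (w40 0)).
  rewrite mulrCA ler_wpM2l ?expR_ge0//.
  have := E1_le s (ltW s0); have := w4_le s 0 (ltW s0) z01; have := w4_le s 1 (ltW s0) o01.
  have b0 := sqr_ge0 (Hnorm 2 (wt s)); have b1 := w2_0 s; have b2 := z_0 s.
  have b3 := mulr_ge0 kE10 b1; have b4 := mulr_ge0 kE10 b2.
  have b5 := mulr_ge0 M0 b0; have b6 := mulr_ge0 M0 b2.
  rewrite /A2; move: b0 b1 b2 b3 b4 b5 b6.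
  move: (Hnorm 2 (w s) ^+ 2) (Hnorm 2 (wt s) ^+ 2) (L2norm (z s) ^+ 2) (E1 _ _ _ _).
  by move: {+}kE1 (w s 0 ^+ 4) (w s 1 ^+ 4) => k x y a b d f; lra.
have pt : Hnorm 2 (w t) ^+ 2 + Hnorm 1 (wt t) ^+ 2 + L2norm (z t) ^+ 2
     + E p w t + E2 p w wt t <= (1 + kE + kE2) * ((2 + 2 * c^-1) * c^-1 * decay_bound p M C * ex).
  have k1 : 0 <= 1 + kE + kE2 by lra.
  apply: le_trans (ler_wpM2l k1 Hpt).
  have := E_le t (ltW t0); have := E2_le t (ltW t0).
  have := mulr_ge0 kE0 (wt1_0 t); have := mulr_ge0 kE0 (z_0 t).
  have := mulr_ge0 kE20 (w2_0 t); have := mulr_ge0 kE20 (z_0 t).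
  move: (Hnorm 2 (w t) ^+ 2) (Hnorm 1 (wt t) ^+ 2) (L2norm (z t) ^+ 2) (E _ _ _) (E2 _ _ _ _).
  by move: {+}kE {+}kE2 => k k' a b d f g; lra.
have ex0' : (0 <= ex%:E)%E by rewrite lee_fin.
rewrite -lee_fin in pt.
apply: le_trans (leeD (leeD pt (lee_wpmul2l ex0' I1)) (lee_wpmul2l ex0' I2)) _.
rewrite -!EFinM -!EFinD lee_fin NE.
have -> : (1 + kE + kE2) * ((2 + 2 * c^-1) * c^-1 * (`|C| * K * (1 + 4 * B ^+ 2) * r ^+ 2) * ex)
    + ex * (14 * c^-1 * (2 * (`|C| * K * (1 + 4 * B ^+ 2) * r ^+ 2)))
    + ex * (A2 * c^-1 * (2 * (`|C| * K * (1 + 4 * B ^+ 2) * r ^+ 2)))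
    = T * (`|C| * K * (1 + 4 * B ^+ 2)) * (ex * r ^+ 2) by rewrite /T; ring.
rewrite -[leRHS]mulrA ler_wpM2r//; first by rewrite mulr_ge0 ?sqr_ge0.
by apply: le_trans (ler_norm _) _; rewrite lerDr.
Qed.

End BoundaryEnergies.

Theorem theorem2p1 (R : realType) (p : params R) (alpha K : R)
    (hp : admissible_params p) (hK : 0 < K)
    (halpha0 : 0 <= alpha) (halpha : alpha <= alpha_max p)
    (hbeta : 0 < beta p alpha) :
  exists C : R -> R, (forall r, 0 < C r) /\
  forall (w0 : R -> R) (w wt z : R -> R -> R),
    (forall t : R, 0 <= t -> cont01 (wt t) /\ cont01 (z t)) ->
    assumption_A1 p w0 w wt z ->
    assumption_A2 p K w0 w wt z ->
    forall t : R, 0 < t ->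
    ((Hnorm 2 (w t) ^+ 2 + Hnorm 1 (wt t) ^+ 2 + L2norm (z t) ^+ 2
       + E p w t + E2 p w wt t)%:E
     + (expR (- 2 * alpha * t))%:E *
         \int[@lebesgue_measure R]_(s in `[0%R, t])
           (expR (2 * alpha * s) *
             (tnorm (w s) ^+ 2 + Hnorm 2 (wt s) ^+ 2 + Hnorm 2 (w s) ^+ 2))%:E
     + (expR (- 2 * alpha * t))%:E *
         \int[@lebesgue_measure R]_(s in `[0%R, t])
           (expR (2 * alpha * s) *
             (L2norm (z s) ^+ 2 + E1 p w wt s + w s 1 ^+ 4 + w s 0 ^+ 4))%:E
     <= (C (Hnorm 3 w0) * expR (- 2 * alpha * t) * Hnorm 3 w0 ^+ 2)%:E)%E.
Proof.
(* Choosing one constant for each value r of the norm fixes C before the solution is given. *)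
have /choice[C HC] := fun r => decay_of_norm hp r halpha0 hbeta hK.
exists C; split=> [r|w0 w wt z Hcont _ HA]; first by have [] := HC r.
by have [_ H] := HC (Hnorm 3 w0); exact: H.
Qed.
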